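(* Let $M\ge 1$. The following assertions hold. (1) For any two pointed proper quantum metric spaces $\mathbb A=(A,L_A,\mathfrak M_A,\mu_A)$ and $\mathbb B=(B,L_B,\mathfrak M_B,\mu_B)$, if there exists a full topographic quantum $M$-isometry $\pi:\mathbb A\to\mathbb B$ such that $\mu_B\circ\pi=\mu_A$, then $\eth_M(\mathbb A,\mathbb B)=0$. (2) For any two pointed proper quantum metric spaces $\mathbb A$ and $\mathbb B$, $\eth_M(\mathbb B,\mathbb A)=\eth_M(\mathbb A,\mathbb B)$. (3) For any three pointed proper quantum metric spaces $\mathbb A,\mathbb B,\mathbb D$, $$\eth_M(\mathbb A,\mathbb D)\le \eth_M(\mathbb A,\mathbb B)\bigl(1+\eth_M(\mathbb B,\mathbb D)\bigr)^2+\eth_M(\mathbb B,\mathbb D)\bigl(1+\eth_M(\mathbb A,\mathbb B)\bigr)^2 .$$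
   Context: **Basics.** For a C*-algebra $A$: $\mathrm{sa}(A)$ is its self-adjoint part, $S(A)$ its state space, $Q(A)$ the set of positive linear functionals of norm at most $1$; $\mathfrak uA=A$ if $A$ is unital and otherwise $\mathfrak uA=A\oplus\mathbb C$ is the minimal unitization; $1_A$ is the unit of $\mathfrak uA$. An element $h\in\mathrm{sa}(A)$ is strictly positive when $\varphi(h)>0$ for all $\varphi\in S(A)$. A seminorm $L$ on a subspace $\mathrm{dom}(L)\subseteq A$ is hermitian when $a\in\mathrm{dom}(L)$ implies $a^*\in\mathrm{dom}(L)$ and $L(a^* )=L(a)$; then $\mathrm{dom}_{sa}(L)=\mathrm{dom}(L)\cap\mathrm{sa}(A)$. It is a norm modulo constants when it is a norm if $A$ has no unit, and $\{a:L(a)=0\}=\mathbb C1_A$ if $A$ is unital. It is Leibniz when $\mathrm{dom}(L)$ is a subalgebra and $L(ab)\le\|a\|L(b)+L(a)\|b\|$. For $M\ge1$, $\|a\|_{L,M}=\max\{\frac1M\|a\|_A,L(a)\}$. For positive linear functionals $\varphi,\psi$, $\mathsf{bl}_{L,M}(\varphi,\psi)=\sup\{|\varphi(a)-\psi(a)|:a\in\mathrm{dom}_{sa}(L),\|a\|_{L,M}\le1\}$, and $\mathsf{bl}_L=\mathsf{bl}_{L,1}$. For states, $\mathsf{mk}_L(\varphi,\psi)=\sup\{|\varphi(a)-\psi(a)|:a\in\mathrm{dom}_{sa}(L),L(a)\le1\}\in[0,\infty]$. **Spaces.** A separable quantum locally compact metric space (sqlcms) $(A,L)$ is a separable C*-algebra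 $A$ with a Leibniz hermitian norm modulo constants $L$ on a dense *-subalgebra $\mathrm{dom}(L)$ of $A$ such that: (i) $\mathsf{bl}_L$ induces the weak* topology on $S(A)$; (ii) $\{a\in\mathrm{dom}_{sa}(L):L(a)\le1\}$ is norm closed in $\mathrm{sa}(A)$; (iii) there are a strictly positive $h\in\mathrm{sa}(A)$ and $\mu\in S(A)$ with $\mu(h)=1$ such that $\{hah\in\mathfrak uA:a=b+t1_A,\ t\in\mathbb R,\ b\in\mathrm{dom}_{sa}(L),\ L(b)\le1,\ \mu(b)=-t\}$ is bounded. A pin of $(A,L)$ is a state $\mu$ such that $\{\varphi\in S(A):\mathsf{mk}_L(\varphi,\mu)<\infty\}$ is weak* dense in $S(A)$; then $(A,L,\mu)$ is called pinned. An $L$-Lipschitz $\mu$-pinned exhaustive sequence is a sequence $(h_n)$ in $\mathrm{dom}_{sa}(L)$ with $L(h_n)\to0$, $\mu(h_n)\to1$, $\|h_n\|_A\to1$. A topography of $(A,L)$ is an Abelian C*-subalgebra $\mathfrak M$ of $A$ containing some $h\in\mathrm{dom}(L)$ strictly positive in $A$ such that $\{hah\in\mathfrak uA:a=b+t1_A,\ t\in\mathbb R,\ b\in\mathrm{dom}_{sa}(L),\ L(b)\le1,\ \mu(b)=-t\}$ is bounded for some state $\mu$ of $A$ restricting to a character of $\mathfrak M$; $(A,L,\mathfrak M)$ is then a topographic sqlcms. A pointed proper quantum metric space $(A,L,\mathfrak M,\mu)$ is a pinned sqlcms $(A,L,\mu)$ with a topography $\mathfrak M$ such that $\mu$ restricts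 to a character of $\mathfrak M$ and there is an $L$-Lipschitz $\mu$-pinned exhaustive sequence contained in $\mathfrak M$. **Isometries.** A quantum $M$-isometry $\pi:(D,L_D)\to(A,L_A)$ between sqlcms is a surjective *-morphism, proper (mapping an approximate unit to an approximate unit), with $\pi(\mathrm{dom}(L_D))=\mathrm{dom}(L_A)$, $\|a\|_{L_A,M}=\inf\{\|d\|_{L_D,M}:d\in\mathrm{dom}_{sa}(L_D),\pi(d)=a\}$ for all $a\in\mathrm{dom}_{sa}(L_A)$, and $L_A(\pi(d))\le L_D(d)$ for all $d\in\mathrm{dom}_{sa}(L_D)$. It is topographic from $(D,L_D,\mathfrak M_D)$ to $(A,L_A,\mathfrak M_A)$ when $\pi(\mathfrak M_D)\subseteq\mathfrak M_A$ and for all $a\in\mathrm{dom}_{sa}(L_A)\cap\mathfrak M_A$, $\varepsilon>0$ there is $d\in\mathfrak M_D\cap\mathrm{dom}_{sa}(L_D)$ with $\pi(d)=a$, $\|d\|_D\le e^\varepsilon\|a\|_A$, $L_D(d)\le e^{\varepsilon}L_A(a)$. A full topographic quantum $M$-isometry is a bijective one whose inverse is also a topographic quantum $M$-isometry. **Tunnels.** An $M$-tunnel $\tau=(D,L_D,\mathfrak M_D,\pi_A,\pi_B,e)$ from $(A,L_A,\mathfrak M_A,\mu_A)$ to $(B,L_B,\mathfrak M_B,\mu_B)$ consists of a topographic sqlcms $(D,L_D,\mathfrak M_D)$, an element $e\in\mathrm{dom}_{sa}(L_D)\cap\mathfrak M_D$, and topographic quantum $M$-isometries $\pi_A:(D,L_D,\mathfrak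 M_D)\to(A,L_A,\mathfrak M_A)$, $\pi_B:(D,L_D,\mathfrak M_D)\to(B,L_B,\mathfrak M_B)$, such that $\mu_A\circ\pi_A$ is a pin of $(D,L_D)$. Write $eQ(D)e=\{\varphi(e\cdot e):\varphi\in Q(D)\}$, $\pi^*(\varphi)=\varphi\circ\pi$, and $X\subseteq_\varepsilon^{d}Y$ when every $x\in X$ satisfies $\inf_{y\in Y}d(x,y)\le\varepsilon$. The extent $\chi(\tau)$ is the maximum of: $\inf\{\varepsilon>0:eQ(D)e\subseteq_\varepsilon^{\mathsf{bl}_{L_D,M}}\pi_A^*(Q(A))\text{ and }eQ(D)e\subseteq_\varepsilon^{\mathsf{bl}_{L_D,M}}\pi_B^*(Q(B))\}$; $\mathsf{mk}_{L_D}(\mu_A\circ\pi_A,\mu_B\circ\pi_B)$; and $\max\{2M L_D(e),|1-\mu_A(\pi_A(e))|,|1-\mu_B(\pi_B(e))|\}$. The $M$-local quantum metametric is $\eth_M(\mathbb A,\mathbb B)=\inf\{\chi(\tau):\tau\text{ an }M\text{-tunnel from }\mathbb A\text{ to }\mathbb B\}$. *)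

(* Defs.v *)
From HB Require Import structures.
From mathcomp Require Import all_boot all_order all_algebra.
From mathcomp Require Import complex.
From mathcomp Require Import all_classical all_reals all_analysis.

Set Implicit Arguments.
Unset Strict Implicit.
Unset Printing Implicit Defensive.

Import Order.TTheory GRing.Theory Num.Theory.
Import numFieldNormedType.Exports.

Local Open Scope classical_set_scope.
Local Open Scope ring_scope.
Local Open Scope complex_scope.

(* MathComp has no rings without unit, so the product of a possibly nonunital
   C*-algebra is a separate operation on the underlying Banach space. *)
HB.mixin Record CompleteNormedModule_isCStarAlgebra (R : realType) A
    of CompleteNormedModule R[i] A := {
  cmul : A -> A -> A;
  star : A -> A;
  cmulA : associative cmul;
  cmulDl : left_distributive cmul +%R;
  cmulDr : right_distributive cmul +%R;
  cscalerAl : forall (c : R[i]) (a b : A), c *: cmul a b = cmul (c *: a) b;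
  cscalerAr : forall (c : R[i]) (a b : A), c *: cmul a b = cmul a (c *: b);
  starK : involutive star;
  starD : {morph star : a b / a + b};
  starZ : forall (c : R[i]) (a : A), star (c *: a) = c^* *: star a;
  starM : forall a b, star (cmul a b) = cmul (star b) (star a);
  normM_le : forall a b, `|cmul a b| <= `|a| * `|b|;
  norm_starM : forall a, `|cmul (star a) a| = `|a| ^+ 2
}.

#[short(type="cstarType")]
HB.structure Definition CStarAlgebra (R : realType) :=
  { A of CompleteNormedModule_isCStarAlgebra R A & CompleteNormedModule R[i] A }.

Notation "a ** b" := (cmul a b) (at level 40, left associativity) : ring_scope.

(* Norms of modules over R[i] take (nonnegative real) values in R[i]. *)
Definition rnorm (R : realType) (V : normedZmodType R[i]) (x : V) : R :=
  complex.Re `|x|.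

Section CStar.
Variables (R : realType) (A : cstarType R).
Implicit Types (a b u h : A) (S : set A) (phi psi mu : A -> R[i]).

Definition is_unit_of u := forall a, u ** a = a /\ a ** u = a.

Definition sa : set A := [set a | star a = a].

Definition cpos : set A := [set a | exists b, a = star b ** b].

Definition linear_subspace S :=
  S 0 /\ forall (c : R[i]) a b, S a -> S b -> S (c *: a + b).

Definition star_subalgebra S :=
  [/\ linear_subspace S, forall a b, S a -> S b -> S (a ** b) &
      forall a, S a -> S (star a)].

Definition abelian_cstar_subalgebra S :=
  [/\ star_subalgebra S, closed S &
      forall a b, S a -> S b -> a ** b = b ** a].

Definition separable_cstar := exists2 Q : set A, countable Q & dense Q.

Definition positive_functional phi :=
  scalar phi /\ forall a, 0 <= phi (star a ** a).

Definition functional_norm phi : \bar R :=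
  ereal_sup [set (rnorm (phi a : R[i]^o))%:E | a in [set a | rnorm a <= 1]].

Definition state_space : set (A -> R[i]) :=
  [set phi | positive_functional phi /\ functional_norm phi = 1%E].

Definition quasi_state_space : set (A -> R[i]) :=
  [set phi | positive_functional phi /\ (functional_norm phi <= 1)%E].

Definition strictly_positive h :=
  sa h /\ forall phi, state_space phi -> 0 < phi h.

Definition restricts_to_character S mu :=
  (forall a b, S a -> S b -> mu (a ** b) = mu a * mu b) /\
  exists2 a, S a & mu a != 0.

(* The weak* topology is the topology of pointwise convergence. *)
Definition weak_star_open_in_states (U : set (A -> R[i])) :=
  exists2 V : set {ptws A -> R[i]^o}, open V & U = V `&` state_space.

Definition weak_star_dense_in_states (X : set (A -> R[i])) :=
  state_space `<=` closure (X : set {ptws A -> R[i]^o}).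

Definition induces_weak_star (d : (A -> R[i]) -> (A -> R[i]) -> \bar R) :=
  forall U : set (A -> R[i]), U `<=` state_space ->
    weak_star_open_in_states U <->
    (forall phi, U phi -> exists2 r : R, 0 < r &
       forall psi, state_space psi -> (d phi psi < r%:E)%E -> U psi).

(* An increasing net of positive contractions converging to the identity on
   both sides. *)
Definition approximate_unit (I : Type) (le : I -> I -> Prop) (v : I -> A) :=
  [/\ [/\ inhabited I, forall i, le i i,
          forall i j k, le i j -> le j k -> le i k &
          forall i j, exists2 k, le i k & le j k],
      forall i, cpos (v i) /\ rnorm (v i) <= 1,
      forall i j, le i j -> cpos (v j - v i) &
      forall a (r : R), 0 < r -> exists i, forall j, le i j ->
        rnorm (v j ** a - a) < r /\ rnorm (a ** v j - a) < r].

(* h (b + t 1) h in the minimal unitization; it lies in A, which sits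
   isometrically in the unitization: see sandwich_unital and
   sandwich_unitization below. *)
Definition sandwich h b (t : R) : A := h ** b ** h + t%:C *: (h ** h).

Definition unitization_mul (x y : A * R[i]) : A * R[i] :=
  (x.1 ** y.1 + x.2 *: y.1 + y.2 *: x.1, x.2 * y.2).

Lemma sandwich_unital u h b (t : R) : is_unit_of u ->
  h ** (b + t%:C *: u) ** h = sandwich h b t.
Proof.
move=> uP; rewrite cmulDr cmulDl /sandwich -cscalerAr -cscalerAl.
by rewrite (uP h).2.
Qed.

Lemma sandwich_unitization h b (t : R) :
  unitization_mul (unitization_mul (h, 0) (b, t%:C)) (h, 0) =
  (sandwich h b t, 0).
Proof.
rewrite /unitization_mul /= !mul0r !scale0r !addr0.
by rewrite cmulDl -cscalerAl.
Qed.

End CStar.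

Arguments sa {R} A.
Arguments state_space {R} A.
Arguments quasi_state_space {R} A.

(* A function on a subset of A; the values of lval outside ldom are junk. *)
Record lipdata (R : realType) (A : cstarType R) := LipData {
  ldom : set A;
  lval :> A -> R
}.

Section Lip.
Variables (R : realType) (A : cstarType R) (L : lipdata A).
Implicit Types (a b h : A) (S : set A) (phi psi mu : A -> R[i]).

Definition ldom_sa : set A := ldom L `&` sa A.

Definition seminorm_on_dom :=
  [/\ linear_subspace (ldom L),
      forall a b, ldom L a -> ldom L b -> L (a + b) <= L a + L b &
      forall (c : R[i]) a, ldom L a -> L (c *: a) = rnorm (c : R[i]^o) * L a].

Definition hermitian_seminorm :=
  forall a, ldom L a -> ldom L (star a) /\ L (star a) = L a.

Definition norm_modulo_constants :=
  (forall u, is_unit_of u ->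
     [set a | ldom L a /\ L a = 0] = [set c *: u | c in [set: R[i]]]) /\
  ((~ exists u : A, is_unit_of u) -> forall a, ldom L a -> L a = 0 -> a = 0).

Definition leibniz :=
  (forall a b, ldom L a -> ldom L b -> ldom L (a ** b)) /\
  (forall a b, ldom L a -> ldom L b ->
     L (a ** b) <= rnorm a * L b + L a * rnorm b).

Definition lip_norm (M : R) a : R := Num.max (M^-1 * rnorm a) (L a).

Definition bl (M : R) phi psi : \bar R :=
  ereal_sup [set (rnorm (phi a - psi a : R[i]^o))%:E
            | a in [set a | ldom_sa a /\ lip_norm M a <= 1]].

Definition mk phi psi : \bar R :=
  ereal_sup [set (rnorm (phi a - psi a : R[i]^o))%:E
            | a in [set a | ldom_sa a /\ L a <= 1]].

Definition bounded_sandwich h mu :=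
  exists k : R, forall b (t : R), ldom_sa b -> L b <= 1 -> mu b = (- t)%:C ->
    rnorm (sandwich h b t) <= k.

Record is_sqlcms : Prop := IsSqlcms {
  sqlcms_separable : separable_cstar A;
  sqlcms_dom : star_subalgebra (ldom L);
  sqlcms_dense : dense (ldom L);
  sqlcms_seminorm : seminorm_on_dom;
  sqlcms_hermitian : hermitian_seminorm;
  sqlcms_norm : norm_modulo_constants;
  sqlcms_leibniz : leibniz;
  sqlcms_weak_star : induces_weak_star (bl 1);
  sqlcms_closed :
    sa A `&` closure [set a | ldom_sa a /\ L a <= 1]
      `<=` [set a | ldom_sa a /\ L a <= 1];
  sqlcms_bounded : exists h mu, [/\ strictly_positive h, state_space A mu,
    mu h = 1 & bounded_sandwich h mu]
}.

Definition is_pin mu :=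
  state_space A mu /\
  weak_star_dense_in_states
    [set phi | state_space A phi /\ (mk phi mu < +oo)%E].

Definition pinned_exhaustive mu (h : nat -> A) :=
  [/\ forall n, ldom_sa (h n),
      (fun n => L (h n)) @ \oo --> (0 : R),
      (fun n => mu (h n) : R[i]^o) @ \oo --> (1 : R[i]^o) &
      (fun n => rnorm (h n)) @ \oo --> (1 : R)].

Definition is_topography S :=
  abelian_cstar_subalgebra S /\
  exists h mu, [/\ S h, ldom L h, strictly_positive h &
    [/\ state_space A mu, restricts_to_character S mu &
        bounded_sandwich h mu]].

Record is_pointed_proper S mu : Prop := IsPointedProper {
  pp_sqlcms : is_sqlcms;
  pp_pin : is_pin mu;
  pp_topography : is_topography S;
  pp_character : restricts_to_character S mu;
  pp_exhaustive : exists2 h, pinned_exhaustive mu h & forall n, S (h n)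
}.

End Lip.

Record topographic_sqlcms (R : realType) := TopographicSqlcms {
  tq_alg :> cstarType R;
  tq_L : lipdata tq_alg;
  tq_M : set tq_alg;
  tq_sqlcms : is_sqlcms tq_L;
  tq_topography : is_topography tq_L tq_M
}.

Arguments tq_M {R} t.

Record pointed_proper_qms (R : realType) := PointedProperQms {
  pq_alg : cstarType R;
  pq_L : lipdata pq_alg;
  pq_M : set pq_alg;
  pq_mu : pq_alg -> R[i];
  pq_pointed_proper : is_pointed_proper pq_L pq_M pq_mu
}.

Arguments pq_M {R} p.
Arguments pq_mu {R} p.

Definition pq_topographic (R : realType) (AA : pointed_proper_qms R) :
    topographic_sqlcms R :=
  TopographicSqlcms (pp_sqlcms (pq_pointed_proper AA))
    (pp_topography (pq_pointed_proper AA)).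
Coercion pq_topographic : pointed_proper_qms >-> topographic_sqlcms.

Section Isometries.
Variable R : realType.

Definition star_morphism (D A : cstarType R) (pi : D -> A) :=
  [/\ linear pi, {morph pi : a b / a ** b} &
      {morph pi : a / star a}].

Definition proper_morphism (D A : cstarType R) (pi : D -> A) :=
  exists (I : Type) (le : I -> I -> Prop) (v : I -> D),
    approximate_unit le v /\ approximate_unit le (pi \o v).

Record quantum_isometry (M : R) (D A : cstarType R)
    (LD : lipdata D) (LA : lipdata A) (pi : D -> A) : Prop :=
  QuantumIsometry {
  qi_morphism : star_morphism pi;
  qi_surjective : forall a, exists d, pi d = a;
  qi_proper : proper_morphism pi;
  qi_dom : pi @` ldom LD = ldom LA;
  qi_quotient : forall a, ldom_sa LA a ->
    (lip_norm LA M a)%:E = ereal_inf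
      [set (lip_norm LD M d)%:E | d in [set d | ldom_sa LD d /\ pi d = a]];
  qi_contractive : forall d, ldom_sa LD d -> LA (pi d) <= LD d
}.

Record topographic_quantum_isometry (M : R) (D A : topographic_sqlcms R)
    (pi : D -> A) : Prop := TopographicQuantumIsometry {
  tqi_isometry : quantum_isometry M (tq_L D) (tq_L A) pi;
  tqi_sub : pi @` tq_M D `<=` tq_M A;
  tqi_lift : forall a (eps : R), ldom_sa (tq_L A) a -> tq_M A a -> 0 < eps ->
    exists d, [/\ tq_M D d, ldom_sa (tq_L D) d, pi d = a,
      rnorm d <= expR eps * rnorm a & tq_L D d <= expR eps * tq_L A a]
}.

Definition full_topographic_quantum_isometry (M : R)
    (D A : topographic_sqlcms R) (pi : D -> A) :=
  topographic_quantum_isometry M pi /\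
  exists rho : A -> D, [/\ cancel pi rho, cancel rho pi &
    topographic_quantum_isometry M rho].

End Isometries.

Section Tunnels.
Variables (R : realType) (M : R).

Record tunnel (AA BB : pointed_proper_qms R) := Tunnel {
  tn_D : topographic_sqlcms R;
  tn_piA : tn_D -> AA;
  tn_piB : tn_D -> BB;
  tn_e : tn_D;
  tn_e_dom : ldom_sa (tq_L tn_D) tn_e;
  tn_e_M : tq_M tn_D tn_e;
  tn_isoA : topographic_quantum_isometry M tn_piA;
  tn_isoB : topographic_quantum_isometry M tn_piB;
  tn_pin : is_pin (tq_L tn_D) (pq_mu AA \o tn_piA)
}.

Arguments tn_piA {AA BB} t.
Arguments tn_piB {AA BB} t.

Definition included_up_to (T : Type) (d : T -> T -> \bar R) (eps : R)
    (X Y : set T) :=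
  forall x, X x -> (ereal_inf [set d x y | y in Y] <= eps%:E)%E.

(* e Q(D) e *)
Definition compressed_quasi_states (D : cstarType R) (e : D) :
    set (D -> R[i]) :=
  [set (fun d => phi (e ** d ** e)) | phi in quasi_state_space D].

Definition pullback (D A : cstarType R) (pi : D -> A)
    (X : set (A -> R[i])) : set (D -> R[i]) :=
  [set phi \o pi | phi in X].

Section Extent.
Variables (AA BB : pointed_proper_qms R) (tau : tunnel AA BB).
Let LD := tq_L (tn_D tau).
Let muA : tn_D tau -> R[i] := pq_mu AA \o tn_piA tau.
Let muB : tn_D tau -> R[i] := pq_mu BB \o tn_piB tau.

Definition extent_reach : \bar R :=
  ereal_inf [set eps%:E | eps in [set eps : R |
    [/\ 0 < eps,
        included_up_to (bl LD M) eps (compressed_quasi_states (tn_e tau))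
          (pullback (tn_piA tau) (quasi_state_space AA)) &
        included_up_to (bl LD M) eps (compressed_quasi_states (tn_e tau))
          (pullback (tn_piB tau) (quasi_state_space BB))]]].

Definition extent_pins : \bar R := mk LD muA muB.

Definition extent_pivot : R :=
  Num.max (2 * M * LD (tn_e tau))
    (Num.max (rnorm (1 - muA (tn_e tau) : R[i]^o))
             (rnorm (1 - muB (tn_e tau) : R[i]^o))).

Definition extent : \bar R :=
  maxe extent_reach (maxe extent_pins extent_pivot%:E).

End Extent.

Definition metametric (AA BB : pointed_proper_qms R) : \bar R :=
  ereal_inf [set x | exists tau : tunnel AA BB, x = extent tau].

End Tunnels.

(* Main.v *)
(* Tunnels (D1, p_A, p_B, e1) from A to B and (D2, q_B, q_D, e2) from B to D are
   glued on the algebra D1 + D2 with the Lipschitz seminorm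
     max (L1 d1) (L2 d2) (|p_B d1 - q_B d2| / eps),
   which makes the two copies of B agree up to eps.  The pivot of the glued
   tunnel is (e1 f1, e2 f2), where f1 and f2 lift q_B e2 and p_B e1 through p_B
   and q_B.  The factors (1 + chi)^2 come from |e|^2 <= 1 + chi / M for a pivot e
   of a tunnel of extent chi: a state norming e^2 is moved into Q(A) by the
   tunnel and tested on an almost-unit of small Lipschitz constant.  Norming
   states exist by Kelley-Vaught (positivity of a^* a) and Hahn-Banach, and the
   same positivity in the unitization makes *-morphisms contractive.
   Any two states that restrict to characters of a topography are at finite
   Monge-Kantorovich distance, which provides the pins of the glued tunnel and
   of the tunnels read backwards. *)

(* Two obstacles shape the proof. In the absence of a functional calculus, positivity is a norm
   condition, [N (t - x) <= t], and all facts about order are drawn from one square root, the fixed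
   point of a contraction, and from the remark that commuting self-adjoint elements with
   [u^2 + w^2 = c^2] have norm at most [c]. Moreover the parts of a state of a direct sum are not
   states, so properties of state spaces are first extended to positive functionals of norm at most
   1, whose norms add up. The form of the inequality comes from the part of a quasi-state on D2.
   Compression by e2 brings it to Q(B), f2 turns into e1 inside B, and compression by e1 brings it
   to Q(A). The elements tested on the way are [f2 d f2], of size at most [K^2 + 2 M K L(f2)] with K
   a bound for |f2|, that is (1 + chi1)^2 up to slack, and this multiplies chi2. The part on D1
   moves to Q(A) at once but must be rescaled by a bound s for |f1|^2, at the cost (s - 1) M; the
   estimate 1 + chi2 / M turns this cost into chi2. *)
Require Import Defs.
From HB Require Import structures.
From mathcomp Require Import all_boot all_order all_algebra.
From mathcomp Require Import complex ring lra.
From mathcomp Require Import all_classical all_reals all_analysis.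

Set Implicit Arguments.
Unset Strict Implicit.
Unset Printing Implicit Defensive.

Import Order.TTheory GRing.Theory Num.Theory.
Import numFieldNormedType.Exports.

Local Open Scope classical_set_scope.
Local Open Scope ring_scope.
Local Open Scope complex_scope.

(* Module identities are decided by [ring] in the square-zero extension of the
   ring of scalars by the module. *)
Definition sqzero_ext (R : comNzRingType) (V : lmodType R) : Type := (R * V)%type.

Section SquareZero.
Variables (R : comNzRingType) (V : lmodType R).
Local Notation E := (sqzero_ext V).

HB.instance Definition _ := GRing.Zmodule.on E.

Let one : E := (1, 0).
Let mul (x y : E) : E := (x.1 * y.1, x.1 *: y.2 + y.1 *: x.2).

Fact sqzero_mulA : associative mul.
Proof.
move=> x y z; congr pair; rewrite /= ?mulrA // !scalerDr !scalerA addrA.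
by rewrite [y.1 * _]mulrC (mulrC z.1) (mulrC x.1 z.1) (mulrC z.1 x.1).
Qed.
Fact sqzero_mulC : commutative mul.
Proof. by move=> x y; rewrite /mul mulrC addrC. Qed.
Fact sqzero_mul1 : left_id one mul.
Proof. by case=> a v; rewrite /mul /= mul1r scale1r scaler0 addr0. Qed.
Fact sqzero_mulD : left_distributive mul +%R.
Proof.
move=> x y z; congr pair; rewrite /= ?mulrDl //.
by rewrite scalerDl scalerDr addrACA.
Qed.
Fact sqzero_one_neq0 : one != 0.
Proof. by rewrite xpair_eqE oner_eq0. Qed.

HB.instance Definition _ := GRing.Zmodule_isComNzRing.Build E
  sqzero_mulA sqzero_mulC sqzero_mul1 sqzero_mulD sqzero_one_neq0.

Definition sqzero_vec (v : V) : E := (0, v).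
Definition sqzero_scal (a : R) : E := (a, 0).

Lemma sqzero_vec_inj : injective sqzero_vec.
Proof. by move=> v w []. Qed.
Lemma sqzero_vecD v w : sqzero_vec (v + w) = sqzero_vec v + sqzero_vec w.
Proof. by congr pair; rewrite /= addr0. Qed.
Lemma sqzero_vecN v : sqzero_vec (- v) = - sqzero_vec v.
Proof. by congr pair; rewrite /= oppr0. Qed.
Lemma sqzero_vec0 : sqzero_vec 0 = 0.
Proof. by []. Qed.
Lemma sqzero_vecZ a v : sqzero_vec (a *: v) = sqzero_scal a * sqzero_vec v.
Proof. by congr pair; rewrite /= ?mulr0 // scale0r addr0. Qed.
Lemma sqzero_vecMn v n : sqzero_vec (v *+ n) = sqzero_vec v *+ n.
Proof. by elim: n => // n IH; rewrite !mulrS sqzero_vecD IH. Qed.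

Fact sqzero_scal_additive : zmod_morphism sqzero_scal.
Proof. by move=> a b; congr pair; rewrite /= subr0. Qed.
Fact sqzero_scal_multiplicative : monoid_morphism sqzero_scal.
Proof. by split=> // a b; congr pair; rewrite /= !scaler0 addr0. Qed.
HB.instance Definition _ :=
  GRing.isZmodMorphism.Build R E sqzero_scal sqzero_scal_additive.
HB.instance Definition _ :=
  GRing.isMonoidMorphism.Build R E sqzero_scal sqzero_scal_multiplicative.

End SquareZero.

Ltac lmod := apply: sqzero_vec_inj;
  rewrite ?(sqzero_vecD, sqzero_vecN, sqzero_vec0, sqzero_vecMn, sqzero_vecZ);
  ring.

Lemma conj_real (R : realType) (r : R) : Num.conj (r%:C : R[i]) = r%:C.
Proof. exact: conjc_real. Qed.

Lemma half_add_half (R : realType) : 2^-1 + 2^-1 = 1 :> R.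
Proof. by field. Qed.

(** * Positivity in unital C*-algebras *)

Section UnitalCStar.
Variables (R : realType) (T : algType R[i]).

(** Completeness is asked only for sequences with geometrically decreasing increments, the kind that
    the iteration in [uc_sqrt] produces. *)
Record unital_cstar (st : T -> T) (N : T -> R) : Prop := UnitalCStarAxioms {
  uc_ge0 : forall x, 0 <= N x;
  uc_eq0 : forall x, N x = 0 -> x = 0;
  uc_normD : forall x y, N (x + y) <= N x + N y;
  uc_normZ : forall c x, N (c *: x) = complex.Re `|c| * N x;
  uc_normM : forall x y, N (x * y) <= N x * N y;
  uc_norm1 : N 1 = 1;
  uc_starK : involutive st;
  uc_starD : {morph st : x y / x + y};
  uc_starZ : forall c x, st (c *: x) = c^* *: st x;
  uc_starM : forall x y, st (x * y) = st y * st x;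
  uc_norm_starM : forall x, N (st x * x) = N x ^+ 2;
  uc_complete : forall (b : nat -> T) (r : R), 0 <= r < 1 ->
    (forall n, N (b n.+1 - b n) <= r ^+ n) ->
    exists l, forall e : R, 0 < e ->
      exists m, forall n, (m <= n)%N -> N (b n - l) < e
}.

Variables (st : T -> T) (N : T -> R) (H : unital_cstar st N).
Implicit Types (x y z u v w a b : T) (r s t c d : R).

Let N_ge0 := uc_ge0 H.
Let starK := uc_starK H.
Let starM := uc_starM H.

Lemma uc_normZr r x : N (r%:C *: x) = `|r| * N x.
Proof.
by rewrite (uc_normZ H) normc_def /= expr0n /= addr0 sqrtr_sqr.
Qed.

Lemma uc_norm0 : N 0 = 0.
Proof. by rewrite -(scale0r 0) (uc_normZ H) normr0 /= mul0r. Qed.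

Lemma uc_normN x : N (- x) = N x.
Proof. by rewrite -scaleN1r (uc_normZ H) normrN1 /= mul1r. Qed.

Lemma uc_normB x y : N (x - y) <= N x + N y.
Proof. by rewrite -(uc_normN y); exact: (uc_normD H). Qed.

Lemma uc_distC x y : N (x - y) = N (y - x).
Proof. by rewrite -uc_normN opprB. Qed.

Lemma uc_norm_le0 x : (forall e : R, 0 < e -> N x <= e) -> x = 0.
Proof.
move=> h; apply: (uc_eq0 H); apply/eqP; rewrite eq_le N_ge0 andbT.
by apply/ler_addgt0Pr => e e0; rewrite add0r h.
Qed.

Lemma uc_star0 : st 0 = 0.
Proof. by rewrite -(scale0r 0) (uc_starZ H) rmorph0 !scale0r. Qed.

Lemma uc_starN x : st (- x) = - st x.
Proof. by rewrite -[- x]scaleN1r (uc_starZ H) rmorphN rmorph1 scaleN1r. Qed.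

Lemma uc_starB x y : st (x - y) = st x - st y.
Proof. by rewrite (uc_starD H) uc_starN. Qed.

Lemma uc_starZr r x : st (r%:C *: x) = r%:C *: st x.
Proof. by rewrite (uc_starZ H) conj_real. Qed.

Lemma uc_star1 : st 1 = 1.
Proof. by rewrite -[LHS]mulr1 -{2}(starK 1) -starM mulr1 starK. Qed.

Lemma uc_norm_star x : N (st x) = N x.
Proof.
have le y : N y <= N (st y).
  have [->|y0] := eqVneq (N y) 0; first exact: N_ge0.
  have yp : 0 < N y by rewrite lt0r y0 N_ge0.
  by rewrite -(ler_pM2r yp) -expr2 -(uc_norm_starM H) (uc_normM H).
by apply/eqP; rewrite eq_le le andbT -{2}(starK x) le.
Qed.

Definition sc r : T := (r%:C)%:A.

Lemma scD r s : sc (r + s) = sc r + sc s.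
Proof. by rewrite /sc rmorphD scalerDl. Qed.
Lemma scN r : sc (- r) = - sc r.
Proof. by rewrite /sc rmorphN scaleNr. Qed.
Lemma scB r s : sc (r - s) = sc r - sc s.
Proof. by rewrite scD scN. Qed.
Lemma scM r s : sc (r * s) = sc r * sc s.
Proof. by rewrite /sc rmorphM -scalerAl mul1r scalerA. Qed.
Lemma sc1 : sc 1 = 1.
Proof. by rewrite /sc scale1r. Qed.
Lemma sc0 : sc 0 = 0.
Proof. by rewrite /sc scale0r. Qed.
Lemma sc_comm r x : sc r * x = x * sc r.
Proof. by rewrite /sc -scalerAl -scalerAr mul1r mulr1. Qed.
Lemma scZ r x : sc r * x = r%:C *: x.
Proof. by rewrite /sc -scalerAl mul1r. Qed.
Lemma star_sc r : st (sc r) = sc r.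
Proof. by rewrite /sc uc_starZr uc_star1. Qed.
Lemma norm_sc r : N (sc r) = `|r|.
Proof. by rewrite /sc uc_normZr (uc_norm1 H) mulr1. Qed.

(** The equation for [b] reads [b = (y + b * b) / 2]. With [r] the smaller root of
    [N y + r * r = 2 * r], the right side maps the ball of radius [r] to itself and contracts it by
    the factor [r < 1], so the iteration from 0 converges; self-adjointness and commutation pass to
    the limit. *)
Lemma uc_sqrt y : st y = y -> N y < 1 ->
  exists b, [/\ st b = b, N b < 1, (1 - b) * (1 - b) = 1 - y &
                forall z, z * y = y * z -> z * b = b * z].
Proof.
move=> sy y1.
pose r := 1 - Num.sqrt (1 - N y).
have r1 : r < 1 by rewrite /r ltrBlDr ltrDl sqrtr_gt0 subr_gt0.
have r0 : 0 <= r.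
  by rewrite /r subr_ge0 -[leRHS]sqrtr1 ler_wsqrtr // gerBl N_ge0.
have rE : N y + r * r = 2 * r.
  have : (1 - r) ^+ 2 = 1 - N y.
    by rewrite /r opprB addrC subrK sqr_sqrtr // subr_ge0 ltW.
  by move=> e; have := N_ge0 y; lra.
pose f x := (2^-1 : R)%:C *: (y + x * x).
pose b n := iter n f 0.
have b_sa n : st (b n) = b n.
  elim: n => [|n IH]; first exact: uc_star0.
  by rewrite /b iterS -/(b n) /f uc_starZr (uc_starD H) starM IH sy.
have b_le n : N (b n) <= r.
  elim: n => [|n IH]; first by rewrite uc_norm0.
  rewrite /b iterS -/(b n) /f uc_normZr ger0_norm ?invr_ge0 ?ler0n //.
  rewrite mulrC ler_pdivrMr ?ltr0n // mulrC -rE.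
  apply: (le_trans (uc_normD H _ _)); rewrite lerD2l.
  by apply: (le_trans (uc_normM H _ _)); rewrite ler_pM.
have fB x1 x2 : N x1 <= r -> N x2 <= r -> N (f x1 - f x2) <= r * N (x1 - x2).
  move=> l1 l2; rewrite /f -scalerBr uc_normZr ger0_norm ?invr_ge0 ?ler0n //.
  rewrite mulrC ler_pdivrMr ?ltr0n //.
  have -> : y + x1 * x1 - (y + x2 * x2) = x1 * (x1 - x2) + (x1 - x2) * x2.
    rewrite mulrBr mulrBl addrA subrK opprD addrACA subrr add0r //.
  apply: (le_trans (uc_normD H _ _)).
  have e1 : N (x1 * (x1 - x2)) <= r * N (x1 - x2).
    by apply: (le_trans (uc_normM H _ _)); rewrite ler_wpM2r.
  have e2 : N ((x1 - x2) * x2) <= r * N (x1 - x2).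
    by apply: (le_trans (uc_normM H _ _)); rewrite mulrC ler_wpM2r.
  lra.
have b_dist n : N (b n.+1 - b n) <= r ^+ n.
  elim: n => [|n IH].
    rewrite expr0 subr0; exact: (le_trans (b_le _) (ltW r1)).
  rewrite exprS [b n.+2]/(f (b n.+1)) [X in _ - X]/(f (b n)).
  apply: (le_trans (fB _ _ (b_le _) (b_le _))).
  by rewrite ler_wpM2l.
have r01 : 0 <= r < 1 by rewrite r0 r1.
have [l lP] := uc_complete H r01 b_dist.
have lr : N l <= r.
  apply/ler_addgt0Pr => e e0; have [n /(_ _ (leqnn n)) nP] := lP _ e0.
  rewrite -[l](subKr (b n)); apply: (le_trans (uc_normB _ _)).
  by rewrite lerD ?b_le // ltW.
have fl : f l = l.
  apply/eqP; rewrite -subr_eq0; apply/eqP/uc_norm_le0 => e e0.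
  have e30 : 0 < e / 3 by rewrite divr_gt0.
  have [n nP] := lP _ e30.
  have -> : f l - l = (f l - f (b n)) + (b n.+1 - l).
    by rewrite addrA subrK.
  apply: (le_trans (uc_normD H _ _)).
  have h1 : N (f l - f (b n)) <= e / 3.
    apply: (le_trans (fB _ _ lr (b_le _))); rewrite uc_distC.
    by have := nP _ (leqnn n); have := N_ge0 (b n - l); nra.
  by have := nP _ (leqnSn n); lra.
have l_sa : st l = l.
  apply/eqP; rewrite -subr_eq0; apply/eqP/uc_norm_le0 => e e0.
  have e20 : 0 < e / 2 by rewrite divr_gt0.
  have [n /(_ _ (leqnn n)) nP] := lP _ e20.
  have -> : st l - l = - st (b n - l) + (b n - l).
    by rewrite uc_starB b_sa opprB addrA subrK.
  apply: (le_trans (uc_normD H _ _)); rewrite uc_normN uc_norm_star; lra.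
exists l; split => //.
- exact: le_lt_trans lr r1.
- have -> : y = l + l - l * l.
    by rewrite -{1 2}fl /f -scalerDl -rmorphD half_add_half scale1r addrK.
  by rewrite mulrBr mulr1 mulrBl mul1r; lmod.
- move=> z zy.
  have bz n : z * b n = b n * z.
    elim: n => [|n IH]; first by rewrite mulr0 mul0r.
    rewrite /b iterS -/(b n) /f -scalerAl -scalerAr mulrDl mulrDr zy.
    by rewrite mulrA IH -mulrA IH mulrA.
  apply/eqP; rewrite -subr_eq0; apply/eqP/uc_norm_le0 => e e0.
  have e20 : 0 < e / (2 * N z + 1) by rewrite divr_gt0 // ltr_wpDl // mulr_ge0.
  have [n /(_ _ (leqnn n)) nP] := lP _ e20.
  have -> : z * l - l * z = (b n - l) * z - z * (b n - l).
    by rewrite mulrBl mulrBr bz; lmod.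
  apply: (le_trans (uc_normB _ _)).
  have h1 := uc_normM H (b n - l) z; have h2 := uc_normM H z (b n - l).
  move: nP; rewrite ltr_pdivlMr ?ltr_wpDl ?mulr_ge0 // => nP.
  by have := N_ge0 (b n - l); lra.
Qed.

(** As [u] and [w] commute, [v = u + i w] satisfies [st v * v = u * u + w * w], so it has norm [c]
    by the C*-identity, and [u] is the mean of [v] and its adjoint. This takes the place of
    arguments on the spectrum. *)
Lemma uc_circle u w c : 0 <= c -> st u = u -> st w = w -> u * w = w * u ->
  u * u + w * w = sc (c ^+ 2) -> N u <= c.
Proof.
move=> c0 su sw uw e.
pose v := u + 'i *: w.
have sv : st v = u - 'i *: w.
  by rewrite (uc_starD H) (uc_starZ H) su sw conjCi scaleNr.
have ii : 'i * 'i = -1 :> R[i] by rewrite -expr2 sqrCi.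
have Nv : N v = c.
  apply/eqP; rewrite -(eqrXn2 (n := 2)) // -(uc_norm_starM H) sv.
  rewrite mulrBl !mulrDr -!scalerAl -!scalerAr scalerA ii.
  have -> : u * u + 'i *: (u * w) - ('i *: (w * u) + -1 *: (w * w)) =
            u * u + w * w by rewrite uw; lmod.
  by rewrite e norm_sc ger0_norm ?sqr_ge0.
have Nsv : N (st v) = c by rewrite uc_norm_star.
have : u = (2^-1 : R)%:C *: (v + st v).
  have -> : v + st v = u + u by rewrite sv /v; lmod.
  by rewrite scalerDr -scalerDl -rmorphD half_add_half scale1r.
move=> ->; rewrite uc_normZr ger0_norm ?invr_ge0 ?ler0n //.
by have := uc_normD H v (st v); rewrite Nv Nsv; lra.
Qed.

(* In a concrete C*-algebra these are the positive elements. *)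
Definition pos x := st x = x /\ exists2 t, 0 <= t & N (sc t - x) <= t.

Lemma pos_sa x : pos x -> st x = x. Proof. by case. Qed.

Lemma pos_sc r : 0 <= r -> pos (sc r).
Proof.
by move=> r0; split; [exact: star_sc|exists r => //; rewrite subrr uc_norm0].
Qed.

Lemma posD x y : pos x -> pos y -> pos (x + y).
Proof.
move=> [sx [t t0 tx]] [sy [s s0 sy']]; split; first by rewrite (uc_starD H) sx sy.
exists (t + s); first exact: addr_ge0.
have -> : sc (t + s) - (x + y) = (sc t - x) + (sc s - y) by rewrite scD; lmod.
by apply: (le_trans (uc_normD H _ _)); rewrite lerD.
Qed.

Lemma posZ r x : 0 <= r -> pos x -> pos (r%:C *: x).
Proof.
move=> r0 [sx [t t0 tx]]; split; first by rewrite uc_starZr sx.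
exists (r * t); first exact: mulr_ge0.
by rewrite scM scZ -scalerBr uc_normZr ger0_norm // ler_wpM2l.
Qed.

Lemma pos_subr c x : st x = x -> N x <= c -> pos (sc c - x).
Proof.
move=> sx xc; split; first by rewrite uc_starB star_sc sx.
by exists c; [exact: le_trans (N_ge0 x) xc|rewrite subKr].
Qed.

(** After scaling [x] to [z] with [N (z * z) < 1], the root [1 - b] of [1 - z * z] commutes with [z]
    and lies with it on the unit circle; [uc_circle] bounds [1 - b], hence its square [1 - z * z],
    by 1. *)
Lemma pos_sqr x : st x = x -> pos (x * x).
Proof.
move=> sx; split; first by rewrite starM sx.
pose t := N x ^+ 2 + 1.
have t0 : 0 < t by rewrite ltr_wpDl // sqr_ge0.
exists t; first exact: ltW.
pose k := Num.sqrt t^-1.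
have k2 : k * k = t^-1 by rewrite -expr2 sqr_sqrtr // invr_ge0 ltW.
pose z := k%:C *: x.
have sz : st z = z by rewrite uc_starZr sx.
have zz : z * z = t^-1%:C *: (x * x).
  by rewrite /z -scalerAl -scalerAr scalerA -rmorphM k2.
have Nz : N (z * z) < 1.
  rewrite zz uc_normZr ger0_norm ?invr_ge0 ?(ltW t0) // mulrC ltr_pdivrMr //.
  by rewrite mul1r; have := uc_normM H x x; rewrite /t expr2; lra.
have szz : st (z * z) = z * z by rewrite starM sz.
have [b [sb _ bE bC]] := uc_sqrt szz Nz.
have zb : z * b = b * z by apply: bC; rewrite mulrA.
have : N (1 - b) <= 1.
  apply: (@uc_circle _ z) => //; first by rewrite uc_starB uc_star1 sb.
    by rewrite mulrBl mulrBr zb mul1r mulr1.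
  by rewrite bE subrK expr1n sc1.
move=> Nb.
have : N (1 - z * z) <= 1.
  rewrite -bE; apply: (le_trans (uc_normM H _ _)).
  by have := N_ge0 (1 - b); nra.
have -> : sc t - x * x = t%:C *: (1 - z * z).
  by rewrite zz scalerBr scalerA -rmorphM mulfV ?gt_eqF // scale1r.
by move=> h; rewrite uc_normZr gtr0_norm // ler_piMr // ltW.
Qed.

(** [x + sc d] is [t + d] times [1 - y] with [N y < 1] strictly, as [uc_sqrt] demands; a limit
    removes the shift by [d] in each use. *)
Lemma pos_sqrt x d : pos x -> 0 < d ->
  exists w, [/\ pos w, w * w = x + sc d &
                forall z, z * x = x * z -> z * w = w * z].
Proof.
move=> [sx [t t0 tx]] d0.
have td : 0 < t + d by rewrite ltr_wpDl.
pose y := (t + d)^-1%:C *: (sc t - x).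
have sy : st y = y by rewrite uc_starZr uc_starB star_sc sx.
have Ny : N y < 1.
  rewrite uc_normZr ger0_norm ?invr_ge0 ?(ltW td) // mulrC ltr_pdivrMr // mul1r.
  by rewrite (le_lt_trans tx) // ltrDl.
have [b [sb Nb bE bC]] := uc_sqrt sy Ny.
exists ((Num.sqrt (t + d))%:C *: (1 - b)); split.
- apply: posZ; first exact: sqrtr_ge0.
  by rewrite -sc1; apply: pos_subr => //; exact: ltW.
- rewrite -scalerAl -scalerAr scalerA -rmorphM -expr2 sqr_sqrtr ?(ltW td) //.
  rewrite bE scalerBr scalerA -rmorphM mulfV ?gt_eqF // scale1r -/(sc _) scD.
  by lmod.
- move=> z zx; rewrite -scalerAl -scalerAr; congr (_ *: _).
  rewrite mulrBl mulrBr mul1r mulr1 bC // -scalerAl -scalerAr; congr (_ *: _).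
  by rewrite mulrBl mulrBr sc_comm zx.
Qed.

(** With [w] and [s] the roots of [x + d] and [c - x + d], one has
    [(x - c/2)^2 + (w s)^2 = (c/2 + d)^2], so [uc_circle] puts [x] within [c/2 + d] of [c/2]. *)
Lemma norm_pos_le c x : pos x -> pos (sc c - x) -> N x <= c.
Proof.
move=> px pcx; apply/ler_addgt0Pr => d d0.
have [w [pw wE wC]] := pos_sqrt px d0.
have [s [ps sE sC]] := pos_sqrt pcx d0.
have xw : x * w = w * x by exact: wC.
have ws : w * s = s * w.
  by apply: sC; rewrite mulrBl mulrBr -sc_comm xw.
have c0 : 0 <= c.
  have := posD px pcx; rewrite addrC subrK => -[_ [t t0]].
  by rewrite -scB norm_sc ler_norml => /andP[_]; lra.
pose m := c / 2; pose u := x - sc m.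
have su : st u = u by rewrite uc_starB star_sc (pos_sa px).
have sws : st (w * s) = w * s by rewrite starM !pos_sa // ws.
have uws : u * (w * s) = w * s * u.
  have xs : x * s = s * x by apply: sC; rewrite mulrBl mulrBr -sc_comm.
  by rewrite mulrBl mulrBr -sc_comm; congr (_ - _); rewrite mulrA xw -!mulrA xs.
have e : u * u + w * s * (w * s) = sc ((m + d) ^+ 2).
  rewrite -mulrA (mulrA s) -ws -mulrA sE mulrA wE /u.
  rewrite !mulrDl !mulrDr !mulrN !mulNr -!(sc_comm _ x) -!scM !scZ.
  have -> : c = m + m by rewrite /m -mulrDr half_add_half mulr1.
  rewrite expr2 mulrDr !mulrDl !scD (mulrC d m).
  by rewrite -!/(sc _) -?scM; lmod.
have Nu : N u <= m + d by apply: uc_circle uws e; rewrite // /m; lra.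
have -> : x = u + sc m by rewrite subrK.
apply: (le_trans (uc_normD H _ _)); rewrite norm_sc ger0_norm; rewrite /m in Nu *; lra.
Qed.

Lemma norm_pos_sub c x : pos x -> N x <= c -> N (sc c - x) <= c.
Proof.
move=> px xc; apply: norm_pos_le; last by rewrite subKr.
by apply: pos_subr => //; exact: pos_sa.
Qed.

(** If [n] is the norm of the left side, then [n - t - x] is positive, and [norm_pos_le] gives
    [N x <= n - t]. *)
Lemma norm_pos_add t x : pos x -> 0 <= t -> N (sc t + x) = t + N x.
Proof.
move=> px t0; apply/eqP; rewrite eq_le; apply/andP; split.
  by apply: (le_trans (uc_normD H _ _)); rewrite norm_sc ger0_norm.
rewrite addrC -lerBrDr; apply: norm_pos_le => //.
rewrite scB -addrA -opprD; apply: pos_subr => //.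
by rewrite (uc_starD H) star_sc (pos_sa px).
Qed.

(** The constants that witness positivity of [x + sc d] might grow without bound as [d] tends to 0;
    [norm_pos_sub] replaces them by [N x + d]. *)
Lemma pos_closed x : (forall d, 0 < d -> pos (x + sc d)) -> pos x.
Proof.
move=> h; have sx : st x = x.
  have /pos_sa := h _ ltr01.
  by rewrite (uc_starD H) star_sc => /addIr.
split => //; exists (N x) => //; apply/ler_addgt0Pr => d d0.
have -> : sc (N x) - x = sc (N x + d) - (x + sc d) by rewrite scD; lmod.
apply: norm_pos_sub; first exact: h.
by apply: (le_trans (uc_normD H _ _)); rewrite norm_sc gtr0_norm.
Qed.

(** With roots [w] of [x + d] and [s] of [y + d], the product differs from the square [(w s)^2] by
    [d x + d y + d^2], which is at most [e] for the chosen [d]. *)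
Lemma pos_mul x y : pos x -> pos y -> x * y = y * x -> pos (x * y).
Proof.
move=> px py xy; apply: pos_closed => e e0.
pose K := N x + N y.
have K0 : 0 <= K by rewrite addr_ge0.
have Ke : 0 < K + 1 + e by rewrite ltr_wpDl // addr_ge0.
pose d := e / (K + 1 + e).
have d0 : 0 < d by rewrite divr_gt0.
have d1 : d * (K + 1 + e) = e by rewrite divfK // gt_eqF.
have dK : 0 <= e - d * K - d * d by nra.
clearbody d.
have [w [pw wE wC]] := pos_sqrt px d0.
have [s [ps sE sC]] := pos_sqrt py d0.
have ws : w * s = s * w.
  by apply: sC; apply/esym/wC.
have -> : x * y + sc e = w * s * (w * s) + sc (e - d * K - d * d) +
    (d%:C *: (sc (N x) - x) + d%:C *: (sc (N y) - y)).
  rewrite -!mulrA (mulrA s) -ws -(mulrA w) sE mulrA wE mulrDl !mulrDr.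
  by rewrite -(sc_comm d x) -scM !scZ /sc /K; lmod.
apply: posD; first apply: posD.
- by apply: pos_sqr; rewrite starM !pos_sa // ws.
- exact: pos_sc.
- by apply: posD; apply: posZ; rewrite ?(ltW d0) //; apply: pos_subr; rewrite ?pos_sa.
Qed.

Lemma pos_exp x n : pos x -> pos (x ^+ n).
Proof.
move=> px; elim: n => [|n IH]; first by rewrite expr0 -sc1; exact: pos_sc.
by rewrite exprS; apply: pos_mul => //; exact: commrX.
Qed.

(** This replaces the comparison of the spectra of [u = st y * y] and [v = y * st y]. The sum
    [u + v] is half a sum of two squares, so [u <= d] forces [v >= - d]; surrounding [n - v] by
    [st y] and [y] bounds [u * (n - u)], hence the square of [n / 2 - u]. *)
Lemma norm_starM_bounded_above y d : 0 <= d -> pos (sc d - st y * y) ->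
  N (st y * y) <= 7 * d.
Proof.
move=> d0 pd; set u := st y * y; set v := y * st y; set n := N u.
have nE : n = N y ^+ 2 by rewrite /n (uc_norm_starM H).
have n0 : 0 <= n by exact: N_ge0.
have su : st u = u by rewrite starM starK.
have sv : st v = v by rewrite starM starK.
have Nv : N v = n by rewrite /v -{1}(starK y) (uc_norm_starM H) uc_norm_star.
have puv : pos (u + v).
  pose a := y + st y; pose b := 'i *: (y - st y).
  have sa : st a = a by rewrite (uc_starD H) starK addrC.
  have sb : st b = b.
    by rewrite (uc_starZ H) uc_starB starK conjCi /b; lmod.
  have -> : u + v = (2^-1 : R)%:C *: (a * a + b * b).
    have -> : a * a + b * b = u + v + (u + v).
      have ii : 'i * 'i = -1 :> R[i] by rewrite -expr2 sqrCi.
      rewrite /b -scalerAl -scalerAr scalerA ii /a /u /v.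
      by rewrite !mulrDl !mulrDr !mulrN !mulNr; lmod.
    by rewrite scalerDr -scalerDl -rmorphD half_add_half scale1r.
  by apply: posZ; rewrite ?invr_ge0 ?ler0n //; apply: posD; exact: pos_sqr.
have pv : pos (sc d + v).
  have -> : sc d + v = (u + v) + (sc d - u) by lmod.
  exact: posD.
have Nnv : N (sc n - v) <= n + d.
  apply: norm_pos_le; first by apply: pos_subr; rewrite ?Nv.
  by have -> : sc (n + d) - (sc n - v) = sc d + v by rewrite scD; lmod.
have Nw : N (u * (sc n - u)) <= n * (n + d).
  have -> : u * (sc n - u) = st y * (sc n - v) * y.
    by rewrite mulrBr mulrBr mulrBl -!sc_comm /u /v !mulrA.
  apply: (le_trans (uc_normM H _ _)).
  have -> : n * (n + d) = N y * (n + d) * N y by rewrite nE; ring.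
  apply: ler_wpM2r => //; apply: (le_trans (uc_normM H _ _)).
  by rewrite uc_norm_star ler_wpM2l.
(* For [n >= 2 * d] the norm of [q = n / 2 - u] is at least [3 / 2 * n - 2 * d], while its square is
   at most [n^2 / 4 + n * (n + d)]. Together they give [n^2 - 7 * n * d + 4 * d^2 <= 0], the source
   of the constant 7. *)
have [nd|nd] := ltP n (2 * d); first by lra.
pose q := sc (n / 2) - u.
have sq : st q = q by rewrite uc_starB star_sc su.
have qE : q = sc (n / 2 - d) + (sc d - u) by rewrite /q scB; lmod.
have Nq : N q = n / 2 - d + N (sc d - u).
  by rewrite qE norm_pos_add //; lra.
have Nr : n <= d + N (sc d - u).
  have : N (sc d - (sc d - u)) <= d + N (sc d - u).
    by apply: (le_trans (uc_normB _ _)); rewrite norm_sc ger0_norm.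
  by rewrite subKr.
have qq : q * q = sc (n ^+ 2 / 4) - u * (sc n - u).
  have -> : n ^+ 2 / 4 = n / 2 * (n / 2) by field.
  have -> : sc n = sc (n / 2) + sc (n / 2) by rewrite -scD; congr sc; field.
  rewrite /q; move: (n / 2) => m; rewrite scM.
  by rewrite !(mulrBl, mulrBr, mulrDl, mulrDr) -!(sc_comm _ u); lmod.
have Nqq : N q ^+ 2 <= n ^+ 2 / 4 + n * (n + d).
  rewrite -(uc_norm_starM H) sq qq; apply: (le_trans (uc_normB _ _)).
  by rewrite norm_sc ger0_norm ?divr_ge0 ?sqr_ge0 // lerD2l.
rewrite Nq in Nqq.
move: Nr Nqq; set r := N _ => Nr Nqq.
have : (3 / 2 * n - 2 * d) ^+ 2 <= n ^+ 2 / 4 + n * (n + d).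
  apply: le_trans Nqq; rewrite ler_sqr ?nnegrE; lra.
nra.
Qed.

Lemma norm_sa_pow2 x k : st x = x -> N (x ^+ (2 ^ k)) = N x ^+ (2 ^ k).
Proof.
move=> sx; elim: k => [|k IH]; first by rewrite expn0 !expr1.
have sX : st (x ^+ (2 ^ k)) = x ^+ (2 ^ k).
  elim: (2 ^ k)%N => [|m IHm]; first by rewrite expr0 uc_star1.
  by rewrite exprS starM IHm sx -exprSr exprS.
by rewrite expnSr muln2 -addnn !exprD -{1}sX -expr2 (uc_norm_starM H) IH expr2.
Qed.

Lemma uc_normX x n : N (x ^+ n) <= N x ^+ n.
Proof.
elim: n => [|n IH]; first by rewrite !expr0 (uc_norm1 H).
rewrite !exprS; apply: (le_trans (uc_normM H _ _)).
by rewrite ler_wpM2l.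
Qed.

(** With [x = st a * a], the element [z = 1 - x] is positive. Since [m z^m (1 - z) <= 1], the
    element [z^m x = st y * y] with [y = a z^(m/2)] is at most [1 / m], hence of norm at most
    [7 / m]. If [N z > 1], consecutive powers of [z] would differ by more than that for large
    [m]. *)
Lemma pos_starM_contraction a : N a <= 1 -> N (1 - st a * a) <= 1.
Proof.
move=> a1; set x := st a * a.
have [z zE] : exists z, z = 1 - x by exists (1 - x).
rewrite -zE.
have sx : st x = x by rewrite starM starK.
have x1 : N x <= 1 by rewrite (uc_norm_starM H) expr_le1.
have pz : pos z by rewrite zE -sc1; exact: pos_subr.
have xE : x = 1 - z by rewrite zE subKr.
have xz : x * z = z * x by rewrite xE mulrBl mulrBr mul1r mulr1.
have xzn n : x * z ^+ n = z ^+ n * x by exact: commrX.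
(* The increment of this expression from [m] to [m + 1] is [(m + 1) z^m x^2], a product of commuting
   positive elements. *)
have pQ m : pos (1 - m%:R *: (z ^+ m * x) - z ^+ m).
  elim: m => [|m IH].
    by rewrite scale0r subr0 expr0 subrr -sc0; exact: pos_sc.
  have -> : 1 - m.+1%:R *: (z ^+ m.+1 * x) - z ^+ m.+1 =
      (1 - m%:R *: (z ^+ m * x) - z ^+ m) +
      (m.+1%:R : R)%:C *: (z ^+ m * (x * x)).
    have -> : z ^+ m.+1 = z ^+ m - z ^+ m * x.
      by rewrite {1}xE mulrBr mulr1 subKr exprSr.
    rewrite mulrBl -mulrA -addn1 rmorph_nat natrD.
    by lmod.
  apply: posD => //; apply: posZ; first exact: ler0n.
  apply: pos_mul; [exact: pos_exp|exact: pos_sqr|].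
  by rewrite mulrA -xzn -mulrA -xzn mulrA.
rewrite leNgt; apply/negP => z1.
set zeta := N z in z1.
have main k : (zeta - 1) * (2 ^ k.+1)%:R <= 7.
  set m := (2 ^ k.+1)%N.
  have m0 : (0 : R) < m%:R by rewrite ltr0n expn_gt0.
  pose y := a * z ^+ (2 ^ k).
  have yE : st y * y = z ^+ m * x.
    rewrite /y starM (pos_sa (pos_exp _ pz)) -mulrA (mulrA (st a)) -/x xzn.
    by rewrite mulrA -exprD addnn -muln2 -expnSr.
  have : N (st y * y) <= 7 * m%:R^-1.
    apply: norm_starM_bounded_above; first by rewrite invr_ge0 ltW.
    rewrite yE.
    have -> : sc m%:R^-1 - z ^+ m * x = (m%:R^-1 : R)%:C *:
        ((1 - m%:R *: (z ^+ m * x) - z ^+ m) + z ^+ m).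
      rewrite subrK scalerBr scalerA -(rmorph_nat (real_complex R)) -rmorphM.
      by rewrite mulVf ?gt_eqF // scale1r.
    apply: posZ; first by rewrite invr_ge0 ltW.
    by apply: posD => //; exact: pos_exp.
  rewrite yE ler_pdivlMr // => h; apply: le_trans h; apply: ler_wpM2r.
    exact: ltW.
  have zm : N (z ^+ m) <= zeta ^+ m by exact: uc_normX.
  (* The C*-identity computes the norm of [z ^+ n] only for [n] a power of 2; the exponent [2 m] is
     split as [(m + 1) + (m - 1)] to bound [N (z ^+ m.+1)] from below. *)
  have zm1 : zeta ^+ m.+1 <= N (z ^+ m.+1).
    have : N (z ^+ (2 ^ k.+2)) <= N (z ^+ m.+1) * zeta ^+ m.-1.
      have -> : (2 ^ k.+2)%N = (m.+1 + m.-1)%N.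
        by rewrite addSnnS prednK ?expn_gt0 // expnSr muln2 addnn.
      rewrite exprD; apply: (le_trans (uc_normM H _ _)).
      by apply: ler_wpM2l => //; exact: uc_normX.
    rewrite norm_sa_pow2 ?(pos_sa pz) //.
    have -> : (2 ^ k.+2)%N = (m.+1 + m.-1)%N.
      by rewrite addSnnS prednK ?expn_gt0 // expnSr muln2 addnn.
    rewrite exprD ler_pM2r // exprn_gt0 //; exact: lt_trans ltr01 z1.
  have zx : z ^+ m * x = z ^+ m - z ^+ m.+1.
    by rewrite xE mulrBr mulr1 -exprSr.
  have : zeta ^+ m.+1 <= N (z ^+ m * x) + zeta ^+ m.
    apply: (le_trans zm1).
    have -> : z ^+ m.+1 = z ^+ m - z ^+ m * x by rewrite zx subKr.
    by apply: (le_trans (uc_normB _ _)); rewrite addrC lerD2l.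
  have : 1 <= zeta ^+ m by apply: exprn_ege1; exact: ltW.
  by rewrite exprS; nra.
have := archi_boundP (_ : 0 <= 7 / (zeta - 1)).
have z10 : 0 < zeta - 1 by rewrite subr_gt0.
rewrite divr_ge0 ?(ltW z10) // => /(_ isT); set k := Num.bound _.
rewrite ltr_pdivrMr // => hk.
have := main k.
have : (k%:R : R) <= (2 ^ k.+1)%:R.
  by rewrite ler_nat (leq_trans (ltnW (ltn_expl k (ltnSn 1)))) // leq_exp2l.
nra.
Qed.

Lemma pos_starM a : pos (st a * a).
Proof.
split; first by rewrite starM starK.
pose t := N a + 1.
have t0 : 0 < t by rewrite ltr_wpDl.
pose b := t^-1%:C *: a.
have ab : a = t%:C *: b by rewrite scalerA -rmorphM mulfV ?gt_eqF // scale1r.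
have : N (1 - st b * b) <= 1.
  apply: pos_starM_contraction; rewrite uc_normZr ger0_norm ?invr_ge0 ?(ltW t0) //.
  by rewrite mulrC ler_pdivrMr // mul1r lerDl.
move=> h; exists (t * t); first exact: mulr_ge0 (ltW t0) (ltW t0).
have -> : sc (t * t) - st a * a = (t * t)%:C *: (1 - st b * b).
  by rewrite ab uc_starZr -scalerAl -scalerAr scalerA -rmorphM scalerBr.
by rewrite uc_normZr ger0_norm ?mulr_ge0 ?(ltW t0) // ler_piMr // mulr_ge0 ?(ltW t0).
Qed.

End UnitalCStar.

(** * Real-valued norms, complex moduli and elementary C*-algebra identities *)

Section RealNorm.
Variables (R : realType) (V : normedZmodType R[i]).
Implicit Types x y : V.

Lemma rnormE x : `|x| = (rnorm x)%:C.
Proof. by rewrite /rnorm RRe_real // ger0_real. Qed.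

Lemma rnorm_ge0 x : 0 <= rnorm x.
Proof. by rewrite -lecR -rnormE normr_ge0. Qed.

Lemma rnorm0 : rnorm (0 : V) = 0.
Proof. by rewrite /rnorm normr0. Qed.

Lemma rnorm_eq0 x : rnorm x = 0 -> x = 0.
Proof. by move=> h; apply/normr0_eq0; rewrite rnormE h. Qed.

Lemma rnormD x y : rnorm (x + y) <= rnorm x + rnorm y.
Proof. by have := ler_normD x y; rewrite !rnormE -rmorphD lecR. Qed.

Lemma rnormN x : rnorm (- x) = rnorm x.
Proof. by rewrite /rnorm normrN. Qed.

Lemma rnormB x y : rnorm (x - y) <= rnorm x + rnorm y.
Proof. by rewrite -(rnormN y) rnormD. Qed.

Lemma rdistC x y : rnorm (x - y) = rnorm (y - x).
Proof. by rewrite -rnormN opprB. Qed.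

Lemma rnorm_lt x (r : R) : (`|x| < r%:C) = (rnorm x < r).
Proof. by rewrite rnormE ltcR. Qed.

End RealNorm.

Section ComplexAbs.
Variable R : realType.
Implicit Types (c d : R[i]) (r : R).

Definition cabs c : R := rnorm (c : R[i]^o).

Lemma cabs_real r : cabs r%:C = `|r|.
Proof. by rewrite /cabs /rnorm normc_def /= expr0n /= addr0 sqrtr_sqr. Qed.

Lemma cabs_nneg r : 0 <= r -> cabs r%:C = r.
Proof. by move=> r0; rewrite cabs_real ger0_norm. Qed.

Lemma cabsM c d : cabs (c * d) = cabs c * cabs d.
Proof.
by have := normrM c d; rewrite !(@rnormE _ R[i]^o) -rmorphM => /complexI.
Qed.

Lemma cabsE c : `|c| = (cabs c)%:C. Proof. exact: (rnormE (c : R[i]^o)). Qed.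
Lemma cabs_ge0 c : 0 <= cabs c. Proof. exact: rnorm_ge0. Qed.
Lemma cabs0 : cabs 0 = 0. Proof. exact: rnorm0. Qed.
Lemma cabs1 : cabs 1 = 1. Proof. by rewrite cabs_nneg. Qed.
Lemma cabs_eq0 c : cabs c = 0 -> c = 0. Proof. exact: rnorm_eq0. Qed.
Lemma cabsD c d : cabs (c + d) <= cabs c + cabs d. Proof. exact: rnormD. Qed.
Lemma cabsB c d : cabs (c - d) <= cabs c + cabs d. Proof. exact: rnormB. Qed.
Lemma cabsN c : cabs (- c) = cabs c. Proof. exact: rnormN. Qed.
Lemma cdistC c d : cabs (c - d) = cabs (d - c). Proof. exact: rdistC. Qed.
Lemma cabsV c : cabs c^-1 = (cabs c)^-1.
Proof. by have := normfV c; rewrite !cabsE -fmorphV => /complexI. Qed.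

Lemma cabs_conj c : cabs (Num.conj c) = cabs c.
Proof. by apply: complexI; rewrite -!cabsE norm_conjC. Qed.

Lemma cabs_i : cabs 'i = 1.
Proof. by apply: complexI; rewrite -!cabsE normCi. Qed.

Lemma cabs_Re c : `|complex.Re c| <= cabs c.
Proof. by rewrite -lecR -cabsE normc_ge_Re. Qed.

Lemma cabs_Im c : `|complex.Im c| <= cabs c.
Proof.
have -> : complex.Im c = - complex.Re (c * 'i%C) by rewrite ReiNIm opprK.
by rewrite normrN (le_trans (cabs_Re _)) // cabsM cabs_i mulr1.
Qed.

Lemma cabs_le_ReIm c : cabs c <= `|complex.Re c| + `|complex.Im c|.
Proof.
rewrite {1}(complexE c) (le_trans (cabsD _ _)) // cabsM cabs_i mul1r.
by rewrite !cabs_real.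
Qed.

Lemma mulC_conj c : c * Num.conj c = (cabs c ^+ 2)%:C.
Proof. by rewrite rmorphXn -normCK; congr (_ ^+ 2); exact: cabsE. Qed.

(** The value 1 at 0 keeps the modulus equal to 1 in all cases. *)
Definition phase c : R[i] := if c == 0 then 1 else Num.conj c / (cabs c)%:C.

Lemma cabs_phase c : cabs (phase c) = 1.
Proof.
rewrite /phase; case: eqP => [|/eqP c0]; first by rewrite cabs1.
rewrite cabsM cabs_conj cabsV cabs_nneg ?cabs_ge0 // mulfV //.
by apply: contra_neq c0 => /cabs_eq0.
Qed.

Lemma phaseM c : phase c * c = (cabs c)%:C.
Proof.
rewrite /phase; case: eqP => [->|/eqP c0]; first by rewrite mulr0 cabs0.
have c1 : cabs c != 0 by apply: contra_neq c0 => /cabs_eq0.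
rewrite mulrAC (mulrC _ c) mulC_conj -fmorphV -rmorphM expr2 mulfK //.
Qed.

End ComplexAbs.

Section CStarBasics.
Variables (R : realType) (A : cstarType R).
Implicit Types (a b : A) (c : R[i]) (r : R).

Lemma rnormZ c a : rnorm (c *: a) = cabs c * rnorm a.
Proof.
apply: complexI; rewrite -rnormE normrZ (rnormE a) rmorphM.
by congr (_ * _); exact: cabsE.
Qed.

Lemma rnormZr r a : rnorm (r%:C *: a) = `|r| * rnorm a.
Proof. by rewrite rnormZ cabs_real. Qed.

Lemma rnormM a b : rnorm (a ** b) <= rnorm a * rnorm b.
Proof. by have := normM_le a b; rewrite !rnormE -rmorphM lecR. Qed.

Lemma rnorm_starM a : rnorm (star a ** a) = rnorm a ^+ 2.
Proof. by have := norm_starM a; rewrite !rnormE -rmorphXn => /complexI. Qed.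

Lemma rnorm_star a : rnorm (star a) = rnorm a.
Proof.
have le b : rnorm b <= rnorm (star b).
  have [->|b0] := eqVneq (rnorm b) 0; first exact: rnorm_ge0.
  have bp : 0 < rnorm b by rewrite lt0r b0 rnorm_ge0.
  by rewrite -(ler_pM2r bp) -expr2 -rnorm_starM rnormM.
by apply/eqP; rewrite eq_le le andbT -{2}(starK a) le.
Qed.

Lemma cmul0r a : 0 ** a = 0.
Proof. by rewrite -(scale0r (0 : A)) -cscalerAl !scale0r. Qed.
Lemma cmulr0 a : a ** 0 = 0.
Proof. by rewrite -(scale0r (0 : A)) -cscalerAr !scale0r. Qed.
Lemma cmulNr a b : (- a) ** b = - (a ** b).
Proof. by rewrite -[- a]scaleN1r -cscalerAl scaleN1r. Qed.
Lemma cmulrN a b : a ** (- b) = - (a ** b).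
Proof. by rewrite -[- b]scaleN1r -cscalerAr scaleN1r. Qed.
Lemma cmulBl a b d : (a - b) ** d = a ** d - b ** d.
Proof. by rewrite cmulDl cmulNr. Qed.
Lemma cmulBr a b d : d ** (a - b) = d ** a - d ** b.
Proof. by rewrite cmulDr cmulrN. Qed.
Lemma star0 : star (0 : A) = 0.
Proof. by rewrite -(scale0r (0 : A)) starZ rmorph0 !scale0r. Qed.
Lemma starN a : star (- a) = - star a.
Proof. by rewrite -[- a]scaleN1r starZ rmorphN rmorph1 scaleN1r. Qed.
Lemma starB a b : star (a - b) = star a - star b.
Proof. by rewrite starD starN. Qed.
Lemma starZr r a : star (r%:C *: a) = r%:C *: star a.
Proof. by rewrite starZ conj_real. Qed.

Definition re_part a : A := (2^-1 : R)%:C *: (a + star a).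
Definition im_part a : A := (2^-1 : R)%:C *: ('i *: (star a - a)).

Lemma re_part_sa a : sa A (re_part a).
Proof. by rewrite /sa /= /re_part starZr starD starK addrC. Qed.

Lemma im_part_sa a : sa A (im_part a).
Proof.
rewrite /sa /= /im_part starZr starZ starB starK conjCi.
by congr (_ *: _); lmod.
Qed.

Lemma re_im_part a : a = re_part a + 'i *: im_part a.
Proof.
have ii : 'i * 'i = -1 :> R[i] by rewrite -expr2 sqrCi.
rewrite /re_part /im_part !scalerA mulrAC ii mulN1r scaleNr -scalerBr.
have -> : a + star a - (star a - a) = a + a by lmod.
by rewrite scalerDr -scalerDl -rmorphD half_add_half scale1r.
Qed.

Lemma rnorm_re_part a : rnorm (re_part a) <= rnorm a.
Proof.
rewrite rnormZr ger0_norm ?invr_ge0 ?ler0n // mulrC ler_pdivrMr ?ltr0n //.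
by apply: (le_trans (rnormD _ _)); rewrite rnorm_star mulr_natr mulr2n.
Qed.

End CStarBasics.

(** Phrased with a bare distance [d] between indices, since it serves the norm [unorm], which is
    attached to no normed-module structure. *)
Lemma geometric_cauchy (R : realType) (d : nat -> nat -> R) (r C : R) :
  0 <= r < 1 -> (forall i, d i i = 0) ->
  (forall i j k, d i k <= d i j + d j k) ->
  (forall n, d n n.+1 <= C * r ^+ n) ->
  forall e : R, 0 < e -> exists m, forall n, (m <= n)%N -> d m n < e.
Proof.
move=> /andP[r0 r1] dd dtri dr e e0.
have r10 : 0 < 1 - r by rewrite subr_gt0.
have dm m k : d m (m + k)%N <= C * r ^+ m * (1 - r ^+ k) / (1 - r).
  elim: k => [|k IH]; first by rewrite addn0 dd expr0 subrr mulr0 mul0r.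
  rewrite addnS; apply: (le_trans (dtri _ (m + k)%N _)).
  apply: (le_trans (lerD IH (dr _))).
  rewrite ler_pdivlMr // mulrDl divfK ?gt_eqF // exprD exprS.
  by rewrite le_eqVlt; apply/orP; left; apply/eqP; ring.
pose C' := `|C| + 1.
have C'0 : 0 < C' by rewrite ltr_wpDl.
have [m rm] : exists m, r ^+ m < e * (1 - r) / C'.
  have e'0 : 0 < e * (1 - r) / C' by rewrite divr_gt0 ?mulr_gt0.
  have r1' : `|r| < 1 by rewrite ger0_norm.
  have /cvgrPdist_lt /(_ _ e'0) [m _ mP] := @cvg_expr R r r1'.
  exists m; have := mP m (leqnn m).
  by rewrite /= sub0r normrN ger0_norm ?exprn_ge0.
exists m => n mn; rewrite -(subnKC mn); apply: (le_lt_trans (dm _ _)).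
rewrite ltr_pdivrMr //.
move: rm; rewrite ltr_pdivlMr // => rm.
have rk0 : 0 <= 1 - r ^+ (n - m) <= 1.
  by rewrite subr_ge0 exprn_ile1 ?(ltW r1) //= gerBl exprn_ge0.
have rm0 : 0 <= r ^+ m by rewrite exprn_ge0.
apply: le_lt_trans rm; case/andP: rk0; rewrite /C'.
move: (1 - r ^+ _) (r ^+ m) rm0 => u v v0 u0 u1.
have h1 : C * v * u <= `|C| * v * u.
  by rewrite ler_wpM2r // ler_wpM2r // ler_norm.
have h2 : `|C| * v * u <= `|C| * v by rewrite ler_piMr // mulr_ge0.
by apply: (le_trans h1); apply: (le_trans h2); rewrite mulrDr mulr1 mulrC lerDl.
Qed.

Lemma cauchy_seq_lim (K : numFieldType) (V : completeNormedModType K)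
    (b : nat -> V) :
  (forall e : K, 0 < e -> exists m, forall n, (m <= n)%N -> `|b m - b n| < e) ->
  exists l, forall e : K, 0 < e ->
    exists m, forall n, (m <= n)%N -> `|b n - l| < e.
Proof.
move=> h; have /cauchy_cvgP/cvg_ex[l bl] : cauchy (b @ \oo).
  apply: cauchy_exP => e e0; have [m mP] := h _ e0.
  by exists (b m); exists m => // n /= mn; rewrite -ball_normE /=; exact: mP.
exists l => e e0; move/cvgrPdist_lt : bl => /(_ _ e0)[m _ mP].
by exists m => n mn; rewrite distrC; exact: mP.
Qed.

(** * The unitization *)

Section Unitization.
Variables (R : realType) (A : cstarType R).

Definition unitization : Type := (A * R[i])%type.
Local Notation U := unitization.
HB.instance Definition _ := GRing.Lmodule.copy U (A * R[i]^o)%type.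

Implicit Types (x y z : U) (a b : A) (c : R[i]) (r s t : R).

Definition uact x a : A := x.1 ** a + x.2 *: a.
Definition umul x y : U := unitization_mul x y.
Definition uone : U := (0, 1).

Fact umulA : associative umul.
Proof.
move=> x y z; congr pair; rewrite /= ?mulrA //.
rewrite !(cmulDl, cmulDr, cmulA, scalerDr, scalerA).
rewrite -!(cscalerAl, cscalerAr) ?scalerA.
by rewrite (mulrC z.2) (mulrC z.2); lmod.
Qed.
Fact umul1x : left_id uone umul.
Proof.
by case=> a c; rewrite /umul /unitization_mul /= cmul0r scale1r scaler0 addr0 add0r mul1r.
Qed.
Fact umulx1 : right_id uone umul.
Proof.
by case=> a c; rewrite /umul /unitization_mul /= cmulr0 scale1r scaler0 addr0 add0r mulr1.
Qed.
Fact umulDl : left_distributive umul +%R.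
Proof.
move=> x y z; congr pair; rewrite /= ?mulrDl //.
by rewrite !(cmulDl, scalerDl, scalerDr); lmod.
Qed.
Fact umulDr : right_distributive umul +%R.
Proof.
move=> x y z; congr pair; rewrite /= ?mulrDr //.
by rewrite !(cmulDr, scalerDl, scalerDr); lmod.
Qed.
Fact uone_neq0 : uone != 0.
Proof. by rewrite xpair_eqE oner_eq0 andbF. Qed.
HB.instance Definition _ := GRing.Zmodule_isNzRing.Build U
  umulA umul1x umulx1 umulDl umulDr uone_neq0.

Fact uscalerAl (c : R[i]) x y : c *: (x * y) = (c *: x) * y.
Proof.
congr pair; last exact: mulrA.
by rewrite /= !scalerDr -cscalerAl !scalerA (mulrC c y.2).
Qed.
HB.instance Definition _ := GRing.Lmodule_isLalgebra.Build R[i] U uscalerAl.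
Fact uscalerAr (c : R[i]) x y : c *: (x * y) = x * (c *: y).
Proof.
congr pair; last exact: mulrCA.
by rewrite /= !scalerDr -cscalerAr !scalerA (mulrC c x.2).
Qed.
HB.instance Definition _ := GRing.Lalgebra_isAlgebra.Build R[i] U uscalerAr.

Definition ustar x : U := (star x.1, Num.conj x.2).

Let bounded_act x := [set rnorm (uact x a) | a in [set a | rnorm a <= 1]].

(* The scalar part enters the norm because left multiplication on [A] is only
   faithful on the unitization when [A] has no unit. *)
Definition unorm x : R := Num.max (cabs x.2) (sup (bounded_act x)).

Let has_sup_act x : has_sup (bounded_act x).
Proof.
split; first by exists (rnorm (uact x 0)), 0 => //=; rewrite rnorm0.
exists (rnorm x.1 + cabs x.2) => _ [a /= a1 <-].
apply: (le_trans (rnormD _ _)); apply: lerD.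
  by apply: (le_trans (rnormM _ _)); rewrite ler_piMr ?rnorm_ge0.
by rewrite rnormZ ler_piMr ?cabs_ge0.
Qed.

Lemma uactZ x c a : uact x (c *: a) = c *: uact x a.
Proof. by rewrite /uact -cscalerAr scalerDr !scalerA mulrC. Qed.

Lemma unorm_act x a : rnorm (uact x a) <= unorm x * rnorm a.
Proof.
have [a0|a0] := eqVneq (rnorm a) 0.
  rewrite (rnorm_eq0 a0) /uact cmulr0 scaler0 addr0 rnorm0 mulr0 //.
have ap : 0 < rnorm a by rewrite lt0r a0 rnorm_ge0.
have [_ ub] := has_sup_act x.
have : rnorm (uact x ((rnorm a)^-1%:C *: a)) <= sup (bounded_act x).
  apply: sup_ubound => //; exists ((rnorm a)^-1%:C *: a) => //=.
  by rewrite rnormZr ger0_norm ?invr_ge0 ?rnorm_ge0 // mulVf.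
rewrite uactZ rnormZr ger0_norm ?invr_ge0 ?rnorm_ge0 // mulrC.
rewrite ler_pdivrMr // => h; apply: (le_trans h); rewrite ler_wpM2r ?rnorm_ge0 //.
by rewrite le_max lexx orbT.
Qed.

Lemma unorm_snd x : cabs x.2 <= unorm x.
Proof. by rewrite le_max lexx. Qed.

Lemma unorm_le x t : cabs x.2 <= t ->
  (forall a, rnorm (uact x a) <= t * rnorm a) -> unorm x <= t.
Proof.
move=> xc h; rewrite ge_max xc /=; apply: ge_sup; first by case: (has_sup_act x).
move=> _ [a /= a1 <-]; apply: (le_trans (h a)).
by rewrite ler_piMr // (le_trans _ xc) // cabs_ge0.
Qed.

Lemma unorm_ge0 x : 0 <= unorm x.
Proof. exact: le_trans (cabs_ge0 _) (unorm_snd x). Qed.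

Definition uinj a : U := (a, 0).

Lemma uact_uinj a b : uact (uinj a) b = a ** b.
Proof. by rewrite /uact /= scale0r addr0. Qed.

(** Left multiplication by [a] attains its norm in the direction of [star a], by the C*-identity. *)
Lemma unorm_uinj a : unorm (uinj a) = rnorm a.
Proof.
apply/eqP; rewrite eq_le; apply/andP; split.
  apply: unorm_le => [|b]; first by rewrite cabs0 rnorm_ge0.
  by rewrite uact_uinj rnormM.
have [->|a0] := eqVneq (rnorm a) 0; first exact: unorm_ge0.
have ap : 0 < rnorm (star a) by rewrite rnorm_star lt0r a0 rnorm_ge0.
rewrite -(ler_pM2r ap) -{1}(rnorm_star a) -expr2 -rnorm_starM starK.
by rewrite -uact_uinj unorm_act.
Qed.

Lemma uactM x y a : uact (x * y) a = uact x (uact y a).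
Proof.
rewrite /uact /= !(cmulDl, cmulDr, scalerDr) cmulA -!cscalerAl -!cscalerAr !scalerA.
by lmod.
Qed.

Lemma uactD x y a : uact (x + y) a = uact x a + uact y a.
Proof. by rewrite /uact /= cmulDl scalerDl addrACA. Qed.

Lemma uactZl c x a : uact (c *: x) a = c *: uact x a.
Proof. by rewrite /uact /= scalerDr scalerA cscalerAl. Qed.

Lemma star_uact x a b : star (uact x a) ** b = star a ** uact (ustar x) b.
Proof.
rewrite /uact /= starD starM starZ cmulDl cmulDr -cmulA -cscalerAl -cscalerAr //.
Qed.

Fact unormD x y : unorm (x + y) <= unorm x + unorm y.
Proof.
apply: unorm_le => [|a].
  by apply: (le_trans (cabsD _ _)); rewrite lerD ?unorm_snd.
rewrite uactD mulrDl; apply: (le_trans (rnormD _ _)).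
by rewrite lerD ?unorm_act.
Qed.

Fact unormM x y : unorm (x * y) <= unorm x * unorm y.
Proof.
apply: unorm_le => [|a].
  by rewrite cabsM ler_pM ?cabs_ge0 ?unorm_snd.
rewrite uactM; apply: (le_trans (unorm_act _ _)).
by rewrite -mulrA ler_wpM2l ?unorm_ge0 ?unorm_act.
Qed.

Fact unormZ_le c x : unorm (c *: x) <= cabs c * unorm x.
Proof.
apply: unorm_le => [|a].
  by rewrite cabsM ler_wpM2l ?cabs_ge0 ?unorm_snd.
by rewrite uactZl rnormZ -mulrA ler_wpM2l ?cabs_ge0 ?unorm_act.
Qed.

(** The square of [rnorm (uact x a)] is the norm of [star a ** uact (ustar x * x) a], so the
    C*-identity of [A] transfers to operators acting on [A]. *)
Fact unorm_starM_ge x : unorm x ^+ 2 <= unorm (ustar x * x).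
Proof.
suff h : unorm x <= Num.sqrt (unorm (ustar x * x)).
  rewrite -[leRHS]sqr_sqrtr ?unorm_ge0 // ler_sqr ?nnegrE ?sqrtr_ge0 ?unorm_ge0 //.
have q0 := unorm_ge0 (ustar x * x).
apply: unorm_le => [|a].
  rewrite -(ler_sqr (x := cabs _)) ?nnegrE ?sqrtr_ge0 ?cabs_ge0 // sqr_sqrtr //.
  apply: le_trans (unorm_snd _); rewrite /= cabsM cabs_conj expr2 //.
rewrite -(ler_sqr (x := rnorm _)) ?nnegrE ?mulr_ge0 ?sqrtr_ge0 ?rnorm_ge0 //.
rewrite exprMn sqr_sqrtr // -rnorm_starM star_uact -uactM.
apply: (le_trans (rnormM _ _)); rewrite rnorm_star expr2 mulrCA.
by rewrite ler_wpM2l ?rnorm_ge0 ?unorm_act.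
Qed.

Fact ustarK : involutive ustar.
Proof. by case=> a c; rewrite /ustar /= starK conjCK. Qed.

Lemma unorm_le_sum x : unorm x <= rnorm x.1 + cabs x.2.
Proof.
apply: unorm_le => [|a]; first by rewrite lerDr rnorm_ge0.
rewrite mulrDl; apply: (le_trans (rnormD _ _)).
by rewrite lerD ?rnormM // rnormZ.
Qed.

(** The vector part is [x] minus its scalar part, each of norm at most [unorm x]; thus a Cauchy
    sequence for [unorm] has Cauchy coordinates. *)
Lemma rnorm_fst_le x : rnorm x.1 <= 2 * unorm x.
Proof.
have -> : rnorm x.1 = unorm (x + (- x.2) *: (1 : U)).
  rewrite -unorm_uinj; congr unorm; congr pair => /=.
    by rewrite scaler0 addr0.
  by change (0 = x.2 + - x.2 * 1 :> R[i]); rewrite mulr1 subrr.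
apply: (le_trans (unormD _ _)); rewrite mulr_natl mulr2n lerD2l.
apply: (le_trans (unorm_le_sum _)) => /=.
by rewrite scaler0 rnorm0 add0r (le_trans _ (unorm_snd x)) // cabsM cabs1 mulr1 cabsN.
Qed.

Fact unorm_complete (b : nat -> U) (r : R) : 0 <= r < 1 ->
  (forall n, unorm (b n.+1 - b n) <= r ^+ n) ->
  exists l, forall e : R, 0 < e ->
    exists m, forall n, (m <= n)%N -> unorm (b n - l) < e.
Proof.
move=> r01 h.
have unormN x : unorm (- x) <= unorm x.
  by rewrite -scaleN1r (le_trans (unormZ_le _ _)) // cabsN cabs1 mul1r.
have unorm0 : unorm (0 : U) = 0.
  apply/eqP; rewrite eq_le unorm_ge0 andbT (le_trans (unorm_le_sum _)) //.
  by rewrite rnorm0 cabs0 addr0.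
have cauchy_b : forall e : R, 0 < e ->
    exists m, forall n, (m <= n)%N -> unorm (b m - b n) < e.
  apply: (geometric_cauchy (d := fun i j => unorm (b i - b j)) (C := 1) r01).
  - by move=> k; rewrite subrr.
  - move=> i j k; have -> : b i - b k = (b i - b j) + (b j - b k).
      by rewrite addrA subrK.
    exact: unormD.
  - by move=> n; rewrite mul1r -opprB (le_trans (unormN _)).
have [la laP] : exists l : A, forall e : R[i], 0 < e ->
    exists m, forall n, (m <= n)%N -> `|(b n).1 - l| < e.
  apply: cauchy_seq_lim => e e0.
  have eR : e = (complex.Re e)%:C by rewrite RRe_real // gtr0_real.
  have e20 : 0 < complex.Re e / 2 by rewrite divr_gt0 // -ltcR -eR.
  have [m mP] := cauchy_b _ e20; exists m => n /mP lt.
  rewrite eR rnorm_lt; apply: (le_lt_trans (rnorm_fst_le (b m - b n))).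
  by rewrite mulrC -ltr_pdivlMr.
have [lr lrP] : exists l : R^o, forall e : R, 0 < e ->
    exists m, forall n, (m <= n)%N -> `|complex.Re (b n).2 - l| < e.
  apply: (@cauchy_seq_lim R R^o) => e e0.
  have [m mP] := cauchy_b _ e0; exists m => n /mP lt.
  apply: le_lt_trans lt; rewrite -raddfB /= (le_trans (cabs_Re _)) //.
  exact: (unorm_snd (b m - b n)).
have [li liP] : exists l : R^o, forall e : R, 0 < e ->
    exists m, forall n, (m <= n)%N -> `|complex.Im (b n).2 - l| < e.
  apply: (@cauchy_seq_lim R R^o) => e e0.
  have [m mP] := cauchy_b _ e0; exists m => n /mP lt.
  apply: le_lt_trans lt; rewrite -raddfB /= (le_trans (cabs_Im _)) //.
  exact: (unorm_snd (b m - b n)).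
exists (la, (lr +i* li)%C) => e e0.
have e30 : 0 < e / 3 by rewrite divr_gt0.
have [|m1 h1] := laP (e / 3)%:C; first by rewrite ltcR.
have [m2 h2] := lrP _ e30; have [m3 h3] := liP _ e30.
exists (maxn m1 (maxn m2 m3)) => n; rewrite !geq_max => /and3P[n1 n2 n3].
apply: (le_lt_trans (unorm_le_sum _)) => /=.
have := h1 _ n1; rewrite rnorm_lt => l1.
have := cabs_le_ReIm ((b n).2 - (lr +i* li)%C); rewrite !raddfB /= => l2.
have := h2 _ n2; have := h3 _ n3; lra.
Qed.

Lemma unitization_cstar : unital_cstar ustar unorm.
Proof.
have normZ c x : unorm (c *: x) = cabs c * unorm x.
  apply/eqP; rewrite eq_le unormZ_le /=.
  have [->|c0] := eqVneq c 0; first by rewrite cabs0 mul0r unorm_ge0.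
  have cp : 0 < cabs c.
    by rewrite lt0r cabs_ge0 andbT; apply: contra_neq c0 => /cabs_eq0.
  have := unormZ_le c^-1 (c *: x).
  by rewrite scalerA mulVf // scale1r cabsV mulrC ler_pdivlMr // mulrC.
have starM x y : ustar (x * y) = ustar y * ustar x.
  congr pair; last by rewrite /= rmorphM mulrC.
  by rewrite /= !starD starM !starZ addrAC.
split.
- exact: unorm_ge0.
- move=> x x0.
  have x2 : x.2 = 0.
    by apply: cabs_eq0; apply/eqP; rewrite eq_le cabs_ge0 -x0 unorm_snd.
  have xE : x = uinj x.1 by case: x x2 {x0} => ? ? /= ->.
  by move: x0; rewrite xE unorm_uinj => /rnorm_eq0 ->.
- exact: unormD.
- exact: normZ.
- exact: unormM.
- apply/eqP; rewrite eq_le; apply/andP; split.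
    apply: unorm_le => [|a]; first by rewrite cabs1.
    by rewrite /uact /= cmul0r scale1r add0r mul1r.
  by rewrite -[leLHS](cabs1 R) (unorm_snd 1).
- exact: ustarK.
- by move=> x y; rewrite /ustar /= starD rmorphD.
- by move=> c x; rewrite /ustar /= starZ rmorphM.
- exact: starM.
- move=> x; apply/eqP; rewrite eq_le unorm_starM_ge andbT.
  apply: (le_trans (unormM _ _)); rewrite expr2 ler_wpM2r ?unorm_ge0 //.
  have := le_trans (unorm_starM_ge (ustar x)) (unormM _ _); rewrite ustarK expr2.
  have [->|x0] := eqVneq (unorm (ustar x)) 0; first by rewrite unorm_ge0.
  by rewrite ler_pM2r // lt0r x0 unorm_ge0.
- exact: unorm_complete.
Qed.

End Unitization.

(** * The Hahn-Banach theorem and norming functionals *)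

Section HahnBanach.
Variables (R : realType) (V : lmodType R).
Implicit Types (p q : V -> R) (x y z : V) (r s t : R).

(** Homogeneity is only an inequality, which is easier to verify for infima; applied to [r] and
    [r^-1] it becomes the equality [sublinear_homo]. *)
Definition sublinear p :=
  [/\ forall x y, p (x + y) <= p x + p y,
      forall r x, 0 < r -> p (r *: x) <= r * p x & p 0 = 0].

Lemma sublinear_homo p r x : sublinear p -> 0 <= r -> p (r *: x) = r * p x.
Proof.
move=> [_ pZ p0]; rewrite le_eqVlt => /predU1P[<-|r0].
  by rewrite scale0r mul0r.
apply/eqP; rewrite eq_le pZ //=.
have := pZ r^-1 (r *: x); rewrite invr_gt0 => /(_ r0).
by rewrite scalerA mulVf ?gt_eqF // scale1r mulrC ler_pdivlMr // mulrC.
Qed.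

Lemma sublinear_ge p x : sublinear p -> - p (- x) <= p x.
Proof. by move=> [pD _ p0]; rewrite lerNl -subr_ge0 opprK -p0 -(addNr x) pD. Qed.

(* The largest sublinear functional below [p] that is additive along [y]. *)
Definition tilt p y x := inf [set p (x + t *: y) - t * p y | t in [set t | 0 <= t]].

Section Tilt.
Variables (p : V -> R) (y : V).
Hypothesis psub : sublinear p.

Let tset x := [set p (x + t *: y) - t * p y | t in [set t | 0 <= t]].

Let tset_lb x : lbound (tset x) (- p (- x)).
Proof.
move=> _ [t /= t0 <-]; rewrite -(sublinear_homo _ psub) //.
have [pD _ _] := psub; have := pD (x + t *: y) (- x).
by rewrite addrAC subrr add0r; lra.
Qed.

Lemma tilt_le t x : 0 <= t -> tilt p y x <= p (x + t *: y) - t * p y.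
Proof.
by move=> t0; apply: ge_inf; [exists (- p (- x)); exact: tset_lb|exists t].
Qed.

Lemma tilt_ge r x : (forall t, 0 <= t -> r <= p (x + t *: y) - t * p y) ->
  r <= tilt p y x.
Proof.
move=> h; apply: lb_le_inf; first by exists (p (x + 0 *: y) - 0 * p y), 0 => /=.
by move=> _ [t /= t0 <-]; exact: h.
Qed.

Lemma tilt_le_id x : tilt p y x <= p x.
Proof.
by apply: (le_trans (tilt_le _ (lexx 0))); rewrite scale0r addr0 mul0r subr0.
Qed.

Lemma tilt_sublinear : sublinear (tilt p y).
Proof.
have [pD pZ p0] := psub.
split=> [u v|r x r0|].
- rewrite -lerBlDr; apply: tilt_ge => s s0.
  rewrite lerBlDl -lerBlDr; apply: tilt_ge => t t0.
  rewrite lerBlDl; apply: (le_trans (tilt_le _ (addr_ge0 t0 s0))).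
  have -> : u + v + (t + s) *: y = (v + t *: y) + (u + s *: y).
    by rewrite scalerDl; lmod.
  by have := pD (v + t *: y) (u + s *: y); lra.
- rewrite -ler_pdivrMl //; apply: tilt_ge => t t0; rewrite ler_pdivrMl //.
  apply: (le_trans (tilt_le _ (mulr_ge0 (ltW r0) t0))).
  rewrite -scalerA -scalerDr mulrBr mulrA lerD2r; exact: pZ.
- apply/eqP; rewrite eq_le; apply/andP; split.
    by rewrite -[leRHS]p0; exact: tilt_le_id.
  by apply: tilt_ge => t t0; rewrite add0r (sublinear_homo _ psub) // subrr.
Qed.

(** A linear functional below the tilt is therefore at most [- p y] at [- y], that is at least [p y]
    at [y]. *)
Lemma tiltN : tilt p y (- y) <= - p y.
Proof.
have [_ _ p0] := psub.
apply: (le_trans (tilt_le _ ler01)).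
by rewrite scale1r addNr p0 mul1r sub0r.
Qed.

End Tilt.

(** A minimal sublinear functional [q] below [p] equals each of its tilts, which makes it
    superadditive, hence linear. *)
Lemma sublinear_minimal p : sublinear p ->
  exists2 f, (forall x y, f (x + y) = f x + f y) /\
             (forall r x, f (r *: x) = r * f x) & forall x, f x <= p x.
Proof.
move=> psub.
pose T := {q : V -> R | sublinear q /\ forall x, q x <= p x}.
(* Zorn provides a maximal element, so the order is the reverse of the pointwise one. *)
pose below (q1 q2 : T) := forall x, sval q2 x <= sval q1 x.
have [q qmin] : exists t : T, forall q : T, below t q -> q = t.
  suff [t tP] : exists t : T, forall q : T, `[< below t q >] -> q = t.
    by exists t => q /asboolP/tP.
  apply: Zorn => [q|q1 q2 q3 /asboolP h12 /asboolP h23|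
      q1 q2 /asboolP h12 /asboolP h21|C Ctot].
  - by apply/asboolP => x.
  - by apply/asboolP => x; exact: le_trans (h23 x) (h12 x).
  - case: q1 q2 h12 h21 => [q1 P1] [q2 P2] /= h12 h21.
    have e : q1 = q2.
      by apply/funext => x; apply/eqP; rewrite eq_le h21 h12.
    by case: q2 / e P2 {h12 h21} => P2; congr exist; exact: Prop_irrelevance.
  have [[c0 Cc0]|C0] := pselect (exists c, C c); last first.
    by exists (exist _ p (conj psub (fun x => lexx _))) => c Cc; case: C0; exists c.
  (* The pointwise infimum bounds the chain; it is subadditive because any two members of a chain
     have a common lower one. *)
  pose m x := inf [set sval c x | c in C].
  have lb x : has_lbound [set sval c x | c in C].
    exists (- p (- x)) => _ [c Cc <-]; case: (svalP c) => cs cp.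
    by apply: le_trans (sublinear_ge _ cs); rewrite lerN2.
  have m_le c x : C c -> m x <= sval c x.
    by move=> Cc; apply: ge_inf => //; exists c.
  have m_ge r x : (forall c, C c -> r <= sval c x) -> r <= m x.
    move=> h; apply: lb_le_inf; first by exists (sval c0 x), c0.
    by move=> _ [c Cc <-]; exact: h.
  have msub : sublinear m.
    split=> [x y|r x r0|].
    - rewrite -lerBlDr; apply: (@m_ge) => c1 C1.
      rewrite lerBlDl -lerBlDr.
      apply: (@m_ge) => c2 C2; rewrite lerBlDl.
      have [c [Cc h1 h2]] : exists c, [/\ C c, below c1 c & below c2 c].
        by have [/asboolP h|/asboolP h] := Ctot _ _ C1 C2; [exists c2|exists c1]; split => // z.
      apply: (le_trans (m_le _ _ Cc)).
      case: (svalP c) => -[cD _ _] _.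
      apply: (le_trans (cD _ _)); exact: lerD (h1 x) (h2 y).
    - rewrite -ler_pdivrMl //; apply: (@m_ge) => c Cc; rewrite ler_pdivrMl //.
      by apply: (le_trans (m_le _ _ Cc)); case: (svalP c) => -[_ cZ _] _; exact: cZ.
    - apply/eqP; rewrite eq_le; apply/andP; split.
        by apply: (le_trans (m_le _ _ Cc0)); case: (svalP c0) => -[_ _ ->].
      by apply: (@m_ge) => c Cc; case: (svalP c) => -[_ _ ->].
  have mp x : m x <= p x.
    by apply: (le_trans (m_le _ _ Cc0)); case: (svalP c0).
  by exists (exist _ m (conj msub mp)) => c Cc; apply/asboolP => x; exact: m_le.
case: q qmin => q [qsub qp] /= qmin.
have tiltE y : tilt q y = q.
  have tp x : tilt q y x <= p x by apply: le_trans (tilt_le_id _ qsub _) (qp x).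
  have := qmin (exist _ (tilt q y) (conj (tilt_sublinear y qsub) tp)).
  by move=> /(_ (fun x => tilt_le_id y qsub x)) [].
have qD x y : q (x + y) = q x + q y.
  have [qD _ _] := qsub; apply/eqP; rewrite eq_le qD /=.
  have := tilt_le y qsub x ler01; rewrite tiltE scale1r mul1r; lra.
exists q => //; split => // r x.
have [_ _ q0] := qsub.
have qN z : q (- z) = - q z by apply/eqP; rewrite -addr_eq0 -qD addNr q0.
have [r0|r0] := leP 0 r; first exact: sublinear_homo.
rewrite -[r]opprK scaleNr qN sublinear_homo ?mulNr // oppr_ge0 ltW //.
Qed.

(** No extension from a subspace is made: a linear functional below the tilt of [p] along [v] is
    below [p] and is forced to agree with it at [v]. *)
Theorem hahn_banach p v : sublinear p ->
  exists f, [/\ forall x y, f (x + y) = f x + f y,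
    forall r x, f (r *: x) = r * f x, forall x, f x <= p x & f v = p v].
Proof.
move=> psub; have [f [fD fZ] fp] := sublinear_minimal (tilt_sublinear v psub).
exists f; split=> // [x|]; first exact: le_trans (fp x) (tilt_le_id _ psub _).
apply/eqP; rewrite eq_le (le_trans (fp v)) ?tilt_le_id //=.
have := le_trans (fp (- v)) (tiltN v psub).
by rewrite -scaleN1r fZ mulN1r lerN2.
Qed.

End HahnBanach.

(** * Star-morphisms are contractive *)

Section Contraction.
Variables (R : realType) (D A : cstarType R) (pi : D -> A).
Hypothesis pi_star : star_morphism pi.

Lemma star_morphismD a b : pi (a + b) = pi a + pi b.
Proof. by case: pi_star => lin _ _; rewrite -[a]scale1r lin !scale1r. Qed.

Lemma star_morphism0 : pi 0 = 0.
Proof. by apply: (addrI (pi 0)); rewrite -star_morphismD !addr0. Qed.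

Lemma star_morphismZ (c : R[i]) a : pi (c *: a) = c *: pi a.
Proof.
by case: pi_star => lin _ _; rewrite -[c *: a]addr0 lin star_morphism0 addr0.
Qed.

Lemma star_morphismN a : pi (- a) = - pi a.
Proof. by rewrite -scaleN1r star_morphismZ scaleN1r. Qed.

Lemma star_morphismB a b : pi (a - b) = pi a - pi b.
Proof. by rewrite star_morphismD star_morphismN. Qed.

Lemma star_morphismM a b : pi (a ** b) = pi a ** pi b.
Proof. by case: pi_star. Qed.

Lemma star_morphism_star a : pi (star a) = star (pi a).
Proof. by case: pi_star. Qed.

Lemma star_morphism_sa a : sa D a -> sa A (pi a).
Proof. by rewrite /sa /= -star_morphism_star => ->. Qed.

Let upi (x : unitization D) : unitization A := (pi x.1, x.2).

(* 1 - x^2 = (1 - b)^2 makes pi x the real part of the unitary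
   pi x + i pi (1 - b). *)
Let pi_sa_le1 x : sa D x -> rnorm x < 1 -> rnorm (pi x) <= 1.
Proof.
move=> sx x1.
have HD := unitization_cstar D; have HA := unitization_cstar A.
have upiM y z : upi (y * z) = upi y * upi z.
  by congr pair; rewrite /= !star_morphismD star_morphismM !star_morphismZ.
have upiB y z : upi (y - z) = upi y - upi z.
  by congr pair; rewrite /= star_morphismB.
have upi1 : upi 1 = 1 by congr pair; rewrite /= star_morphism0.
have sux : ustar (uinj x) = uinj x by rewrite /ustar /= sx rmorph0.
pose y := uinj x * uinj x.
have sy : ustar y = y by rewrite /y (uc_starM HD) sux.
have y1 : unorm y < 1.
  rewrite (le_lt_trans (uc_normM HD _ _)) // unorm_uinj.
  by have := rnorm_ge0 x; nra.
have [b [sb _ bE bC]] := uc_sqrt HD sy y1.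
have xb : uinj x * b = b * uinj x by apply: bC; rewrite mulrA.
rewrite -unorm_uinj; apply: (@uc_circle _ _ _ _ HA _ (upi (1 - b))) => //.
- by rewrite /ustar /= -star_morphism_star sx rmorph0.
- have sb1 : ustar (1 - b) = 1 - b by rewrite (uc_starB HD) (uc_star1 HD) sb.
  have upi_star z : ustar (upi z) = upi (ustar z).
    by congr pair; rewrite /= star_morphism_star.
  by rewrite upi_star sb1.
- change (upi (uinj x) * upi (1 - b) = upi (1 - b) * upi (uinj x)).
  by rewrite -!upiM mulrBr mulrBl mulr1 mul1r xb.
- change (upi (uinj x) * upi (uinj x) + upi (1 - b) * upi (1 - b) = sc _ (1 ^+ 2)).
  by rewrite -!upiM bE upiB upi1 addrC subrK expr1n sc1.
Qed.

Lemma star_morphism_contractive a : rnorm (pi a) <= rnorm a.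
Proof.
have h x : sa D x -> rnorm (pi x) <= rnorm x.
  move=> sx; apply/ler_addgt0Pr => e e0.
  have t0 : 0 < rnorm x + e by rewrite ltr_wpDl // rnorm_ge0.
  have : rnorm (pi ((rnorm x + e)^-1%:C *: x)) <= 1.
    apply: pi_sa_le1; first by rewrite /sa /= starZr sx.
    rewrite rnormZr ger0_norm ?invr_ge0 ?(ltW t0) // mulrC ltr_pdivrMr // mul1r.
    by rewrite ltrDl.
  rewrite star_morphismZ rnormZr ger0_norm ?invr_ge0 ?(ltW t0) // mulrC.
  by rewrite ler_pdivrMr // mul1r.
rewrite -(ler_sqr (x := rnorm _)) ?nnegrE ?rnorm_ge0 //.
rewrite -!rnorm_starM -star_morphism_star -star_morphismM.
by apply: h; rewrite /sa /= starM starK.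
Qed.

End Contraction.

(** * Norming positive functionals *)

Section NormingFunctional.
Variables (R : realType) (A : cstarType R).

(** A second name for [A], so that it can carry a module structure over the reals beside the complex
    one. *)
Definition realified : Type := A.
HB.instance Definition _ := GRing.Zmodule.on realified.

Definition rscale (r : R) (a : realified) : realified := r%:C *: (a : A).
Fact rscalerA r s a : rscale r (rscale s a) = rscale (r * s) a.
Proof. by rewrite /rscale scalerA -rmorphM. Qed.
Fact rscale1r : left_id 1 rscale.
Proof. by move=> a; rewrite /rscale scale1r. Qed.
Fact rscalerDr : right_distributive rscale +%R.
Proof. by move=> r a b; rewrite /rscale scalerDr. Qed.
Fact rscalerDl a : {morph rscale^~ a : r s / r + s}.
Proof. by move=> r s; rewrite /rscale rmorphD scalerDl. Qed.
HB.instance Definition _ := GRing.Zmodule_isLmodule.Build R realified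
  rscalerA rscale1r rscalerDr rscalerDl.

Local Notation H := (unitization_cstar A).
Local Notation usc := (@sc R (unitization A)).

Implicit Types (a b : A).

Lemma re_partD a b : re_part (a + b) = re_part a + re_part b.
Proof. by rewrite /re_part starD -scalerDr addrACA. Qed.
Lemma re_partZ (r : R) a : re_part (r%:C *: a) = r%:C *: re_part a.
Proof. by rewrite /re_part starZr -scalerDr !scalerA mulrC. Qed.
Lemma re_part_id a : sa A a -> re_part a = a.
Proof.
by move=> sa; rewrite /re_part sa scalerDr -scalerDl -rmorphD half_add_half scale1r.
Qed.
Lemma re_part_i a : sa A a -> re_part ('i *: a) = 0.
Proof.
by move=> sa; rewrite /re_part starZ sa conjCi scaleNr subrr scaler0.
Qed.

Lemma uinjD a b : uinj (a + b) = uinj a + uinj b.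
Proof. by congr pair; rewrite /= addr0. Qed.
Lemma uinjZ (c : R[i]) a : uinj (c *: a) = c *: uinj a.
Proof. by congr pair; rewrite -[RHS]/(c * 0) mulr0. Qed.
Lemma uinjM a b : uinj (a ** b) = uinj a * uinj b.
Proof. by congr pair; rewrite /= ?mulr0 // !scale0r !addr0. Qed.

Let pset a := [set unorm (usc t + uinj (re_part a)) - t | t in [set t | 0 <= t]].

(* For a self-adjoint element this is the supremum of 0 and of its spectrum. *)
Definition upper_bound_norm (a : realified) : R := inf (pset a).

Let pset_lb a : lbound (pset a) (- rnorm (re_part a)).
Proof.
move=> _ [t /= t0 <-].
have := uc_normB H (usc t + uinj (re_part a)) (uinj (re_part a)).
by rewrite addrK (norm_sc H) unorm_uinj ger0_norm //; lra.
Qed.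

Lemma ubn_le t a : 0 <= t ->
  upper_bound_norm a <= unorm (usc t + uinj (re_part a)) - t.
Proof.
by move=> t0; apply: ge_inf; [exists (- rnorm (re_part a)); exact: pset_lb|exists t].
Qed.

Lemma ubn_ge r a : (forall t, 0 <= t -> r <= unorm (usc t + uinj (re_part a)) - t) ->
  r <= upper_bound_norm a.
Proof.
move=> h; apply: lb_le_inf.
  by exists (unorm (usc 0 + uinj (re_part a)) - 0), 0 => /=.
by move=> _ [t /= t0 <-]; exact: h.
Qed.

Lemma ubn_le_norm a : upper_bound_norm a <= rnorm a.
Proof.
apply: (le_trans (ubn_le _ (lexx 0))).
by rewrite sc0 add0r subr0 unorm_uinj rnorm_re_part.
Qed.

Lemma ubn_sublinear : sublinear upper_bound_norm.
Proof.
split=> [a b|r a r0|].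
- rewrite -lerBlDr; apply: ubn_ge => s s0.
  rewrite lerBlDl -lerBlDr; apply: ubn_ge => t t0.
  rewrite lerBlDl; apply: (le_trans (ubn_le _ (addr_ge0 s0 t0))).
  have -> : usc (s + t) + uinj (re_part (a + b)) =
      (usc s + uinj (re_part a)) + (usc t + uinj (re_part b)).
    by rewrite scD re_partD uinjD addrACA.
  have := uc_normD H (usc s + uinj (re_part a)) (usc t + uinj (re_part b)).
  lra.
- rewrite -ler_pdivrMl //; apply: ubn_ge => t t0; rewrite ler_pdivrMl //.
  apply: (le_trans (ubn_le _ (mulr_ge0 (ltW r0) t0))).
  rewrite re_partZ uinjZ scM scZ -scalerDr (uc_normZr H) gtr0_norm //.
  by rewrite mulrBr.
- apply/eqP; rewrite eq_le; apply/andP; split.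
    by rewrite -[leRHS](rnorm0 A); exact: ubn_le_norm.
  apply: ubn_ge => t t0.
  have -> : uinj (re_part (0 : A)) = 0 by rewrite re_part_id //; exact: star0.
  by rewrite addr0 (norm_sc H) ger0_norm // subrr.
Qed.

Lemma ustar_uinj a : ustar (uinj a) = uinj (star a).
Proof. by rewrite /ustar /= rmorph0. Qed.

Lemma pos_uinj a : pos (@ustar R A) (@unorm R A) (uinj (star a ** a)).
Proof. by rewrite uinjM -ustar_uinj; exact: (pos_starM H). Qed.

Lemma starM_sa a : sa A (star a ** a).
Proof. by rewrite /sa /= starM starK. Qed.

(** Positivity of [star a ** a] enters through [norm_pos_add]: adding [t] raises the norm by exactly
    [t]. *)
Lemma ubn_starM_ge a : rnorm (star a ** a) <= upper_bound_norm (star a ** a).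
Proof.
apply: ubn_ge => t t0; rewrite (re_part_id (starM_sa a)).
by rewrite (norm_pos_add H (pos_uinj a) t0) unorm_uinj addrAC subrr add0r.
Qed.

(** The [t] that witnesses positivity of [star a ** a] also witnesses this bound, which makes every
    linear functional below [upper_bound_norm] nonnegative on such elements. *)
Lemma ubn_starM_le a : upper_bound_norm (- (star a ** a)) <= 0.
Proof.
have [_ [t t0 tP]] := pos_uinj a.
apply: (le_trans (ubn_le _ t0)); rewrite subr_le0.
have snx : sa A (- (star a ** a)) by rewrite /sa /= starN starM starK.
by rewrite (re_part_id snx) -scaleN1r uinjZ scaleN1r.
Qed.

(** Only the self-adjoint part enters [upper_bound_norm]; hence a linear functional below it
    vanishes on [i] times self-adjoint elements, and its complexification is real on self-adjoint
    ones. *)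
Lemma ubn_i_sa a : sa A a -> upper_bound_norm ('i *: a) <= 0.
Proof.
move=> sa; apply: (le_trans (ubn_le _ (lexx 0))).
by rewrite re_part_i // sc0 add0r unorm_uinj rnorm0 subrr.
Qed.

(** Hahn-Banach is applied to the upper spectral bound instead of the norm, so that positivity comes
    with the domination. The complex functional is [f b - i f (i b)], and a phase turns the bound on
    [f] into one on its modulus. *)
Theorem norming_functional a : exists phi : A -> R[i],
  [/\ positive_functional phi, forall b, cabs (phi b) <= rnorm b &
      phi (star a ** a) = (rnorm a ^+ 2)%:C].
Proof.
have [f [fD fZ fp fa]] := @hahn_banach R realified _ (star a ** a) ubn_sublinear.
have fZ' (r : R) b : f (r%:C *: b) = r * f b by exact: fZ.
have fN b : f (- b) = - f b.
  by rewrite -scaleN1r -(rmorphN1 (real_complex R)) fZ' mulN1r.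
pose phi b : R[i] := (f b)%:C - 'i * (f ('i *: b))%:C.
have ii : 'i * 'i = -1 :> R[i] by rewrite -expr2 sqrCi.
have phiD b1 b2 : phi (b1 + b2) = phi b1 + phi b2.
  by rewrite /phi scalerDr !fD !rmorphD; ring.
have phiZr (r : R) b : phi (r%:C *: b) = r%:C * phi b.
  by rewrite /phi scalerA (mulrC 'i r%:C) -scalerA !fZ' !rmorphM; ring.
have phiZi b : phi ('i *: b) = 'i * phi b.
  rewrite /phi scalerA ii scaleN1r fN rmorphN.
  by rewrite mulrBr [in RHS]mulrA ii !mulrN mulN1r !opprK addrC.
have phiZ (c : R[i]) b : phi (c *: b) = c * phi b.
  by rewrite (complexE c) scalerDl -scalerA phiD phiZi !phiZr mulrDl mulrA.
have phi_sa b : sa A b -> phi b = (f b)%:C.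
  move=> sb; have h1 := le_trans (fp _) (ubn_i_sa sb).
  have snb : sa A (- b) by rewrite /sa /= starN sb.
  have := le_trans (fp _) (ubn_i_sa snb); rewrite scalerN fN oppr_le0 => h2.
  have h : f ('i *: b) = 0 by apply/eqP; rewrite eq_le h1 h2.
  by rewrite /phi h mulr0 subr0.
have f_pos b : 0 <= f (star b ** b).
  by rewrite -oppr_le0 -fN; exact: le_trans (fp _) (ubn_starM_le b).
have phi_le b : cabs (phi b) <= rnorm b.
  have e : (cabs (phi b))%:C = phi (phase (phi b) *: b) by rewrite phiZ phaseM.
  have -> : cabs (phi b) = f (phase (phi b) *: b).
    have Rei (r : R) : complex.Re ('i * r%:C) = 0 by rewrite mulrC ReiNIm /= oppr0.
    have := congr1 (@complex.Re R) e; rewrite /phi raddfB /= => ->.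
    by rewrite [X in _ - X](_ : _ = 0) ?subr0 //; exact: Rei.
  apply: (le_trans (fp _)); apply: (le_trans (ubn_le_norm _)).
  by rewrite rnormZ cabs_phase mul1r.
exists phi; split => //.
- split; first by move=> c b1 b2; rewrite phiD phiZ.
  by move=> b; rewrite (phi_sa _ (starM_sa b)) lecE /= eqxx f_pos.
- rewrite (phi_sa _ (starM_sa a)) -rnorm_starM; congr (_%:C); rewrite [LHS]fa.
  by apply/eqP; rewrite eq_le ubn_le_norm ubn_starM_ge.
Qed.

End NormingFunctional.

(** * Positive functionals and states *)

Section Functionals.
Variables (R : realType) (A : cstarType R).
Implicit Types (a b x h w : A) (phi psi : A -> R[i]) (r c : R).

Definition fbound phi c := forall a, cabs (phi a) <= c * rnorm a.

Section Scalar.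
Variable phi : A -> R[i].
Hypothesis lin : scalar phi.

Lemma functionalD a b : phi (a + b) = phi a + phi b.
Proof. by have := lin 1 a b; rewrite scale1r mul1r. Qed.
Lemma functional0 : phi 0 = 0.
Proof. by apply: (addrI (phi 0)); rewrite -functionalD !addr0. Qed.
Lemma functionalZ (c : R[i]) a : phi (c *: a) = c * phi a.
Proof. by rewrite -[c *: a]addr0 lin functional0 addr0. Qed.
Lemma functionalN a : phi (- a) = - phi a.
Proof. by rewrite -scaleN1r functionalZ mulN1r. Qed.
Lemma functionalB a b : phi (a - b) = phi a - phi b.
Proof. by rewrite functionalD functionalN. Qed.

Lemma functional_norm_leP c : 0 <= c ->
  (functional_norm phi <= c%:E)%E <-> fbound phi c.
Proof.
move=> c0; split=> [h a|h].
  have [a0|a0] := eqVneq (rnorm a) 0.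
    by rewrite (rnorm_eq0 a0) functional0 cabs0 rnorm0 mulr0.
  have ap : 0 < rnorm a by rewrite lt0r a0 rnorm_ge0.
  have : ((cabs (phi ((rnorm a)^-1%:C *: a)))%:E <= c%:E)%E.
    apply: le_trans h; apply: ereal_sup_ubound.
    exists ((rnorm a)^-1%:C *: a) => //=.
    by rewrite rnormZr ger0_norm ?invr_ge0 ?rnorm_ge0 // mulVf.
  by rewrite lee_fin functionalZ cabsM cabs_nneg ?invr_ge0 ?rnorm_ge0 // mulrC
    ler_pdivrMr.
apply: ge_ereal_sup => _ [a /= a1 <-]; rewrite lee_fin.
by apply: (le_trans (h a)); rewrite ler_piMr.
Qed.

End Scalar.

Lemma functional_norm_ge phi a : rnorm a <= 1 ->
  ((cabs (phi a))%:E <= functional_norm phi)%E.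
Proof. by move=> a1; apply: ereal_sup_ubound; exists a. Qed.

(** Meaningful for bounded functionals only; [fine] sends an infinite norm to 0. *)
Definition fnorm phi : R := fine (functional_norm phi).

Lemma functional_norm_fin phi c : scalar phi -> 0 <= c -> fbound phi c ->
  functional_norm phi = (fnorm phi)%:E.
Proof.
move=> lin c0 /(functional_norm_leP lin c0) h; rewrite /fnorm fineK //.
rewrite ge0_fin_numE ?(le_lt_trans h) ?ltry //.
have := @functional_norm_ge phi 0; rewrite rnorm0 ler01 => /(_ isT).
by rewrite functional0 // cabs0.
Qed.

Section Bounded.
Variables (phi : A -> R[i]) (c : R).
Hypotheses (lin : scalar phi) (c0 : 0 <= c) (bd : fbound phi c).

Lemma fnorm_ge0 : 0 <= fnorm phi.
Proof.
have := @functional_norm_ge phi 0; rewrite rnorm0 ler01 => /(_ isT).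
by rewrite functional0 // cabs0 (functional_norm_fin lin c0 bd) lee_fin.
Qed.

Lemma fnorm_bound : fbound phi (fnorm phi).
Proof.
apply/(functional_norm_leP lin fnorm_ge0).
by rewrite (functional_norm_fin lin c0 bd).
Qed.

Lemma fnorm_le : fnorm phi <= c.
Proof.
by rewrite -lee_fin -(functional_norm_fin lin c0 bd); apply/functional_norm_leP.
Qed.

Lemma fnorm_witness r : r < fnorm phi -> exists2 a, rnorm a <= 1 & r < cabs (phi a).
Proof.
rewrite -lte_fin -(functional_norm_fin lin c0 bd) => /ereal_sup_gt[_ [a /= a1 <-]].
by rewrite lte_fin => h; exists a.
Qed.

End Bounded.

Lemma quasi_stateP phi :
  quasi_state_space A phi <-> positive_functional phi /\ fbound phi 1.
Proof.
split=> -[pos h]; split=> //; have [lin _] := pos.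
  exact/(functional_norm_leP lin ler01).
exact/(functional_norm_leP lin ler01).
Qed.

Lemma stateP phi : state_space A phi <->
  [/\ positive_functional phi, fbound phi 1 &
      forall r, r < 1 -> exists2 a, rnorm a <= 1 & r < cabs (phi a)].
Proof.
split=> [[pos h]|[pos bd h]]; have [lin _] := pos.
  have bd : fbound phi 1 by apply/(functional_norm_leP lin ler01); rewrite h.
  split=> // r r1; apply: (fnorm_witness lin ler01 bd).
  by rewrite /fnorm h.
split=> //; rewrite (functional_norm_fin lin ler01 bd); congr (_%:E).
apply/eqP; rewrite eq_le (fnorm_le lin ler01 bd) /= leNgt; apply/negP => lt.
have [a a1] := h _ lt; rewrite ltNge; apply/negP/negPn.
apply: (le_trans (fnorm_bound lin ler01 bd a)).
by rewrite ler_piMr // (fnorm_ge0 lin ler01 bd).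
Qed.

Lemma state_quasi phi : state_space A phi -> quasi_state_space A phi.
Proof. by move=> /stateP[pos bd _]; apply/quasi_stateP. Qed.

Section CauchySchwarz.
Variable phi : A -> R[i].
Hypothesis pos : positive_functional phi.

Let lin : scalar phi. Proof. by case: pos. Qed.

(** The squared seminorm of [a] for the sesquilinear form [phi (star a ** b)]. *)
Definition fsq a : R := complex.Re (phi (star a ** a)).

Lemma fsqE a : phi (star a ** a) = (fsq a)%:C.
Proof. by rewrite /fsq RRe_real // ger0_real //; case: pos. Qed.

Lemma fsq_ge0 a : 0 <= fsq a.
Proof. by rewrite -lecR -fsqE; case: pos. Qed.

Let fsq_comb (s t : R[i]) a b : (fsq (s *: a + t *: b))%:C =
  Num.conj s * s * (fsq a)%:C + Num.conj s * t * phi (star a ** b) +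
  Num.conj t * s * phi (star b ** a) + Num.conj t * t * (fsq b)%:C.
Proof.
rewrite -!fsqE starD !starZ cmulDl !cmulDr -!cscalerAl -!cscalerAr.
by rewrite !functionalD // !functionalZ //; ring.
Qed.

(** The form is real on the diagonal; at [a + b] and at [a + i b] this relates the imaginary and the
    real parts of the off-diagonal values. *)
Lemma form_conj a b : phi (star b ** a) = Num.conj (phi (star a ** b)).
Proof.
have [r1 h1] : exists r, phi (star a ** b) + phi (star b ** a) = r%:C.
  exists (fsq (1 *: a + 1 *: b) - fsq a - fsq b).
  by rewrite !rmorphB /= fsq_comb conjC1; ring.
have [r2 h2] : exists r, 'i * phi (star a ** b) - 'i * phi (star b ** a) = r%:C.
  exists (fsq (1 *: a + 'i *: b) - fsq a - fsq b).
  rewrite !rmorphB /= fsq_comb conjC1 conjCi.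
  have -> : - 'i * 'i = 1 :> R[i] by rewrite mulNr -expr2 sqrCi opprK.
  by ring.
move: h1 h2; case: (phi (star a ** b)) (phi (star b ** a)) => [x y] [x' y'].
rewrite -mulrBr mulrC.
move=> /(congr1 (@complex.Im R)) /= e1 /(congr1 (@complex.Im R)).
rewrite ImiRe /= => e2.
by apply/eqP; rewrite eq_complex /=; apply/andP; split; apply/eqP; lra.
Qed.

Lemma cauchy_schwarz a b : cabs (phi (star a ** b)) ^+ 2 <= fsq a * fsq b.
Proof.
set z := phi (star a ** b); have quad (t : R) :
    0 <= t ^+ 2 * fsq a + 2 * t * cabs z + fsq b.
  have := fsq_ge0 (t%:C *: a + phase z *: b).
  suff -> : fsq (t%:C *: a + phase z *: b) =
      t ^+ 2 * fsq a + 2 * t * cabs z + fsq b by [].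
  apply: complexI; rewrite fsq_comb conj_real (form_conj a b) -/z.
  have pz := phaseM z; have pzc : Num.conj (phase z) * Num.conj z = (cabs z)%:C.
    by rewrite -rmorphM pz; exact: conj_real.
  have pp : Num.conj (phase z) * phase z = 1.
    by rewrite mulrC mulC_conj cabs_phase expr1n.
  transitivity (t%:C ^+ 2 * (fsq a)%:C + t%:C * (phase z * z) +
      t%:C * (Num.conj (phase z) * Num.conj z) +
      Num.conj (phase z) * phase z * (fsq b)%:C); first by ring.
  by rewrite pz pzc pp !rmorphD !rmorphM ?rmorphXn rmorph_nat; ring.
have z0 := cabs_ge0 z; have a0 := fsq_ge0 a; have b0 := fsq_ge0 b.
have [aE|a1] := eqVneq (fsq a) 0.
  (* When [fsq a] is 0 and [cabs z] is not, this [t] gives the quadratic the value -1. *)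
  have := quad (- (fsq b + 1) / (2 * cabs z)).
  have [->|z1] := eqVneq (cabs z) 0; first by rewrite expr0n mulr_ge0.
  rewrite aE mulr0 add0r mulrAC mulrCA divff ?mulr1; last by rewrite mulf_neq0 // pnatr_eq0.
  lra.
have ap : 0 < fsq a by rewrite lt0r a1.
have := quad (- cabs z / fsq a).
have -> : (- cabs z / fsq a) ^+ 2 * fsq a + 2 * (- cabs z / fsq a) * cabs z + fsq b
   = fsq b - cabs z ^+ 2 / fsq a by field.
by rewrite subr_ge0 ler_pdivrMr // mulrC.
Qed.

End CauchySchwarz.

End Functionals.

(** * Functionals on an algebra with an approximate unit *)

Section ApproximateUnit.
Variables (R : realType) (A : cstarType R).
Implicit Types (a b x h w : A) (phi psi : A -> R[i]) (r c : R).

(* What is used of an approximate unit. *)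
Definition approximately_unital := forall (s : seq A) r, 0 < r ->
  exists w, [/\ sa A w, rnorm w <= 1 & forall a, a \in s ->
    rnorm (w ** a - a) <= r /\ rnorm (a ** w - a) <= r].

Lemma approximate_unit_approximately (I : Type) (le : I -> I -> Prop) (v : I -> A) :
  approximate_unit le v -> approximately_unital.
Proof.
move=> [[[i0] lexx' tr dir] vpos _ vlim] s r r0.
have [i iP] : exists i, forall j, le i j -> forall a, a \in s ->
    rnorm (v j ** a - a) <= r /\ rnorm (a ** v j - a) <= r.
  elim: s => [|a s [i iP]]; first by exists i0.
  have [k kP] := vlim a r r0; have [l il kl] := dir i k.
  exists l => j lj b; rewrite inE => /predU1P[->|bs].
    by have [h1 h2] := kP j (tr _ _ _ kl lj); split; exact: ltW.
  exact: iP (tr _ _ _ il lj) _ bs.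
exists (v i); have [[b vb] v1] := vpos i; split => //.
  by rewrite /sa /= vb starM starK.
exact: iP (lexx' i).
Qed.

Section Functional.
Variable phi : A -> R[i].
Hypotheses (au : approximately_unital) (pos : positive_functional phi).
Hypothesis bd : fbound phi 1.

Let lin : scalar phi. Proof. by case: pos. Qed.

(** With [w] in the role of a unit, [form_conj] for [w] and [a] compares [phi (star a ** w)] with
    [phi (w ** a)]. *)
Lemma functional_star a : phi (star a) = Num.conj (phi a).
Proof.
apply/eqP; rewrite -subr_eq0; apply/eqP/cabs_eq0/eqP.
rewrite eq_le cabs_ge0 andbT; apply/ler_addgt0Pr => e e0; rewrite add0r.
have e20 : 0 < e / 2 by rewrite divr_gt0.
have [w [sw w1 wP]] := au [:: a; star a] e20.
have [_ h1] : _ /\ _ := wP (star a) ltac:(by rewrite !inE eqxx orbT).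
have [h2 _] := wP a (mem_head _ _).
have -> : phi (star a) - Num.conj (phi a) =
    - phi (star a ** w - star a) + Num.conj (phi (w ** a - a)).
  rewrite !(functionalB lin) rmorphB /=.
  have -> : phi (star a ** w) = Num.conj (phi (w ** a)).
    by rewrite (form_conj pos w a) sw.
  by rewrite opprB addrA subrK.
apply: (le_trans (cabsD _ _)); rewrite cabsN cabs_conj.
have := bd (star a ** w - star a); have := bd (w ** a - a); lra.
Qed.

Lemma functional_sa a : sa A a -> phi a = (complex.Re (phi a))%:C.
Proof.
move=> sa; have := functional_star a; rewrite sa; case: (phi a) => x y.
by move=> /(congr1 (@complex.Im R)) /= h; congr (_ +i* _)%C; lra.
Qed.

(* Cauchy-Schwarz applied to x (h - c 1), where the unit of the unitization is
   approximated within A. *)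
Lemma functional_variance x h c : sa A h ->
  cabs (phi (x ** h) - c%:C * phi x) ^+ 2 <=
  rnorm x ^+ 2 *
    (complex.Re (phi (h ** h)) - 2 * c * complex.Re (phi h) + c ^+ 2).
Proof.
move=> sh.
set B := _ - _ + _; set X := cabs _.
have x0 := rnorm_ge0 x; have h0 := rnorm_ge0 h; have c0 := normr_ge0 c.
(* [Y] bounds [phi (x ** d)], where [d = h - c w] stands for [h - c 1]; [K] collects the
   coefficients of the tolerance [r] in the final estimate. *)
pose Y := rnorm x * (rnorm h + `|c|).
have Y0 : 0 <= Y by rewrite mulr_ge0 // addr_ge0.
pose K := rnorm x ^+ 2 * (2 * `|c|) + 2 * Y * `|c| + c ^+ 2.
have K0 : 0 <= K by rewrite /K !addr_ge0 ?sqr_ge0 // !mulr_ge0 ?sqr_ge0 // addr_ge0.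
apply/ler_addgt0Pr => e e0.
pose r := Num.min 1 (e / (K + 1)).
have r0 : 0 < r by rewrite lt_min ltr01 divr_gt0 // ltr_wpDl.
have r1 : r <= 1 by rewrite ge_min lexx.
have rK : r * K <= e.
  have : r <= e / (K + 1) by rewrite ge_min lexx orbT.
  rewrite ler_pdivlMr ?ltr_wpDl // => rK; nra.
have [w [sw w1 wP]] := au [:: x; h] r0.
have [_ wx] := wP x (mem_head _ _); have [wh hw] : _ /\ _ := wP h ltac:(by rewrite !inE eqxx orbT).
pose d := h - c%:C *: w.
have sd : star d = d by rewrite starB starZr sh sw.
have dY : cabs (phi (x ** d)) <= Y.
  apply: (le_trans (bd _)); rewrite mul1r; apply: (le_trans (rnormM _ _)).
  apply: ler_wpM2l => //; apply: (le_trans (rnormB _ _)); rewrite rnormZr lerD2l.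
  by rewrite ler_piMr.
have X_le : X <= cabs (phi (x ** d)) + `|c| * r.
  have -> : X = cabs (phi (x ** d) + c%:C * phi (x ** w - x)).
    congr cabs; rewrite /d cmulBr -cscalerAr !(functionalB lin) (functionalZ lin); ring.
  apply: (le_trans (cabsD _ _)); rewrite lerD2l cabsM cabs_real ler_wpM2l //.
  by apply: (le_trans (bd _)); rewrite mul1r.
have d2 : fsq phi d <= B + 2 * `|c| * r.
  have -> : fsq phi d = complex.Re (phi (h ** h)) -
      c * complex.Re (phi (h ** w)) - c * complex.Re (phi (w ** h)) +
      c ^+ 2 * complex.Re (phi (w ** w)).
    have ReZ (t : R) z : complex.Re (t%:C * z) = t * complex.Re z.
      by case: z => u v /=; rewrite mul0r subr0.
    rewrite /fsq sd /d cmulBl !cmulBr -!cscalerAl -!cscalerAr scalerA.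
    rewrite !(functionalB lin) !(functionalZ lin) !raddfB /= -rmorphM !ReZ.
    by ring.
  have Re_close u v : rnorm (u - v) <= r ->
      `|complex.Re (phi u) - complex.Re (phi v)| <= r.
    move=> uv; rewrite -raddfB -(functionalB lin); apply: le_trans (cabs_Re _) _.
    by apply: (le_trans (bd _)); rewrite mul1r.
  have mul_close u v : `|u - v| <= r -> - (c * u) <= - (c * v) + `|c| * r.
    move=> uv; rewrite -lerBlDl opprK addrC -mulrBr; apply: le_trans (ler_norm _) _.
    by rewrite normrM ler_wpM2l // distrC.
  have h1 := mul_close _ _ (Re_close _ _ hw).
  have h2 := mul_close _ _ (Re_close _ _ wh).
  have h3 : c ^+ 2 * complex.Re (phi (w ** w)) <= c ^+ 2.
    rewrite ler_piMr ?sqr_ge0 //; apply: le_trans (ler_norm _) _.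
    apply: le_trans (cabs_Re _) _; apply: le_trans (bd _) _; rewrite mul1r.
    by apply: le_trans (rnormM _ _) _; rewrite mulr_ile1 ?rnorm_ge0.
  rewrite /B; lra.
have CS : cabs (phi (x ** d)) ^+ 2 <= rnorm x ^+ 2 * fsq phi d.
  have := cauchy_schwarz pos (star x) d; rewrite starK => h1.
  apply: (le_trans h1); apply: ler_wpM2r; first exact: fsq_ge0.
  have := bd (x ** star x); rewrite mul1r => h2.
  apply: le_trans (_ : rnorm (x ** star x) <= _).
    apply: le_trans h2; rewrite /fsq starK.
    by apply: le_trans (cabs_Re _); exact: ler_norm.
  by apply: (le_trans (rnormM _ _)); rewrite rnorm_star expr2.
have X0 : 0 <= X by exact: cabs_ge0.
have c2 : `|c| ^+ 2 = c ^+ 2 by rewrite real_normK // num_real.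
move: CS d2 X_le dY (cabs_ge0 (phi (x ** d))) (fsq_ge0 pos d).
set Z := cabs (phi _); set q := fsq _ _ => CS d2 X_le dY Z0 q0.
apply: (le_trans (y := (Z + `|c| * r) ^+ 2)).
  by rewrite ler_sqr ?nnegrE ?addr_ge0 ?mulr_ge0 // ltW.
have -> : (Z + `|c| * r) ^+ 2 = Z ^+ 2 + 2 * Z * `|c| * r + c ^+ 2 * r * r.
  by rewrite -c2; ring.
have h1 : rnorm x ^+ 2 * q <= rnorm x ^+ 2 * (B + 2 * `|c| * r).
  by rewrite ler_wpM2l ?sqr_ge0.
have h2 : 2 * Z * `|c| * r <= 2 * Y * `|c| * r.
  by rewrite ler_wpM2r ?(ltW r0) // ler_wpM2r // ler_wpM2l.
have h3 : c ^+ 2 * r * r <= c ^+ 2 * r.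
  by rewrite ler_piMr // mulr_ge0 ?sqr_ge0 // ltW.
rewrite /K in rK; lra.
Qed.

(** The bound of [functional_variance] with [c = phi h] is zero: [h] lies in the multiplicative
    domain of [phi]. *)
Lemma functional_character h : sa A h -> phi (h ** h) = phi h * phi h ->
  forall x, phi (x ** h) = phi x * phi h.
Proof.
move=> sh hh x; have hE := functional_sa sh.
apply/eqP; rewrite -subr_eq0 mulrC; apply/eqP/cabs_eq0/eqP.
rewrite -sqrf_eq0 eq_le sqr_ge0 andbT {1}hE.
apply: (le_trans (functional_variance _ _ sh)).
rewrite hh hE -rmorphM /=.
by rewrite (_ : _ - _ + _ = 0) ?mulr0 //; ring.
Qed.

Lemma functional_character_sandwich h : sa A h -> phi (h ** h) = phi h * phi h ->
  forall x, phi (h ** x ** h) = phi h * phi h * phi x.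
Proof.
move=> sh hh x; have hE := functional_sa sh.
rewrite (functional_character sh hh).
have -> : h ** x = star (star x ** h) by rewrite starM starK sh.
rewrite functional_star (functional_character sh hh) functional_star rmorphM /=.
by rewrite conjCK hE conj_real; ring.
Qed.

End Functional.

End ApproximateUnit.

Section Pullback.
Variables (R : realType) (D A : cstarType R) (pi : D -> A).
Hypothesis pi_star : star_morphism pi.

Lemma scalar_pullback phi : scalar phi -> scalar (phi \o pi).
Proof.
move=> lin c a b /=.
by rewrite (star_morphismD pi_star) (star_morphismZ pi_star) lin.
Qed.

Lemma positive_pullback phi : positive_functional phi -> positive_functional (phi \o pi).
Proof.
move=> [lin pos]; split; first exact: scalar_pullback.
by move=> a /=; rewrite (star_morphismM pi_star) (star_morphism_star pi_star).
Qed.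

Lemma fbound_pullback phi c : 0 <= c -> fbound phi c -> fbound (phi \o pi) c.
Proof.
move=> c0 bd a; apply: (le_trans (bd _)); rewrite ler_wpM2l //.
exact: star_morphism_contractive.
Qed.

Lemma quasi_state_pullback phi :
  quasi_state_space A phi -> quasi_state_space D (phi \o pi).
Proof.
move=> /quasi_stateP[pos bd]; apply/quasi_stateP; split.
  exact: positive_pullback.
exact: fbound_pullback.
Qed.

End Pullback.

Section Compression.
Variables (R : realType) (A : cstarType R).
Implicit Types (a e : A) (phi : A -> R[i]).

Lemma positive_compress phi e : sa A e -> positive_functional phi ->
  positive_functional (fun a => phi (e ** a ** e)).
Proof.
move=> se [lin pos]; split=> [c a b|a].
  by rewrite cmulDr cmulDl -cscalerAr -cscalerAl lin.
have -> : e ** (star a ** a) ** e = star (a ** e) ** (a ** e).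
  by rewrite starM se !cmulA.
exact: pos.
Qed.

Lemma fbound_compress phi e c : 0 <= c -> fbound phi c ->
  fbound (fun a => phi (e ** a ** e)) (c * rnorm e ^+ 2).
Proof.
move=> c0 bd a; apply: (le_trans (bd _)); rewrite -mulrA ler_wpM2l //.
apply: (le_trans (rnormM _ _)); rewrite expr2 mulrAC ler_wpM2r ?rnorm_ge0 //.
exact: rnormM.
Qed.

Lemma positive_scale phi (c : R) : 0 <= c -> positive_functional phi ->
  positive_functional (fun a => c%:C * phi a).
Proof.
move=> c0 [lin pos]; split=> [z a b|a]; first by rewrite lin; ring.
by rewrite mulr_ge0 // lecR.
Qed.

Lemma fbound_scale phi c (t : R) : 0 <= t -> fbound phi c ->
  fbound (fun a => t%:C * phi a) (t * c).
Proof. by move=> t0 bd a; rewrite cabsM cabs_nneg // -mulrA ler_wpM2l. Qed.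

Lemma positive_add phi psi : positive_functional phi -> positive_functional psi ->
  positive_functional (fun a : A => phi a + psi a).
Proof.
move=> [l1 p1] [l2 p2]; split=> [z a b|a]; first by rewrite l1 l2; ring.
by rewrite addr_ge0.
Qed.

Lemma fbound_add phi psi c d : fbound phi c -> fbound psi d ->
  fbound (fun a : A => phi a + psi a) (c + d).
Proof.
by move=> h1 h2 a; apply: (le_trans (cabsD _ _)); rewrite mulrDl lerD.
Qed.

Lemma positive0 : positive_functional (fun _ : A => 0).
Proof. by split=> // z a b; rewrite mulr0 addr0. Qed.

Lemma fbound0 phi : fbound phi 0 -> forall a : A, phi a = 0.
Proof.
move=> bd a; apply: cabs_eq0; apply/eqP; rewrite eq_le cabs_ge0 andbT.
by apply: (le_trans (bd a)); rewrite mul0r.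
Qed.

Lemma fbound_weaken phi c d : c <= d -> fbound phi c -> fbound (phi : A -> R[i]) d.
Proof. by move=> cd bd a; apply: (le_trans (bd a)); rewrite ler_wpM2r ?rnorm_ge0. Qed.

End Compression.

(** * Neighborhoods in the norm topology and in the weak* topology *)

Section Topology.
Variables (R : realType) (A : cstarType R).
Implicit Types (a b x h : A) (S X : set A) (s : seq A) (phi psi : A -> R[i]) (r e : R).

Lemma nbhs_rnormP a (V : set A) :
  nbhs a V <-> exists2 r : R, 0 < r & forall b, rnorm (a - b) < r -> V b.
Proof.
split.
  move=> /nbhs_ballP[e e0 eV].
  have eR : e = (complex.Re e)%:C by rewrite RRe_real // gtr0_real.
  exists (complex.Re e); first by rewrite -ltcR -eR.
  by move=> b ab; apply: eV; rewrite -ball_normE /= eR rnorm_lt.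
move=> [r r0 rV]; apply/nbhs_ballP; exists r%:C; first by rewrite /= ltcR.
by move=> b; rewrite -ball_normE /= rnorm_lt; exact: rV.
Qed.

Lemma closure_rnormP X a :
  closure X a <-> forall e, 0 < e -> exists2 x, X x & rnorm (a - x) < e.
Proof.
split=> [cl e e0|h V /nbhs_rnormP[r r0 rV]].
  have [|x [Xx xa]] := cl [set b | rnorm (a - b) < e].
    by apply/nbhs_rnormP; exists e.
  by exists x.
by have [x Xx xa] := h r r0; exists x; split=> //; exact: rV.
Qed.

Lemma dense_rnormP X :
  dense X <-> forall a e, 0 < e -> exists2 x, X x & rnorm (a - x) < e.
Proof.
split=> [dX a e e0|h O [a Oa] oO].
  have [||x [xa Xx]] := dX [set b | rnorm (a - b) < e]°.
    by exists a; apply/nbhs_rnormP; exists e.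
    exact: open_interior.
  by exists x => //; exact: interior_subset xa.
have /nbhs_rnormP[r r0 rO] := open_nbhs_nbhs (conj oO Oa).
by have [x Xx xa] := h a r r0; exists x; split=> //; exact: rO.
Qed.

Let basic phi : set_system (A -> R[i]) :=
  [set V | exists s r, 0 < r /\
     forall psi, (forall a, a \in s -> cabs (psi a - phi a) < r) -> V psi].

Let basic_filter phi : Filter (basic phi).
Proof.
split.
- by exists [::], 1; split.
- move=> P Q [s1 [r1 [r10 h1]]] [s2 [r2 [r20 h2]]].
  exists (s1 ++ s2), (Num.min r1 r2); split; first by rewrite lt_min r10.
  move=> psi h; split; [apply: h1|apply: h2] => a ain.
    by have := h a; rewrite mem_cat ain lt_min => /(_ isT)/andP[].
  by have := h a; rewrite mem_cat ain orbT lt_min => /(_ isT)/andP[].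
- move=> P Q PQ [s [r [r0 h]]]; exists s, r; split=> // psi /h; exact: PQ.
Qed.

(** Convergence in this topology is convergence at each point. Applied to the filter [basic phi]
    this gives one inclusion, and applied to the neighborhood filter it gives the other, by
    induction on the list of test elements. *)
Lemma nbhs_ptwsP phi (V : set {ptws A -> R[i]^o}) :
  nbhs (phi : {ptws A -> R[i]^o}) V <-> basic phi V.
Proof.
split.
  have /(_ V) : {ptws, basic phi --> (phi : A -> R[i]^o)}; last by apply.
  apply/(@pointwise_cvgP A R[i]^o _ _ (basic_filter phi)) => a W /nbhs_ballP[e e0 eW].
  have eR : e = (complex.Re e)%:C by rewrite RRe_real // gtr0_real.
  exists [:: a], (complex.Re e); split; first by rewrite -ltcR -eR.
  move=> psi /(_ a); rewrite mem_seq1 eqxx => /(_ isT) h; apply: eW.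
  by rewrite -ball_normE /= eR rnorm_lt; rewrite cdistC in h.
have FF : Filter (nbhs (phi : {ptws A -> R[i]^o})) by exact: nbhs_filter.
move=> [s [r [r0 h]]]; apply: (@filterS _ _ FF _ _ h).
elim: s {h} => [|a s IH].
  by apply: (@filterS _ _ FF setT) => //; exact: (@filterT _ _ FF).
have ha : nbhs (phi : {ptws A -> R[i]^o}) [set psi | cabs (psi a - phi a) < r].
  have : {ptws, nbhs (phi : {ptws A -> R[i]^o}) --> (phi : A -> R[i]^o)} by [].
  move=> /(@pointwise_cvgP A R[i]^o _ _ FF) /(_ a [set z | cabs (z - phi a) < r]); apply.
  apply/nbhs_ballP; exists r%:C; first by rewrite /= ltcR.
  by move=> z; rewrite -ball_normE /= rnorm_lt -/(cabs _) cdistC.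
apply: (@filterS _ _ FF _ _ _ (@filterI _ _ FF _ _ ha IH)) => psi [h1 h2] b.
by rewrite inE => /predU1P[->|] //; exact: h2.
Qed.

Lemma weak_star_denseP (X : set (A -> R[i])) : weak_star_dense_in_states X <->
  forall phi, state_space A phi -> forall s r, 0 < r ->
    exists2 psi, X psi & forall a, a \in s -> cabs (psi a - phi a) < r.
Proof.
split=> [h phi sp s r r0|h phi sp V /nbhs_ptwsP[s [r [r0 rV]]]].
  have [|psi [Xp hp]] := h phi sp
      [set psi | forall a, a \in s -> cabs (psi a - phi a) < r].
    by apply/nbhs_ptwsP; exists s, r.
  by exists psi.
by have [psi Xp hp] := h phi sp s r r0; exists psi; split=> //; exact: rV.
Qed.

End Topology.

(** * Lipschitz seminorms and the metrics they define *)

Section Lipschitz.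
Variables (R : realType) (A : cstarType R) (L : lipdata A).
Implicit Types (a b x h : A) (s : seq A) (phi psi : A -> R[i]) (r e M : R).

Lemma bl_leP M phi psi r : (bl L M phi psi <= r%:E)%E <->
  forall a, ldom_sa L a -> lip_norm L M a <= 1 -> cabs (phi a - psi a) <= r.
Proof.
split=> [h a da la|h].
  by rewrite -lee_fin; apply: le_trans h; apply: ereal_sup_ubound; exists a.
by apply: ge_ereal_sup => _ [a [da la] <-]; rewrite lee_fin; exact: h.
Qed.

Lemma mk_leP phi psi r : (mk L phi psi <= r%:E)%E <->
  forall a, ldom_sa L a -> L a <= 1 -> cabs (phi a - psi a) <= r.
Proof.
split=> [h a da la|h].
  by rewrite -lee_fin; apply: le_trans h; apply: ereal_sup_ubound; exists a.
by apply: ge_ereal_sup => _ [a [da la] <-]; rewrite lee_fin; exact: h.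
Qed.

Lemma mk_ltyP phi psi : (mk L phi psi < +oo)%E <->
  exists k, forall a, ldom_sa L a -> L a <= 1 -> cabs (phi a - psi a) <= k.
Proof.
split=> [h|[k /mk_leP h]]; last by apply: le_lt_trans h _; exact: ltry.
case e : (mk L phi psi) h => [k| |] // _.
  by exists k; apply/mk_leP; rewrite e.
by exists 0; apply/mk_leP; rewrite e leNye.
Qed.

Lemma bl_ltP M phi psi r : (bl L M phi psi < r%:E)%E <-> exists2 k, k < r &
  forall a, ldom_sa L a -> lip_norm L M a <= 1 -> cabs (phi a - psi a) <= k.
Proof.
split=> [h|[k kr /bl_leP h]]; last by apply: le_lt_trans h _; rewrite lte_fin.
case e : (bl L M phi psi) h => [k| |] //.
  by rewrite lte_fin => h; exists k => //; apply/bl_leP; rewrite e.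
by exists (r - 1); [rewrite gtrBl|apply/bl_leP; rewrite e leNye].
Qed.

Hypothesis Lsemi : seminorm_on_dom L.
Hypothesis Lherm : hermitian_seminorm L.

Lemma dom0 : ldom L 0. Proof. by case: Lsemi => -[]. Qed.
Lemma domD a b : ldom L a -> ldom L b -> ldom L (a + b).
Proof. by case: Lsemi => -[_ lin] _ _ da db; rewrite -[a]scale1r; exact: lin. Qed.
Lemma domZ (c : R[i]) a : ldom L a -> ldom L (c *: a).
Proof.
by case: Lsemi => -[d0 lin] _ _ da; rewrite -[c *: a]addr0; exact: lin.
Qed.
Lemma lipZ (c : R[i]) a : ldom L a -> L (c *: a) = cabs c * L a.
Proof. by case: Lsemi => _ _; apply. Qed.
Lemma lipZr r a : ldom L a -> L (r%:C *: a) = `|r| * L a.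
Proof. by move=> /lipZ ->; rewrite cabs_real. Qed.
Lemma lipD a b : ldom L a -> ldom L b -> L (a + b) <= L a + L b.
Proof. by case: Lsemi => _ h _; exact: h. Qed.
Lemma lip0 : L 0 = 0.
Proof. by rewrite -(scale0r 0) lipZ ?cabs0 ?mul0r //; exact: dom0. Qed.
Lemma lipN a : ldom L a -> L (- a) = L a.
Proof. by move=> da; rewrite -scaleN1r lipZ // cabsN cabs1 mul1r. Qed.
Lemma lip_ge0 a : ldom L a -> 0 <= L a.
Proof.
move=> da; have := lipD da (domZ (-1) da).
by rewrite scaleN1r subrr lip0 lipN //; lra.
Qed.
Lemma dom_star a : ldom L a -> ldom L (star a).
Proof. by move=> /Lherm[]. Qed.
Lemma lip_star a : ldom L a -> L (star a) = L a.
Proof. by move=> /Lherm[]. Qed.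

Lemma dom_sa0 : ldom_sa L 0.
Proof. by split; [exact: dom0|exact: star0]. Qed.
Lemma dom_saZr r a : ldom_sa L a -> ldom_sa L (r%:C *: a).
Proof.
by move=> [da sa]; split; [exact: domZ|apply: etrans (starZr _ _) _; rewrite sa].
Qed.
Lemma dom_sa_re a : ldom L a -> ldom_sa L (re_part a).
Proof.
move=> da; split; last exact: re_part_sa.
by apply: domZ; apply: domD => //; exact: dom_star.
Qed.
Lemma dom_sa_im a : ldom L a -> ldom_sa L (im_part a).
Proof.
move=> da; split; last exact: im_part_sa.
apply: domZ; apply: domZ; apply: domD; first exact: dom_star.
by rewrite -scaleN1r; exact: domZ.
Qed.

Lemma lip_norm_leP M a r : 0 < M -> lip_norm L M a <= r <->
  rnorm a <= M * r /\ L a <= r.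
Proof.
move=> M0; rewrite /lip_norm ge_max ler_pdivrMl //.
by split=> [/andP|[-> ->]].
Qed.

Lemma lip_normZr M r a : 0 < M -> 0 <= r -> ldom L a ->
  lip_norm L M (r%:C *: a) = r * lip_norm L M a.
Proof.
move=> M0 r0 da; rewrite /lip_norm rnormZr lipZr // ger0_norm // mulrCA.
by rewrite maxr_pMr.
Qed.

Lemma lip_norm_ge0 M a : 0 < M -> 0 <= lip_norm L M a.
Proof. by move=> M0; rewrite le_max mulr_ge0 ?invr_ge0 ?(ltW M0) ?rnorm_ge0. Qed.

(** Division by [lip_norm L M a] fails when it is 0, hence the small summand in [t]. *)
Lemma bl_homo M phi psi k : 0 < M -> 0 <= k -> scalar phi -> scalar psi ->
  (forall a, ldom_sa L a -> lip_norm L M a <= 1 -> cabs (phi a - psi a) <= k) ->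
  forall a, ldom_sa L a -> cabs (phi a - psi a) <= k * lip_norm L M a.
Proof.
move=> M0 k0 l1 l2 h a da; apply/ler_addgt0Pr => e e0.
pose t := lip_norm L M a + e / (k + 1).
have k1 : 0 < k + 1 by rewrite ltr_wpDl.
have l0 := lip_norm_ge0 a M0.
have t0 : 0 < t by rewrite ltr_wpDl // divr_gt0.
have te : k * t <= k * lip_norm L M a + e.
  have : k * (e / (k + 1)) <= e.
    by rewrite mulrA ler_pdivrMr // mulrDr mulr1 mulrC lerDl ltW.
  by rewrite /t mulrDr; lra.
apply: le_trans te.
have := h (t^-1%:C *: a) (dom_saZr _ da).
rewrite lip_normZr ?invr_ge0 ?(ltW t0) //; last by case: da.
rewrite ler_pdivrMl // mulr1 lerDl => /(_ (ltW (divr_gt0 e0 k1))).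
rewrite !functionalZ // -mulrBr cabsM cabs_nneg ?invr_ge0 ?(ltW t0) //.
by rewrite ler_pdivrMl // mulrC.
Qed.

Hypothesis Ldense : dense (ldom L).

(** Density of the domain and the splitting into real and imaginary parts reduce [a] to two
    self-adjoint elements of the domain, where [bl_homo] applies. *)
Lemma bl_controls phi s e : state_space A phi -> 0 < e ->
  exists2 r, 0 < r & forall psi, state_space A psi -> (bl L 1 phi psi < r%:E)%E ->
    forall a, a \in s -> cabs (psi a - phi a) < e.
Proof.
move=> /stateP[[lphi _] bphi _] e0; elim: s => [|a s [r r0 IH]].
  by exists 1.
have e40 : 0 < e / 4 by rewrite divr_gt0.
have [x dx xa] := (dense_rnormP _).1 Ldense a _ e40.
have [u [v [d1 d2 xE]]] : exists u v, [/\ ldom_sa L u, ldom_sa L v & x = u + 'i *: v].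
  exists (re_part x), (im_part x).
  by split; [exact: dom_sa_re|exact: dom_sa_im|exact: re_im_part].
pose C := lip_norm L 1 u + lip_norm L 1 v + 1.
have C1 := lip_norm_ge0 u ltr01.
have C2 := lip_norm_ge0 v ltr01.
have C0 : 0 < C by rewrite ltr_wpDl // addr_ge0.
pose r' := e / (4 * C).
have r'0 : 0 < r' by rewrite divr_gt0 // mulr_gt0.
exists (Num.min r r'); first by rewrite lt_min r0.
move=> psi sp bl_lt b.
rewrite inE => /predU1P[->|]; last first.
  apply: IH => //; apply: lt_le_trans bl_lt _.
  by rewrite lee_fin ge_min lexx.
have /stateP[[lpsi _] bpsi _] := sp.
have [k kr hk] : exists2 k, k < r' & forall a, ldom_sa L a ->
    lip_norm L 1 a <= 1 -> cabs (phi a - psi a) <= k.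
  apply/bl_ltP; apply: lt_le_trans bl_lt _.
  by rewrite lee_fin ge_min lexx orbT.
have k0 : 0 <= k.
  apply: le_trans (hk 0 dom_sa0 _); first exact: cabs_ge0.
  by apply/(lip_norm_leP _ _ ltr01); rewrite rnorm0 lip0 mulr1 !ler01.
have hb := bl_homo ltr01 k0 lphi lpsi hk.
have hx : cabs (psi x - phi x) <= r' * C.
  rewrite cdistC xE !functionalD // !functionalZ //.
  have -> : phi u + 'i * phi v - (psi u + 'i * psi v) =
      (phi u - psi u) + 'i * (phi v - psi v) by ring.
  apply: (le_trans (cabsD _ _)); rewrite cabsM cabs_i mul1r.
  apply: (le_trans (lerD (hb _ d1) (hb _ d2))).
  rewrite -mulrDr; apply: ler_pM => //; rewrite ?addr_ge0 //; first exact: ltW.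
  by rewrite lerDl.
have r'C : r' * C = e / 4 by rewrite /r' invfM mulrA divfK // gt_eqF.
have -> : psi a - phi a = psi (a - x) + (psi x - phi x) - phi (a - x).
  by rewrite !functionalB //; ring.
apply: le_lt_trans (cabsB _ _) _; have := cabsD (psi (a - x)) (psi x - phi x).
have := bpsi (a - x); have := bphi (a - x); lra.
Qed.

(** By [bl_controls] the metric always refines the weak* topology, so what remains to check is that
    metric balls contain weak* neighborhoods. *)
Lemma induces_weak_starP : induces_weak_star (bl L 1) <->
  forall phi, state_space A phi -> forall r, 0 < r -> exists s e, 0 < e /\
    forall psi, state_space A psi ->
      (forall a, a \in s -> cabs (psi a - phi a) < e) -> (bl L 1 phi psi < r%:E)%E.
Proof.
split=> [h phi sp r r0|h U US].
  pose U := [set psi | state_space A psi /\ (bl L 1 phi psi < r%:E)%E].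
  have US : U `<=` state_space A by move=> psi [].
  have [_ [|V oV UV]] := h U US.
    move=> psi [spsi /bl_ltP[k kr hk]]; exists (r - k); first by rewrite subr_gt0.
    move=> chi schi /bl_ltP[k' k'r hk']; split=> //; apply/bl_ltP.
    exists (k + k'); first by rewrite -ltrBrDl.
    move=> a da la; have -> : phi a - chi a = (phi a - psi a) + (psi a - chi a).
      by rewrite addrA subrK.
    by apply: (le_trans (cabsD _ _)); rewrite lerD ?hk ?hk'.
  have Uphi : U phi.
    split=> //; apply/bl_ltP; exists 0 => // a _ _; by rewrite subrr cabs0.
  have Vphi : V phi by move: Uphi; rewrite UV => -[].
  have /nbhs_ptwsP[s [e [e0 eV]]] := open_nbhs_nbhs (conj oV Vphi).
  exists s, e; split=> // psi spsi /eV Vpsi.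
  by have [] : U psi by rewrite UV.
split=> [[V oV ->] phi [Vphi sphi]|hU].
  have /nbhs_ptwsP[s [e [e0 eV]]] := open_nbhs_nbhs (conj oV Vphi).
  have [r r0 rP] := bl_controls s sphi e0.
  by exists r => // psi spsi /(rP _ spsi)/eV.
(* Adding all functionals that are not states leaves the trace on the states unchanged and makes
   every point of [U] interior. *)
exists ((U `|` ~` state_space A : set {ptws A -> R[i]^o})°).
  exact: open_interior.
apply/seteqP; split=> [phi Uphi|phi [/interior_subset [//|]]]; last by [].
have sphi := US _ Uphi; split=> //.
have [r r0 rU] := hU _ Uphi.
have [s [e [e0 he]]] := h _ sphi _ r0.
apply/nbhs_ptwsP; exists s, e; split=> // psi hpsi.
have [spsi|] := pselect (state_space A psi); last by right.
by left; apply: rU => //; exact: he.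
Qed.

End Lipschitz.

(** * Direct sums *)

Section ProductComplete.
Variables (K : numFieldType) (V W : completeNormedModType K).

HB.instance Definition _ := Pointed.on (V * W)%type.

Fact prod_complete (F : set_system (V * W)) : ProperFilter F -> cauchy F -> cvg F.
Proof.
move=> FF /cauchyP Fc.
have c1 : cauchy (fst @ F).
  apply: cauchy_exP => e e0; have [x Fx] := Fc e e0.
  exists x.1; rewrite /fmap /=; apply: filterS Fx => y; by case.
have c2 : cauchy (snd @ F).
  apply: cauchy_exP => e e0; have [x Fx] := Fc e e0.
  exists x.2; rewrite /fmap /=; apply: filterS Fx => y; by case.
have /cvg_ex[l1 h1] : cvg (fst @ F) by exact: cauchy_cvg.
have /cvg_ex[l2 h2] : cvg (snd @ F) by exact: cauchy_cvg.
apply/cvg_ex; exists (l1, l2) => U /nbhs_ballP[e e0 eU].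
have n1 := h1 _ (nbhsx_ballx l1 e e0); have n2 := h2 _ (nbhsx_ballx l2 e e0).
have : F [set x | ball l1 e x.1 /\ ball l2 e x.2] by exact: filterI.
by apply: filterS => -[a b] [h h']; apply: eU; split.
Qed.

HB.instance Definition _ := Uniform_isComplete.Build (V * W)%type prod_complete.

End ProductComplete.

Section ProductCStar.
Variables (R : realType) (A B : cstarType R).
Local Notation P := (A * B)%type.

Definition prod_cmul (x y : P) : P := (x.1 ** y.1, x.2 ** y.2).
Definition prod_star (x : P) : P := (star x.1, star x.2).

Fact prod_cmulA : associative prod_cmul.
Proof. by move=> x y z; rewrite /prod_cmul /= !cmulA. Qed.
Fact prod_cmulDl : left_distributive prod_cmul +%R.
Proof. by move=> x y z; rewrite /prod_cmul /= !cmulDl. Qed.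
Fact prod_cmulDr : right_distributive prod_cmul +%R.
Proof. by move=> x y z; rewrite /prod_cmul /= !cmulDr. Qed.
Fact prod_cscalerAl (c : R[i]) (x y : P) :
  c *: prod_cmul x y = prod_cmul (c *: x) y.
Proof. by congr pair; rewrite /= cscalerAl. Qed.
Fact prod_cscalerAr (c : R[i]) (x y : P) :
  c *: prod_cmul x y = prod_cmul x (c *: y).
Proof. by congr pair; rewrite /= cscalerAr. Qed.
Fact prod_starK : involutive prod_star.
Proof. by case=> a b; rewrite /prod_star /= !starK. Qed.
Fact prod_starD : {morph prod_star : x y / x + y}.
Proof. by move=> x y; rewrite /prod_star /= !starD. Qed.
Fact prod_starZ (c : R[i]) (x : P) : prod_star (c *: x) = Num.conj c *: prod_star x.
Proof. by congr pair; rewrite /= starZ. Qed.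
Fact prod_starM x y : prod_star (prod_cmul x y) = prod_cmul (prod_star y) (prod_star x).
Proof. by rewrite /prod_star /= !starM. Qed.

Lemma rnorm_prod (x : P) : rnorm x = Num.max (rnorm x.1) (rnorm x.2).
Proof.
apply: complexI; rewrite -rnormE prod_normE !rnormE /Num.max ltcR.
by case: ltP.
Qed.

Fact prod_normM_le (x y : P) : `|prod_cmul x y| <= `|x| * `|y|.
Proof.
rewrite !rnormE -rmorphM lecR !rnorm_prod /= ge_max.
have := rnormM x.1 y.1; have := rnormM x.2 y.2.
set a := rnorm x.1; set b := rnorm x.2; set c := rnorm y.1; set d := rnorm y.2.
have a0 : 0 <= a by exact: rnorm_ge0. have b0 : 0 <= b by exact: rnorm_ge0.
have c0 : 0 <= c by exact: rnorm_ge0. have d0 : 0 <= d by exact: rnorm_ge0.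
move=> h1 h2; apply/andP; split.
  by apply: le_trans h2 _; rewrite ler_pM // le_max lexx.
by apply: le_trans h1 _; rewrite ler_pM // le_max lexx orbT.
Qed.

Fact prod_norm_starM (x : P) : `|prod_cmul (prod_star x) x| = `|x| ^+ 2.
Proof.
rewrite !rnormE -rmorphXn; congr (_%:C); rewrite !rnorm_prod /= !rnorm_starM.
have a0 := rnorm_ge0 x.1; have b0 := rnorm_ge0 x.2.
have [h|h] := leP (rnorm x.1) (rnorm x.2).
  by apply/max_idPr; rewrite ler_sqr ?nnegrE.
by apply/max_idPl; rewrite ler_sqr ?nnegrE // ltW.
Qed.

HB.instance Definition _ := CompleteNormedModule_isCStarAlgebra.Build R P
  prod_cmulA prod_cmulDl prod_cmulDr prod_cscalerAl prod_cscalerAr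
  prod_starK prod_starD prod_starZ prod_starM prod_normM_le prod_norm_starM.

End ProductCStar.

(** * States that restrict to characters of a topography *)

Section CharacterStates.
Variables (R : realType).
Implicit Types (T : topographic_sqlcms R).

Definition character_state T (nu : T -> R[i]) :=
  state_space T nu /\ restricts_to_character (tq_M T) nu.

Lemma cpos_real (z : R[i]) : 0 < z -> z = (complex.Re z)%:C /\ 0 < complex.Re z.
Proof.
by move=> z0; have := z0; rewrite ltcE => /andP[_ h]; rewrite RRe_real // gtr0_real.
Qed.

(** A state multiplicative at [h] sends [sandwich h b t] to [(nu h)^2 (nu b + t)], and [t] is
    [- mu b]; so the bound on the sandwich, divided by [(nu h)^2], bounds [nu b - mu b]. *)
Lemma bounded_sandwich_close (A : cstarType R) (L : lipdata A) (M : set A)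
    (h : A) (mu nu : A -> R[i]) :
  approximately_unital A -> M h -> strictly_positive h ->
  state_space A mu -> bounded_sandwich L h mu ->
  state_space A nu -> restricts_to_character M nu ->
  exists k, forall b, ldom_sa L b -> L b <= 1 -> cabs (nu b - mu b) <= k.
Proof.
move=> au Mh [sh hpos] smu [k hk] snu [cnu _].
have [pnu bnu _] := (stateP _).1 snu; have [pmu bmu _] := (stateP _).1 smu.
have [c_real c0] := cpos_real (hpos _ snu).
set c := complex.Re (nu h) in c_real c0.
have sand := functional_character_sandwich au pnu bnu sh (cnu _ _ Mh Mh).
exists (c ^- 2 * k) => b db lb; have [_ sb] := db.
pose t := - complex.Re (mu b).
have mub : mu b = (- t)%:C by rewrite opprK -(functional_sa au pmu bmu sb).
have : cabs (nu (sandwich h b t)) <= k.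
  by apply: (le_trans (bnu _)); rewrite mul1r; exact: hk.
have [lin _] := pnu.
rewrite /sandwich functionalD // functionalZ // sand (cnu _ _ Mh Mh) c_real mub.
have -> : c%:C * c%:C * nu b + t%:C * (c%:C * c%:C) = (c ^+ 2)%:C * (nu b - (- t)%:C).
  by rewrite rmorphN opprK rmorphXn; ring.
by rewrite cabsM cabs_nneg ?sqr_ge0 // ler_pdivlMl ?exprn_gt0.
Qed.

(** A topography grants a bounded sandwich for one state only. Replacing it by [nu] moves the scalar
    [t] by at most the constant of [bounded_sandwich_close]. *)
Lemma topography_character_state T : approximately_unital T ->
  exists h, [/\ tq_M T h, ldom (tq_L T) h, strictly_positive h &
    forall nu, character_state nu -> bounded_sandwich (tq_L T) h nu].
Proof.
move=> au; have [_ [h [mu [Mh dh sph [smu _ bmu]]]]] := tq_topography T.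
exists h; split=> // nu [snu cnu].
have [K hK] := bounded_sandwich_close au Mh sph smu bmu snu cnu.
have [k hk] := bmu.
have [_ bdmu _] := (stateP _).1 smu; have [pmu _ _] := (stateP _).1 smu.
exists (k + K * rnorm (h ** h)) => b t db lb nub.
have [_ sb] := db.
pose t1 := - complex.Re (mu b).
have mub : mu b = (- t1)%:C by rewrite opprK -(functional_sa au pmu bdmu sb).
have tt : `|t - t1| <= K.
  have := hK b db lb; rewrite nub mub -rmorphB /= cabs_real.
  by rewrite opprK addrC distrC.
have -> : sandwich h b t = sandwich h b t1 + (t - t1)%:C *: (h ** h).
  by rewrite /sandwich rmorphB; lmod.
apply: (le_trans (rnormD _ _)); rewrite rnormZr lerD //; first exact: hk.
by rewrite ler_wpM2r // rnorm_ge0.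
Qed.

Lemma mk_character_states T (nu1 nu2 : T -> R[i]) : approximately_unital T ->
  character_state nu1 -> character_state nu2 -> (mk (tq_L T) nu1 nu2 < +oo)%E.
Proof.
move=> au [s1 c1] ch2; have [h [Mh dh sph hb]] := topography_character_state au.
have [s2 _] := ch2; apply/mk_ltyP.
exact: bounded_sandwich_close au Mh sph s2 (hb _ ch2) s1 c1.
Qed.

Lemma mk_tri (A : cstarType R) (L : lipdata A) (f g k : A -> R[i]) :
  (mk L f g < +oo)%E -> (mk L g k < +oo)%E -> (mk L f k < +oo)%E.
Proof.
move=> /mk_ltyP[c1 h1] /mk_ltyP[c2 h2]; apply/mk_ltyP; exists (c1 + c2) => a da la.
have -> : f a - k a = (f a - g a) + (g a - k a) by rewrite addrA subrK.
by apply: (le_trans (cabsD _ _)); rewrite lerD ?h1 ?h2.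
Qed.

(* What the gluing of two tunnels uses of the common end point. *)
Record leg T (B : cstarType R) (p : T -> B) (nu : B -> R[i]) : Prop := Leg {
  leg_morphism : star_morphism p;
  leg_surjective : forall b, exists d, p d = b;
  leg_unital : approximately_unital T;
  leg_state : state_space B nu;
  leg_character : character_state (nu \o p)
}.

(** Terms of the exhaustive sequence lift through [p] inside the topography, with norm and seminorm
    multiplied by at most [1 + d]; the lifts serve as almost units with small Lipschitz constant. *)
Lemma pinned_lift M (T : topographic_sqlcms R) (BB : pointed_proper_qms R) (p : T -> BB) :
  topographic_quantum_isometry M p ->
  forall e : R, 0 < e -> exists d, [/\ tq_M T d, ldom_sa (tq_L T) d,
    rnorm d <= 1 + e, tq_L T d <= e & cabs (pq_mu BB (p d) - 1) <= e].
Proof.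
move=> iso e e0.
have [h [dh Lh muh nh] Mh] := pp_exhaustive (pq_pointed_proper BB).
have Lsemi := sqlcms_seminorm (pp_sqlcms (pq_pointed_proper BB)).
pose d := Num.min (e / 4) 1.
have d0 : 0 < d by rewrite lt_min divr_gt0 //=.
have d1 : d <= 1 by rewrite ge_min lexx orbT.
have de : d <= e / 4 by rewrite ge_min lexx.
have [n [n1 n2 n3]] : exists n, [/\ pq_L BB (h n) <= d, rnorm (h n) <= 1 + d &
    cabs (pq_mu BB (h n) - 1) <= d].
  have /cvgrPdist_lt /(_ _ d0)[m1 _ h1] := Lh.
  have /cvgrPdist_lt /(_ _ d0)[m2 _ h2] := nh.
  have dC : 0 < d%:C :> R[i] by rewrite ltcR.
  have /cvgrPdist_lt /(_ _ dC)[m3 _ h3] := muh.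
  exists (maxn m1 (maxn m2 m3)); split.
  - have := h1 _ (leq_maxl m1 (maxn m2 m3)); rewrite /= sub0r normrN => /ltW.
    exact: le_trans (ler_norm _).
  - have := h2 _ (leq_trans (leq_maxl m2 m3) (leq_maxr m1 _)); rewrite /= => /ltW.
    by rewrite ler_distlC => /andP[].
  - have := h3 _ (leq_trans (leq_maxr m2 m3) (leq_maxr m1 _)); rewrite /= => h'.
    apply/ltW; rewrite cdistC -ltcR -cabsE; exact: h'.
(* The tolerance [ln (1 + d)] turns the factor [expR] into [1 + d]. *)
have l20 : 0 < ln (1 + d) by rewrite ln_gt0 // ltrDl.
have [x [Mx dx px nx Lx]] := tqi_lift iso (dh n) (Mh n) l20.
exists x; rewrite px; split => //.
- apply: (le_trans nx); rewrite lnK ?posrE; last by rewrite addr_gt0.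
  by nra.
- apply: (le_trans Lx); rewrite lnK ?posrE; last by rewrite addr_gt0.
  by have := lip_ge0 Lsemi (dh n).1; nra.
- by apply: (le_trans n3); lra.
Qed.

(** Pulling back a state could lower its norm. The elements of [pinned_lift], of norm at most
    [1 + e] and value within [e] of 1, exclude this and also show that the character is not zero on
    the topography. *)
Lemma leg_isometry M T (BB : pointed_proper_qms R) (p : T -> BB) :
  topographic_quantum_isometry M p -> leg p (pq_mu BB).
Proof.
move=> iso; have iso' := tqi_isometry iso.
have st := qi_morphism iso'.
have smu : state_space BB (pq_mu BB) by case: (pp_pin (pq_pointed_proper BB)).
have [[lin pos] bd _] := (stateP _).1 smu.
split=> //.
- exact: qi_surjective iso'.
- have [I [le [v [av _]]]] := qi_proper iso'.
  exact: approximate_unit_approximately av.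
split.
- apply/stateP; split; [exact: positive_pullback|exact: fbound_pullback|].
  move=> r r1.
  have [r0|r0] := ltP r 0.
    by exists 0; [rewrite rnorm0|apply: lt_le_trans r0 (cabs_ge0 _)].
  pose e := (1 - r) / 4.
  have e0 : 0 < e by rewrite divr_gt0 // subr_gt0.
  have [x [_ _ nx _ mx]] := pinned_lift iso e0.
  have e1 : 0 < 1 + e by rewrite addr_gt0.
  exists ((1 + e)^-1%:C *: x).
    rewrite rnormZr ger0_norm ?invr_ge0 ?(ltW e1) // ler_pdivrMl // mulr1 //.
  rewrite /= (star_morphismZ st) functionalZ // cabsM cabs_nneg ?invr_ge0 ?(ltW e1) //.
  rewrite ltr_pdivlMl //.
  have := cabsB 1 (1 - pq_mu BB (p x)); rewrite subKr cabs1 cdistC => h.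
  have h2 : 1 - e <= cabs (pq_mu BB (p x)).
    have := cabsB (pq_mu BB (p x)) (pq_mu BB (p x) - 1); rewrite subKr cabs1; lra.
  by apply: lt_le_trans h2; rewrite /e in e0 *; nra.
split.
- move=> a b Ma Mb /=; rewrite (star_morphismM st).
  have [cmu _] := pp_character (pq_pointed_proper BB).
  by apply: cmu; apply: (tqi_sub iso); [exists a|exists b].
- have e0 : 0 < 2^-1 :> R by rewrite invr_gt0.
  have [x [Mx _ _ _ mx]] := pinned_lift iso e0.
  exists x => //=; apply/eqP => h; move: mx; rewrite h sub0r cabsN cabs1.
  by rewrite leNgt => /negP; apply; lra.
Qed.

End CharacterStates.

(** * Weak* control of positive functionals of norm at most 1 *)

Section NormalizedFunctionals.
Variables (R : realType) (A : cstarType R).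
Implicit Types (a : A) (phi psi : A -> R[i]) (r t : R).

Lemma state_normalize phi c : positive_functional phi -> 0 <= c -> fbound phi c ->
  0 < fnorm phi -> state_space A (fun a => (fnorm phi)^-1%:C * phi a).
Proof.
move=> pos c0 bd t0; have [lin _] := pos; have it0 : 0 <= (fnorm phi)^-1.
  by rewrite invr_ge0 ltW.
apply/stateP; split; first exact: positive_scale.
  have := fbound_scale it0 (fnorm_bound lin c0 bd).
  by rewrite mulVf // gt_eqF.
move=> r r1; have rt : r * fnorm phi < fnorm phi.
  by rewrite gtr_pMl.
have [a a1 ra] := fnorm_witness lin c0 bd rt; exists a => //.
by rewrite cabsM cabs_nneg // ltr_pdivlMl // mulrC.
Qed.

Lemma fnorm_state phi : state_space A phi -> fnorm phi = 1.
Proof. by move=> [_ h]; rewrite /fnorm h. Qed.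

Variable L : lipdata A.
Hypothesis Lsemi : seminorm_on_dom L.
Hypothesis Lherm : hermitian_seminorm L.
Hypothesis Ldense : dense (ldom L).
Hypothesis Lweak : induces_weak_star (bl L 1).

(* The metric controls positive contractive functionals, once their norms are
   taken into account, and not just states. *)
Lemma positive_weak_control phi r : positive_functional phi -> fbound phi 1 -> 0 < r ->
  exists (s : seq A) (e : R), 0 < e /\ forall psi, positive_functional psi -> fbound psi 1 ->
    (forall a, a \in s -> cabs (psi a - phi a) < e) ->
    `|fnorm psi - fnorm phi| < e ->
    forall a, ldom_sa L a -> lip_norm L 1 a <= 1 -> cabs (phi a - psi a) <= r.
Proof.
move=> pos bd r0; have [lin _] := pos.
have t0 := fnorm_ge0 lin ler01 bd; have tbd := fnorm_bound lin ler01 bd.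
have norm_le1 a : lip_norm L 1 a <= 1 -> rnorm a <= 1.
  by move=> /(lip_norm_leP _ _ _ ltr01)[]; rewrite mulr1.
move: t0; rewrite le_eqVlt => /predU1P[t0|t0].
  (* If [phi] has norm 0, a small norm of [psi] suffices and no element is tested. *)
  exists [::], r; split=> // psi ppos pbd _; rewrite -t0 subr0 => pr a _ la.
  rewrite -t0 in tbd; rewrite (fbound0 tbd) sub0r cabsN.
  have [plin _] := ppos.
  apply: (le_trans (fnorm_bound plin ler01 pbd a)); apply: le_trans (ltW pr).
  apply: le_trans (ler_norm _); rewrite ler_piMr ?norm_le1 //.
  exact: fnorm_ge0 plin ler01 pbd.
set t := fnorm phi in t0 tbd *.
have r20 : 0 < r / 2 by rewrite divr_gt0.
have [s [e0 [e00 he0]]] := (induces_weak_starP Lsemi Lherm Ldense).1 Lweak _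
  (state_normalize pos ler01 bd t0) _ r20.
pose C := \sum_(a <- s) rnorm a.
have C0 : 0 <= C by apply: sumr_ge0 => a _; exact: rnorm_ge0.
have aC a : a \in s -> rnorm a <= C.
  move=> ain; rewrite /C (big_rem a) //= lerDl.
  by apply: sumr_ge0 => b _; exact: rnorm_ge0.
have C1 : 0 < 1 + C by rewrite ltr_pwDl.
(* The first bound keeps [fnorm psi] above [t / 2], the second makes the normalized functionals
   [e0]-close on [s], the third absorbs the difference of the norms. *)
pose e := Num.min (t / 2) (Num.min (e0 * t / (2 * (1 + C))) (r / 2)).
have e0' : 0 < e.
  by rewrite !lt_min r20 !divr_gt0 ?mulr_gt0.
have et : e <= t / 2 by rewrite ge_min lexx.
have er : e <= r / 2 by rewrite !ge_min lexx !orbT.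
have ee : e * (1 + C) <= e0 * (t / 2).
  have : e <= e0 * t / (2 * (1 + C)) by rewrite !ge_min lexx !orbT.
  have -> : e0 * t / (2 * (1 + C)) = e0 * (t / 2) / (1 + C) by field; rewrite gt_eqF.
  by rewrite ler_pdivlMr.
clearbody e.
exists s, e; split=> // psi ppos pbd close; set tau := fnorm psi => tau_close a da la.
have [plin _] := ppos.
move: tau_close; rewrite ltr_norml => /andP[tau1 tau2].
have tau0 : 0 < tau by lra.
have tau_le1 : tau <= 1 by exact: fnorm_le plin ler01 pbd.
pose phi' b := t^-1%:C * phi b; pose psi' b := tau^-1%:C * psi b.
have /bl_ltP[k kr hk] : (bl L 1 phi' psi' < (r / 2)%:E)%E.
  apply: he0; first exact: state_normalize.
  move=> b bs; rewrite /psi' -/t.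
  have -> : tau^-1%:C * psi b - t^-1%:C * phi b =
      tau^-1%:C * ((psi b - phi b) + (t - tau)%:C * (t^-1%:C * phi b)).
    rewrite !fmorphV rmorphB; field.
    by rewrite !(fmorph_eq0 (real_complex R)) !gt_eqF.
  rewrite cabsM cabs_nneg ?invr_ge0 ?(ltW tau0) // ltr_pdivrMl //.
  apply: (le_lt_trans (cabsD _ _)); rewrite cabsM cabs_real cabsM cabs_nneg; last first.
    by rewrite invr_ge0 ltW.
  have h1 := close _ bs.
  have h2 : t^-1 * cabs (phi b) <= C.
    by rewrite ler_pdivrMl //; apply: (le_trans (tbd b)); rewrite ler_wpM2l ?aC // ltW.
  have h3 : `|t - tau| <= e by rewrite ler_norml; apply/andP; split; lra.
  have h4 : `|t - tau| * (t^-1 * cabs (phi b)) <= e * C.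
    by rewrite ler_pM // mulr_ge0 ?invr_ge0 ?cabs_ge0 // ltW.
  have h5 : e0 * (t / 2) <= tau * e0 by rewrite mulrC ler_wpM2r //; lra.
  lra.
have := hk a da la; rewrite /phi' /psi'.
have -> : phi a - psi a = tau%:C * (t^-1%:C * phi a - tau^-1%:C * psi a) +
    (t - tau)%:C * (t^-1%:C * phi a).
  rewrite !fmorphV rmorphB; field.
  by rewrite !(fmorph_eq0 (real_complex R)) !gt_eqF.
move=> h1; apply: (le_trans (cabsD _ _)); rewrite !cabsM cabs_nneg ?(ltW tau0) //.
rewrite cabs_real cabs_nneg ?invr_ge0 ?(ltW t0) //.
have h2 : t^-1 * cabs (phi a) <= 1.
  rewrite ler_pdivrMl // mulr1; apply: (le_trans (tbd a)).
  by rewrite ler_piMr ?norm_le1 // ltW.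
have h3 : `|t - tau| * (t^-1 * cabs (phi a)) <= r / 2.
  apply: le_trans (_ : `|t - tau| <= _); first by rewrite ler_piMr.
  by rewrite ler_norml; apply/andP; split; lra.
have h4 : tau * cabs (t^-1%:C * phi a - tau^-1%:C * psi a) <= r / 2.
  apply: le_trans (_ : cabs (t^-1%:C * phi a - tau^-1%:C * psi a) <= _).
    by rewrite ler_piMl // cabs_ge0.
  exact: le_trans h1 (ltW kr).
lra.
Qed.

End NormalizedFunctionals.

Section DirectSum.
Variables (R : realType) (A B : cstarType R).
Local Notation P := (A * B)%type.
Implicit Types (phi : P -> R[i]) (d : P).

Lemma fst_morphism : star_morphism (fst : P -> A). Proof. by split. Qed.
Lemma snd_morphism : star_morphism (snd : P -> B). Proof. by split. Qed.

Lemma inl_morphism : star_morphism (fun a : A => (a, 0) : P).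
Proof.
split=> [c a b|a b|a]; congr pair; rewrite /= ?scaler0 ?addr0 ?cmul0r ?star0 //.
Qed.
Lemma inr_morphism : star_morphism (fun b : B => (0, b) : P).
Proof.
split=> [c a b|a b|a]; congr pair; rewrite /= ?scaler0 ?addr0 ?cmul0r ?star0 //.
Qed.

Definition part1 phi (a : A) : R[i] := phi (a, 0).
Definition part2 phi (b : B) : R[i] := phi (0, b).

Lemma partE phi d : scalar phi -> phi d = part1 phi d.1 + part2 phi d.2.
Proof.
move=> lin; rewrite /part1 /part2 -functionalD //; congr phi.
by case: d => a b; congr pair; rewrite /= ?addr0 ?add0r.
Qed.

Lemma part1_positive phi : positive_functional phi -> positive_functional (part1 phi).
Proof. exact: (positive_pullback inl_morphism). Qed.
Lemma part2_positive phi : positive_functional phi -> positive_functional (part2 phi).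
Proof. exact: (positive_pullback inr_morphism). Qed.
Lemma part1_bound phi c : 0 <= c -> fbound phi c -> fbound (part1 phi) c.
Proof. exact: (fbound_pullback inl_morphism). Qed.
Lemma part2_bound phi c : 0 <= c -> fbound phi c -> fbound (part2 phi) c.
Proof. exact: (fbound_pullback inr_morphism). Qed.

(** Near-norming elements of the two parts, turned by phases so that the values are nonnegative,
    form one element of norm at most 1, since the norm of the direct sum is a maximum. *)
Lemma fnorm_part_le phi : scalar phi -> fbound phi 1 ->
  fnorm (part1 phi) + fnorm (part2 phi) <= fnorm phi.
Proof.
move=> lin bd.
have b1 := part1_bound ler01 bd; have b2 := part2_bound ler01 bd.
have l1 : scalar (part1 phi) := scalar_pullback inl_morphism lin.
have l2 : scalar (part2 phi) := scalar_pullback inr_morphism lin.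
apply/ler_addgt0Pr => e e0; have e20 : 0 < e / 2 by rewrite divr_gt0.
have [|a a1 ha] := fnorm_witness l1 ler01 b1 (r := fnorm (part1 phi) - e / 2).
  by rewrite gtrBl.
have [|b b1' hb] := fnorm_witness l2 ler01 b2 (r := fnorm (part2 phi) - e / 2).
  by rewrite gtrBl.
pose d : P := (phase (part1 phi a) *: a, phase (part2 phi b) *: b).
have nd : rnorm d <= 1.
  by rewrite rnorm_prod /= !rnormZ !cabs_phase !mul1r ge_max a1.
have : cabs (phi d) <= fnorm phi.
  apply: (le_trans (fnorm_bound lin ler01 bd d)).
  by rewrite ler_piMr // (fnorm_ge0 lin ler01 bd).
rewrite (partE d lin) /= (functionalZ l1) (functionalZ l2) !phaseM -rmorphD /=.
rewrite cabs_nneg ?addr_ge0 ?cabs_ge0 //; lra.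
Qed.

Lemma state_fst (phi : A -> R[i]) : state_space A phi ->
  state_space P (phi \o fst).
Proof.
move=> /stateP[pos bd h]; apply/stateP; split.
- exact: (positive_pullback fst_morphism).
- exact: (fbound_pullback fst_morphism).
- move=> r /h[a a1 ha]; exists (a, 0) => //.
  by rewrite rnorm_prod /= rnorm0 ge_max a1 ler01.
Qed.

End DirectSum.

Lemma fnorm_parts (R : realType) (A B : cstarType R) (phi : A * B -> R[i]) :
  scalar phi -> fbound phi 1 -> fnorm phi = fnorm (part1 phi) + fnorm (part2 phi).
Proof.
move=> lin bd; apply/eqP; rewrite eq_le fnorm_part_le // andbT.
have b1 := part1_bound ler01 bd; have b2 := part2_bound ler01 bd.
have l1 : scalar (part1 phi) := scalar_pullback (inl_morphism A B) lin.
have l2 : scalar (part2 phi) := scalar_pullback (inr_morphism A B) lin.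
have t1 := fnorm_ge0 l1 ler01 b1; have t2 := fnorm_ge0 l2 ler01 b2.
apply: fnorm_le => //; first exact: addr_ge0.
move=> d; rewrite (partE d lin); apply: (le_trans (cabsD _ _)).
apply: (le_trans (lerD (fnorm_bound l1 ler01 b1 _) (fnorm_bound l2 ler01 b2 _))).
by rewrite mulrDl rnorm_prod lerD // ler_wpM2l // le_max lexx ?orbT.
Qed.

(** * Gluing two quantum metric spaces over a common quotient *)

Section Glue.
Variables (R : realType) (T1 T2 : topographic_sqlcms R) (B : cstarType R).
Variables (p1 : T1 -> B) (p2 : T2 -> B) (nu : B -> R[i]) (eps : R).
Hypotheses (leg1 : leg p1 nu) (leg2 : leg p2 nu) (eps0 : 0 < eps).

Local Notation D := (tq_alg T1 * tq_alg T2)%type.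
Implicit Types (d : D) (phi psi : D -> R[i]).

(* The bridge term makes elements of small Lipschitz constant agree in B up to
   eps, so that the two copies of the states of B are eps-close. *)
Definition glueL : lipdata D := LipData
  [set d | ldom (tq_L T1) d.1 /\ ldom (tq_L T2) d.2]
  (fun d => Num.max (Num.max (tq_L T1 d.1) (tq_L T2 d.2))
                    (eps^-1 * rnorm (p1 d.1 - p2 d.2))).

Definition glueM : set D := [set d | tq_M T1 d.1 /\ tq_M T2 d.2].

Let st1 := leg_morphism leg1.
Let st2 := leg_morphism leg2.
Let S1 := tq_sqlcms T1.
Let S2 := tq_sqlcms T2.
Let semi1 := sqlcms_seminorm S1.
Let semi2 := sqlcms_seminorm S2.
Let herm1 := sqlcms_hermitian S1.
Let herm2 := sqlcms_hermitian S2.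

Lemma glueL_leP d r : glueL d <= r <-> [/\ tq_L T1 d.1 <= r, tq_L T2 d.2 <= r &
  rnorm (p1 d.1 - p2 d.2) <= eps * r].
Proof.
rewrite /= !ge_max ler_pdivrMl //.
by split=> [/andP[/andP[-> ->] ->]|[-> -> ->]].
Qed.

Lemma glue_dom_saP d :
  ldom_sa glueL d <-> ldom_sa (tq_L T1) d.1 /\ ldom_sa (tq_L T2) d.2.
Proof.
split=> [[[d1 d2] sd]|[[d1 s1] [d2 s2]]].
  by split; split=> //; [have := congr1 fst sd|have := congr1 snd sd].
by split=> //; rewrite /sa /=; case: d d1 s1 d2 s2 => a b /= _ s1 _ s2; congr pair.
Qed.

Lemma glue_lip_norm_leP M d r : 0 < M -> lip_norm glueL M d <= r <->
  [/\ lip_norm (tq_L T1) M d.1 <= r, lip_norm (tq_L T2) M d.2 <= r &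
      rnorm (p1 d.1 - p2 d.2) <= eps * r].
Proof.
move=> M0; split.
  move=> /(lip_norm_leP _ _ _ M0)[]; rewrite rnorm_prod ge_max => /andP[n1 n2].
  by move=> /glueL_leP[l1 l2 l3]; split=> //; apply/(lip_norm_leP _ _ _ M0).
move=> [/(lip_norm_leP _ _ _ M0)[n1 l1] /(lip_norm_leP _ _ _ M0)[n2 l2] l3].
apply/(lip_norm_leP _ _ _ M0); split; first by rewrite rnorm_prod ge_max n1.
by apply/glueL_leP.
Qed.

Lemma glue_seminorm : seminorm_on_dom glueL.
Proof.
split.
- split; first by split; exact: dom0.
  move=> c a b [a1 a2] [b1 b2]; split.
    by apply: (domD semi1) => //; exact: domZ.
  by apply: (domD semi2) => //; exact: domZ.
- move=> a b [a1 a2] [b1 b2].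
  have /glueL_leP[h1 h2 h3] := lexx (glueL a).
  have /glueL_leP[k1 k2 k3] := lexx (glueL b).
  apply/glueL_leP; split.
  + by apply: (le_trans (lipD semi1 a1 b1)); rewrite lerD.
  + by apply: (le_trans (lipD semi2 a2 b2)); rewrite lerD.
  + rewrite /= (star_morphismD st1) (star_morphismD st2) opprD addrACA mulrDr.
    by apply: (le_trans (rnormD _ _)); rewrite lerD.
- move=> c a [a1 a2]; rewrite -/(cabs c) /= (lipZ semi1) // (lipZ semi2) //.
  rewrite (star_morphismZ st1) (star_morphismZ st2) -scalerBr rnormZ mulrCA.
  by rewrite !maxr_pMr ?cabs_ge0.
Qed.

Lemma glue_hermitian : hermitian_seminorm glueL.
Proof.
move=> a [a1 a2]; split; first by split; apply: dom_star.
rewrite /= (lip_star herm1) // (lip_star herm2) //.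
by rewrite (star_morphism_star st1) (star_morphism_star st2) -starB rnorm_star.
Qed.

Let state_nu : state_space T1 (nu \o p1) /\ state_space T2 (nu \o p2).
Proof. by case: (leg_character leg1); case: (leg_character leg2). Qed.

Lemma unit_image (T : topographic_sqlcms R) (p : T -> B) u :
  leg p nu -> is_unit_of u -> is_unit_of (p u).
Proof.
move=> lg uP b; have [d <-] := leg_surjective lg b.
by rewrite -!(star_morphismM (leg_morphism lg)) (uP d).1 (uP d).2.
Qed.

Lemma unit_unique (v w : B) : is_unit_of v -> is_unit_of w -> v = w.
Proof. by move=> vP wP; rewrite -(wP v).2 (vP w).1. Qed.

(** The algebra [B] supports a nonzero functional, through [p1], so its unit is not 0. *)
Lemma scale_unit_eq0 (v : B) (c : R[i]) : is_unit_of v -> c *: v = 0 -> c = 0.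
Proof.
move=> vP cv; apply/eqP; apply: contraT => c0.
have b0 (b : B) : b = 0.
  by rewrite -(vP b).1 -[v]scale1r -(mulVf c0) -scalerA cv scaler0 cmul0r.
have /stateP[[lin _] _ /(_ 0 ltr01)[a _]] := state_nu.1.
by rewrite /= (b0 (p1 a)) -(b0 (p1 0)) -/((nu \o p1) 0) (functional0 lin) cabs0 ltxx.
Qed.

(** The components of a null element are multiples of the units, or 0, with the same image in [B].
    Two units force equal coefficients; if one algebra has no unit, its zero component forces the
    other coefficient to vanish by [scale_unit_eq0]. *)
Lemma glue_norm_modulo_constants : norm_modulo_constants glueL.
Proof.
have glue0 d : glueL d = 0 -> ldom glueL d ->
    [/\ tq_L T1 d.1 = 0, tq_L T2 d.2 = 0 & p1 d.1 = p2 d.2].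
  move=> h [d1 d2]; have /glueL_leP := lexx (glueL d); rewrite h mulr0 => -[h1 h2 h3].
  split; first by apply/eqP; rewrite eq_le h1 (lip_ge0 semi1).
    by apply/eqP; rewrite eq_le h2 (lip_ge0 semi2).
  apply/eqP; rewrite -subr_eq0; apply/eqP/rnorm_eq0/eqP.
  by rewrite eq_le h3 rnorm_ge0.
have [N1u N1n] := sqlcms_norm S1; have [N2u N2n] := sqlcms_norm S2.
split=> [u uP|nu_unit d dd Ld].
  have u1 : is_unit_of u.1.
    by move=> a; have [/(congr1 fst) /= -> /(congr1 fst) /= ->] := uP (a, 0).
  have u2 : is_unit_of u.2.
    by move=> b; have [/(congr1 snd) /= -> /(congr1 snd) /= ->] := uP (0, b).
  have v1 := unit_image leg1 u1; have v2 := unit_image leg2 u2.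
  have v12 := unit_unique v1 v2.
  apply/seteqP; split=> [d [dd /glue0 /(_ dd)[h1 h2 h3]]|_ [c _ <-]] /=.
    have [d1 d2] := dd.
    have : [set a | ldom (tq_L T1) a /\ tq_L T1 a = 0] d.1 by [].
    rewrite (N1u _ u1) => -[c1 _ c1E].
    have : [set a | ldom (tq_L T2) a /\ tq_L T2 a = 0] d.2 by [].
    rewrite (N2u _ u2) => -[c2 _ c2E].
    have c12 : c1 = c2.
      apply/eqP; rewrite -subr_eq0; apply/eqP/(scale_unit_eq0 v1).
      rewrite scalerBl {2}v12 -(star_morphismZ st1) -(star_morphismZ st2).
      by rewrite c1E c2E h3 subrr.
    exists c1 => //; rewrite [d]surjective_pairing -c1E -c2E c12.
    by case: u {uP u1 u2 v1 v2 v12 c1E c2E}.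
  have [k1 k1'] : [set a | ldom (tq_L T1) a /\ tq_L T1 a = 0] (c *: u.1).
    by rewrite (N1u _ u1); exists c.
  have [k2 k2'] : [set a | ldom (tq_L T2) a /\ tq_L T2 a = 0] (c *: u.2).
    by rewrite (N2u _ u2); exists c.
  split=> //; rewrite k1' k2' (star_morphismZ st1) (star_morphismZ st2) v12.
  by rewrite subrr rnorm0 mulr0 !maxxx.
have [h1 h2 h3] := glue0 _ Ld dd; have [d1 d2] := dd.
have [[u1 u1P]|nu1] := pselect (exists u : T1, is_unit_of u); last first.
  have d10 : d.1 = 0 by exact: N1n.
  have d20 : d.2 = 0.
    have [[u2 u2P]|nu2] := pselect (exists u : T2, is_unit_of u); last exact: N2n.
    have : [set a | ldom (tq_L T2) a /\ tq_L T2 a = 0] d.2 by [].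
    rewrite (N2u _ u2P) => -[c _ cE].
    have c0 : c = 0.
      apply: (scale_unit_eq0 (unit_image leg2 u2P)).
      by rewrite -(star_morphismZ st2) cE -h3 d10 (star_morphism0 st1).
    by rewrite -cE c0 scale0r.
  by rewrite [d]surjective_pairing d10 d20.
have [[u2 u2P]|nu2] := pselect (exists u : T2, is_unit_of u).
  case: nu_unit; exists ((u1, u2) : D) => -[a b].
  by split; congr pair; [exact: (u1P a).1|exact: (u2P b).1|exact: (u1P a).2|exact: (u2P b).2].
have d20 : d.2 = 0 by exact: N2n.
have d10 : d.1 = 0.
  have : [set a | ldom (tq_L T1) a /\ tq_L T1 a = 0] d.1 by [].
  rewrite (N1u _ u1P) => -[c _ cE].
  have c0 : c = 0.
    apply: (scale_unit_eq0 (unit_image leg1 u1P)).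
    by rewrite -(star_morphismZ st1) cE h3 d20 (star_morphism0 st2).
  by rewrite -cE c0 scale0r.
by rewrite [d]surjective_pairing d10 d20.
Qed.

Lemma glue_leibniz : leibniz glueL.
Proof.
have [D1 Leib1] := sqlcms_leibniz S1; have [D2 Leib2] := sqlcms_leibniz S2.
split=> a b [a1 a2] [b1 b2]; first by split; [exact: D1|exact: D2].
have /glueL_leP[h1 h2 h3] := lexx (glueL a).
have /glueL_leP[k1 k2 k3] := lexx (glueL b).
have na : rnorm a.1 <= rnorm a /\ rnorm a.2 <= rnorm a.
  by rewrite rnorm_prod !le_max !lexx orbT.
have nb : rnorm b.1 <= rnorm b /\ rnorm b.2 <= rnorm b.
  by rewrite rnorm_prod !le_max !lexx orbT.
have [na1 na2] := na; have [nb1 nb2] := nb.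
have La1 := lip_ge0 semi1 a1; have La2 := lip_ge0 semi2 a2.
have Lb1 := lip_ge0 semi1 b1; have Lb2 := lip_ge0 semi2 b2.
apply/glueL_leP; split.
- apply: (le_trans (Leib1 _ _ a1 b1)).
  by rewrite lerD // ler_pM // rnorm_ge0.
- apply: (le_trans (Leib2 _ _ a2 b2)).
  by rewrite lerD // ler_pM // rnorm_ge0.
rewrite /= (star_morphismM st1) (star_morphismM st2).
(* The bridge is a derivation for the two actions on [B]; contractivity of [p1] and [p2] bounds the
   outer factors. *)
have -> : p1 a.1 ** p1 b.1 - p2 a.2 ** p2 b.2 =
    p1 a.1 ** (p1 b.1 - p2 b.2) + (p1 a.1 - p2 a.2) ** p2 b.2.
  by rewrite cmulBr cmulBl addrA subrK.
apply: (le_trans (rnormD _ _)).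
have e1 : rnorm (p1 a.1 ** (p1 b.1 - p2 b.2)) <= rnorm a * (eps * glueL b).
  apply: (le_trans (rnormM _ _)); apply: ler_pM; rewrite ?rnorm_ge0 //.
  by apply: le_trans na1; exact: star_morphism_contractive.
have e2 : rnorm ((p1 a.1 - p2 a.2) ** p2 b.2) <= eps * glueL a * rnorm b.
  apply: (le_trans (rnormM _ _)); apply: ler_pM; rewrite ?rnorm_ge0 //.
  by apply: le_trans nb2; exact: star_morphism_contractive.
apply: (le_trans (lerD e1 e2)).
rewrite -[leRHS]/(eps * (rnorm a * glueL b + glueL a * rnorm b)).
by rewrite le_eqVlt; apply/orP; left; apply/eqP; ring.
Qed.

Lemma glue_dense : dense (ldom glueL).
Proof.
apply/dense_rnormP => d e e0.
have [x dx xd] := (dense_rnormP _).1 (sqlcms_dense S1) d.1 e e0.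
have [y dy yd] := (dense_rnormP _).1 (sqlcms_dense S2) d.2 e e0.
by exists (x, y) => //; rewrite rnorm_prod gt_max; apply/andP; split.
Qed.

Lemma glue_separable : separable_cstar D.
Proof.
have [Q1 c1 /dense_rnormP d1] := sqlcms_separable S1.
have [Q2 c2 /dense_rnormP d2] := sqlcms_separable S2.
exists (Q1 `*` Q2); first exact: countableX.
apply/dense_rnormP => d e e0.
have [x dx xd] := d1 d.1 e e0; have [y dy yd] := d2 d.2 e e0.
by exists (x, y) => //; rewrite rnorm_prod gt_max; apply/andP; split.
Qed.

Lemma glue_closed : sa D `&` closure [set a | ldom_sa glueL a /\ glueL a <= 1]
  `<=` [set a | ldom_sa glueL a /\ glueL a <= 1].
Proof.
move=> d [sd /closure_rnormP cl].
have s1 : sa T1 d.1 by have := congr1 fst sd.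
have s2 : sa T2 d.2 by have := congr1 snd sd.
have [|h1 l1] := sqlcms_closed S1 (t := d.1).
  split=> //; apply/closure_rnormP => e /cl[x [/glue_dom_saP[x1 x2] /glueL_leP[y1 y2 _]]].
  by rewrite rnorm_prod gt_max => /andP[dx _]; exists x.1.
have [|h2 l2] := sqlcms_closed S2 (t := d.2).
  split=> //; apply/closure_rnormP => e /cl[x [/glue_dom_saP[x1 x2] /glueL_leP[y1 y2 _]]].
  by rewrite rnorm_prod gt_max => /andP[_ dx]; exists x.2.
split; first exact/glue_dom_saP.
apply/glueL_leP; split=> //; apply/ler_addgt0Pr => e e0.
have e20 : 0 < e / 2 by rewrite divr_gt0.
have [x [_ /glueL_leP[_ _ xb]]] := cl _ e20.
rewrite rnorm_prod gt_max => /andP[/= dx1 dx2].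
have -> : p1 d.1 - p2 d.2 = p1 (d.1 - x.1) + (p1 x.1 - p2 x.2) - p2 (d.2 - x.2).
  by rewrite (star_morphismB st1) (star_morphismB st2); lmod.
apply: (le_trans (rnormB _ _)).
have := rnormD (p1 (d.1 - x.1)) (p1 x.1 - p2 x.2).
have := star_morphism_contractive st1 (d.1 - x.1).
have := star_morphism_contractive st2 (d.2 - x.2).
lra.
Qed.

(** The norms of the parts of a state have to be controlled as well. Near-norming elements bound the
    norms of the parts of [psi] from below; as both pairs of norms sum to 1, this also bounds them
    from above. *)
Lemma glue_weak_star : induces_weak_star (bl glueL 1).
Proof.
apply/(induces_weak_starP glue_seminorm glue_hermitian glue_dense).
move=> phi sphi r r0; have /stateP[pos bd _] := sphi; have [lin _] := pos.
have r30 : 0 < r / 3 by rewrite divr_gt0.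
have P1 := part1_positive pos; have P2 := part2_positive pos.
have b1 := part1_bound ler01 bd; have b2 := part2_bound ler01 bd.
have [l1 _] := P1; have [l2 _] := P2.
have [s1 [e1 [e10 h1]]] := positive_weak_control semi1 herm1 (sqlcms_dense S1)
  (sqlcms_weak_star S1) P1 b1 r30.
have [s2 [e2 [e20 h2]]] := positive_weak_control semi2 herm2 (sqlcms_dense S2)
  (sqlcms_weak_star S2) P2 b2 r30.
pose e := Num.min e1 e2.
have e0 : 0 < e by rewrite lt_min e10.
have ee1 : e <= e1 by rewrite ge_min lexx.
have ee2 : e <= e2 by rewrite ge_min lexx orbT.
have eh0 : 0 < e / 2 by rewrite divr_gt0.
have [|a a1 ha] := fnorm_witness l1 ler01 b1 (r := fnorm (part1 phi) - e / 2).
  by rewrite gtrBl.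
have [|b b1' hb] := fnorm_witness l2 ler01 b2 (r := fnorm (part2 phi) - e / 2).
  by rewrite gtrBl.
pose s : seq D := [seq (x, 0) | x <- a :: s1] ++ [seq (0, y) | y <- b :: s2].
exists s, (e / 2); split=> // psi spsi close.
have /stateP[pos' bd' _] := spsi; have [lin' _] := pos'.
have Q1 := part1_positive pos'; have Q2 := part2_positive pos'.
have c1 := part1_bound ler01 bd'; have c2 := part2_bound ler01 bd'.
have [m1 _] := Q1; have [m2 _] := Q2.
have close1 x : x \in a :: s1 -> cabs (part1 psi x - part1 phi x) < e / 2.
  by move=> xs; apply: close; rewrite mem_cat (map_f (fun x => (x, 0) : D)).
have close2 y : y \in b :: s2 -> cabs (part2 psi y - part2 phi y) < e / 2.
  by move=> ys; apply: close; rewrite mem_cat (map_f (fun y => (0, y) : D)) ?orbT.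
have sum : fnorm (part1 psi) + fnorm (part2 psi) = fnorm (part1 phi) + fnorm (part2 phi).
  by rewrite -!fnorm_parts // !fnorm_state.
have lower (A : cstarType R) (f g : A -> R[i]) x : scalar f -> fbound f 1 ->
    rnorm x <= 1 -> fnorm g - e / 2 < cabs (g x) -> cabs (f x - g x) < e / 2 ->
    fnorm g - e < fnorm f.
  move=> lf bf x1 gx fg.
  have h3 : cabs (f x) <= fnorm f.
    apply: (le_trans (fnorm_bound lf ler01 bf x)).
    by rewrite ler_piMr // (fnorm_ge0 lf ler01 bf).
  have := cabsB (f x) (f x - g x); rewrite subKr; lra.
have low1 := lower _ _ _ _ m1 c1 a1 ha (close1 _ (mem_head _ _)).
have low2 := lower _ _ _ _ m2 c2 b1' hb (close2 _ (mem_head _ _)).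
have k1 : `|fnorm (part1 psi) - fnorm (part1 phi)| < e1.
  by rewrite ltr_norml; apply/andP; split; lra.
have k2 : `|fnorm (part2 psi) - fnorm (part2 phi)| < e2.
  by rewrite ltr_norml; apply/andP; split; lra.
have r_lt : 2 * (r / 3) < r by lra.
apply/bl_ltP; exists (2 * (r / 3)) => // x /glue_dom_saP[x1 x2].
move=> /(glue_lip_norm_leP _ _ ltr01)[y1 y2 _].
have i1 : cabs (part1 phi x.1 - part1 psi x.1) <= r / 3.
  apply: h1 => // z zs; apply: lt_le_trans (_ : e / 2 <= _); last by lra.
  by apply: close1; rewrite inE zs orbT.
have i2 : cabs (part2 phi x.2 - part2 psi x.2) <= r / 3.
  apply: h2 => // z zs; apply: lt_le_trans (_ : e / 2 <= _); last by lra.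
  by apply: close2; rewrite inE zs orbT.
rewrite (partE x lin) (partE x lin') opprD addrACA.
by apply: (le_trans (cabsD _ _)); lra.
Qed.

Let nu1 : character_state (nu \o p1) := leg_character leg1.
Let nu2 : character_state (nu \o p2) := leg_character leg2.

Lemma glue_abelian : abelian_cstar_subalgebra glueM.
Proof.
have [[[[z1 l1] m1 s1] c1 k1] _] := tq_topography T1.
have [[[[z2 l2] m2 s2] c2 k2] _] := tq_topography T2.
split.
- split; first by split=> [|c a b [a1 a2] [b1 b2]]; split=> //; [exact: l1|exact: l2].
  + by move=> a b [a1 a2] [b1 b2]; split; [exact: m1|exact: m2].
  + by move=> a [a1 a2]; split; [exact: s1|exact: s2].
- move=> d /closure_rnormP cl; split.
  + apply: c1; apply/closure_rnormP => e /cl[x [x1 _]].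
    by rewrite rnorm_prod gt_max => /andP[dx _]; exists x.1.
  + apply: c2; apply/closure_rnormP => e /cl[x [_ x2]].
    by rewrite rnorm_prod gt_max => /andP[_ dx]; exists x.2.
- by move=> a b [a1 a2] [b1 b2]; congr pair; [exact: k1|exact: k2].
Qed.

Lemma glue_character : restricts_to_character glueM (nu \o p1 \o fst).
Proof.
have [_ [mult [a Ma a0]]] := nu1.
split; first by move=> x y [x1 _] [y1 _]; exact: mult.
have [[[[z2 _] _ _] _ _] _] := tq_topography T2.
by exists (a, 0).
Qed.

(** At least one part of a state is nonzero, and a nonzero part is a positive multiple of a
    state. *)
Lemma glue_strictly_positive (h1 : T1) (h2 : T2) :
  strictly_positive h1 -> strictly_positive h2 -> strictly_positive ((h1, h2) : D).
Proof.
move=> [s1 pos1] [s2 pos2]; split; first by congr pair.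
move=> phi sphi; have /stateP[pos bd _] := sphi; have [lin _] := pos.
have weak (A : cstarType R) (f : A -> R[i]) (h : A) : positive_functional f ->
    fbound f 1 -> (forall g, state_space A g -> 0 < g h) ->
    0 <= f h /\ (0 < fnorm f -> 0 < f h).
  move=> pf bf hpos; have [lf _] := pf.
  have t0 := fnorm_ge0 lf ler01 bf.
  have main : 0 < fnorm f -> 0 < f h.
    move=> t1; have := hpos _ (state_normalize pf ler01 bf t1).
    by rewrite pmulr_rgt0 // ltcR invr_gt0.
  split=> //; move: t0; rewrite le_eqVlt => /predU1P[t0|/main/ltW //].
  have := fnorm_bound lf ler01 bf; rewrite -t0 => /fbound0 ->.
  exact: lexx.
have P1 := part1_positive pos; have P2 := part2_positive pos.
have b1 := part1_bound ler01 bd; have b2 := part2_bound ler01 bd.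
have [w1 v1] := weak _ _ _ P1 b1 pos1; have [w2 v2] := weak _ _ _ P2 b2 pos2.
have [l1 _] := P1; have [l2 _] := P2.
have t1 := fnorm_ge0 l1 ler01 b1; have t2 := fnorm_ge0 l2 ler01 b2.
rewrite (partE _ lin) /=.
have := fnorm_parts lin bd; rewrite fnorm_state // => e.
move: t1; rewrite le_eqVlt => /predU1P[t1|/v1 h]; last exact: ltr_pwDl.
by apply: ltr_wpDl => //; apply: v2; rewrite -t1 add0r in e; rewrite -e.
Qed.

(** The first component fixes the scalar [t] of the sandwich; the bridge term keeps it within [eps]
    of the scalar suited to the second component. *)
Lemma glue_topography_witness : exists h, [/\ glueM h, ldom glueL h,
  strictly_positive h & bounded_sandwich glueL h (nu \o p1 \o fst)].
Proof.
have [h1 [M1 d1 pos1 hb1]] := topography_character_state (leg_unital leg1).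
have [h2 [M2 d2 pos2 hb2]] := topography_character_state (leg_unital leg2).
exists (h1, h2); split=> //; first exact: glue_strictly_positive.
have [k1 hk1] := hb1 _ nu1; have [k2 hk2] := hb2 _ nu2.
have /stateP[[lnu _] bnu _] := leg_state leg1.
have /stateP[pmu2 bmu2 _] := (nu2).1.
exists (k1 + (k2 + eps * rnorm (h2 ** h2))) => b t /glue_dom_saP[b1 b2].
move=> /glueL_leP[Lb1 Lb2 Lb3] bt.
have r1 := hk1 b.1 t b1 Lb1 bt.
have [_ sb2] := b2.
pose t2 := - complex.Re (nu (p2 b.2)).
have nub2 : nu (p2 b.2) = (- t2)%:C.
  by rewrite opprK; exact: (functional_sa (leg_unital leg2) pmu2 bmu2 sb2).
have r2 := hk2 b.2 t2 b2 Lb2 nub2.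
have tt : `|t - t2| <= eps.
  have := bnu (p1 b.1 - p2 b.2); rewrite mul1r (functionalB lnu).
  have -> : nu (p1 b.1) = (- t)%:C by exact: bt.
  rewrite nub2 -rmorphB /= cabs_real opprK addrC distrC => h.
  by apply: (le_trans h); rewrite mulr1 in Lb3.
have sE : sandwich h2 b.2 t = sandwich h2 b.2 t2 + (t - t2)%:C *: (h2 ** h2).
  by rewrite /sandwich rmorphB; lmod.
have r3 : rnorm (sandwich h2 b.2 t) <= k2 + eps * rnorm (h2 ** h2).
  rewrite sE; apply: (le_trans (rnormD _ _)); rewrite rnormZr lerD //.
  by rewrite ler_wpM2r // rnorm_ge0.
have k10 : 0 <= k1 by apply: le_trans r1; exact: rnorm_ge0.
have k20 : 0 <= k2 + eps * rnorm (h2 ** h2) by apply: le_trans r3; exact: rnorm_ge0.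
rewrite rnorm_prod ge_max; apply/andP; split.
  by apply: (le_trans r1); rewrite lerDl.
by apply: (le_trans r3); rewrite lerDr.
Qed.

Let glue_state : state_space D (nu \o p1 \o fst).
Proof. by apply: state_fst; case: nu1. Qed.

Lemma glue_topography : is_topography glueL glueM.
Proof.
split; first exact: glue_abelian.
have [h [Mh dh ph bh]] := glue_topography_witness.
exists h, (nu \o p1 \o fst); split=> //.
by split; [exact: glue_state|exact: glue_character|].
Qed.

Lemma glue_sqlcms : is_sqlcms glueL.
Proof.
split.
- exact: glue_separable.
- have [[l1 m1 s1] [l2 m2 s2]] := (sqlcms_dom S1, sqlcms_dom S2).
  split; first by case: glue_seminorm.
    by case: glue_leibniz.
  by move=> a /glue_hermitian[].
- exact: glue_dense.
- exact: glue_seminorm.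
- exact: glue_hermitian.
- exact: glue_norm_modulo_constants.
- exact: glue_leibniz.
- exact: glue_weak_star.
- exact: glue_closed.
have [h [Mh dh ph [k bh]]] := glue_topography_witness.
pose mu : D -> R[i] := nu \o p1 \o fst; have [sh hpos] := ph.
have [c_real c0] := cpos_real (hpos _ glue_state).
set c := complex.Re _ in c_real c0.
have [[lmu _] _ _] := (stateP _).1 glue_state.
have ic0 : 0 < c^-1 by rewrite invr_gt0.
(* The state must take the value 1 at the witness, hence the normalization. *)
exists (c^-1%:C *: h), mu; split=> //.
- split; first by apply: etrans (starZr _ _) _; rewrite sh.
  move=> phi sphi; have /stateP[[lphi _] _ _] := sphi.
  by rewrite functionalZ // mulr_gt0 ?ltcR //; exact: hpos.
- by rewrite /mu functionalZ // c_real -rmorphM mulVf ?gt_eqF.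
- exists (c^-1 ^+ 2 * k) => b t db lb bt.
  have -> : sandwich (c^-1%:C *: h) b t = (c^-1 ^+ 2)%:C *: sandwich h b t.
    rewrite /sandwich -!cscalerAl -!cscalerAr scalerDr !scalerA expr2 rmorphM.
    by rewrite (mulrC _ t%:C) mulrA.
  by rewrite rnormZr ger0_norm ?sqr_ge0 // ler_wpM2l ?sqr_ge0 //; exact: bh.
Qed.

Definition glued : topographic_sqlcms R := TopographicSqlcms glue_sqlcms glue_topography.

(** A state is a convex combination of states of the summands, which are approximated by states at
    finite distance from [muA] and from [nu \o p2]. The bridge joins [nu \o p2] to [nu \o p1], and
    [mk_character_states] joins the latter to [muA]. *)
Lemma glue_pin (muA : T1 -> R[i]) : is_pin (tq_L T1) muA -> character_state muA ->
  is_pin (tq_L T2) (nu \o p2) -> is_pin glueL (muA \o fst).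
Proof.
move=> [smu /weak_star_denseP dA] ch [_ /weak_star_denseP dB].
split; first exact: state_fst.
apply/weak_star_denseP => phi sphi s r r0.
have /stateP[pos bd _] := sphi; have [lin _] := pos.
have P1 := part1_positive pos; have P2 := part2_positive pos.
have b1 := part1_bound ler01 bd; have b2 := part2_bound ler01 bd.
have [l1 _] := P1; have [l2 _] := P2.
have t1 := fnorm_ge0 l1 ler01 b1; have t2 := fnorm_ge0 l2 ler01 b2.
have t12 : fnorm (part1 phi) + fnorm (part2 phi) = 1.
  by rewrite -fnorm_parts // fnorm_state.
have r30 : 0 < r / 3 by rewrite divr_gt0.
(* Approximates a positive functional by a multiple of a state at finite
   distance. *)
have approx (A : cstarType R) (L : lipdata A) (m f : A -> R[i]) (s' : seq A) :
    (forall g, state_space A g -> forall s0 e, 0 < e -> exists2 k,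
      [set g | state_space A g /\ (mk L g m < +oo)%E] k &
      forall a, a \in (s0 : seq A) -> cabs (k a - g a) < e) ->
    state_space A m -> positive_functional f -> fbound f 1 ->
    exists k, [/\ state_space A k, (mk L k m < +oo)%E &
      forall a, a \in s' -> cabs ((fnorm f)%:C * k a - f a) <= r / 3].
  move=> dens sm pf bf; have [lf _] := pf.
  have := fnorm_ge0 lf ler01 bf; rewrite le_eqVlt => /predU1P[f0|f0].
    exists m; split=> //.
      apply/mk_ltyP; exists 0 => a _ _; by rewrite subrr cabs0.
    move=> a _; have := fnorm_bound lf ler01 bf; rewrite -f0 => /fbound0 ->.
    by rewrite mul0r subrr cabs0 ltW.
  have [k [sk mkk] hk] := dens _ (state_normalize pf ler01 bf f0) s' _ r30.
  exists k; split=> // a /hk h.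
  have -> : (fnorm f)%:C * k a - f a = (fnorm f)%:C * (k a - (fnorm f)^-1%:C * f a).
    by rewrite mulrBr mulrA -rmorphM mulfV ?gt_eqF // mul1r.
  rewrite cabsM cabs_nneg ?(ltW f0) //.
  apply: le_trans (ltW h); rewrite ler_piMl ?cabs_ge0 //.
  exact: fnorm_le lf ler01 bf.
have [snu2 _] := nu2.
have [k1 [sk1 mk1 c1]] := approx _ _ _ _ [seq d.1 | d <- s] dA smu P1 b1.
have [k2 [sk2 mk2 c2]] := approx _ _ _ _ [seq d.2 | d <- s] dB snu2 P2 b2.
set u1 := fnorm (part1 phi) in t1 t12 c1; set u2 := fnorm (part2 phi) in t2 t12 c2.
pose k (d : D) : R[i] := u1%:C * k1 d.1 + u2%:C * k2 d.2.
have /stateP[q1 d1 w1] := sk1; have /stateP[q2 d2 w2] := sk2.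
have [m1 _] := q1; have [m2 _] := q2.
exists k; last first.
  move=> d ds; rewrite (partE d lin) /k opprD addrACA.
  have h1 := c1 d.1 (map_f fst ds); have h2 := c2 d.2 (map_f snd ds).
  by apply: le_lt_trans (cabsD _ _) _; lra.
split.
  apply/stateP; split.
  - apply: positive_add; apply: positive_scale => //.
      exact: (positive_pullback (fst_morphism T1 T2)).
    exact: (positive_pullback (snd_morphism T1 T2)).
  - rewrite -t12 -[u1]mulr1 -[u2]mulr1.
    apply: fbound_add; apply: fbound_scale => //.
      exact: (fbound_pullback (fst_morphism T1 T2)).
    exact: (fbound_pullback (snd_morphism T1 T2)).
  - move=> q /[dup] /w1[a a1 ha] /w2[b b1' hb].
    exists (phase (k1 a) *: a, phase (k2 b) *: b).
      by rewrite rnorm_prod /= !rnormZ !cabs_phase !mul1r ge_max a1.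
    rewrite /k /= !functionalZ // !phaseM -!rmorphM -rmorphD /= cabs_nneg.
      pose m := Num.min (cabs (k1 a)) (cabs (k2 b)).
      have qm : q < m by rewrite lt_min ha.
      apply: (lt_le_trans qm).
      have -> : m = u1 * m + u2 * m by rewrite -mulrDl t12 mul1r.
      rewrite lerD // ler_wpM2l //.
        by rewrite ge_min lexx.
      by rewrite ge_min lexx orbT.
    by rewrite addr_ge0 // mulr_ge0 // cabs_ge0.
have /mk_ltyP[K1 hK1] := mk1; have /mk_ltyP[K2 hK2] := mk2.
have /mk_ltyP[K3 hK3] := mk_character_states (leg_unital leg1) nu1 ch.
have /stateP[[lnu _] bnu _] := leg_state leg1.
apply/mk_ltyP; exists (K1 + K2 + eps + K3) => d /glue_dom_saP[x1 x2].
move=> /glueL_leP[y1 y2 y3].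
have u1' : u1 <= 1 by lra.
have u2' : u2 <= 1 by lra.
have -> : k d - muA d.1 = u1%:C * (k1 d.1 - muA d.1) +
    u2%:C * (k2 d.2 - nu (p2 d.2)) +
    u2%:C * ((nu (p2 d.2) - nu (p1 d.1)) + (nu (p1 d.1) - muA d.1)).
  have e : u2%:C = 1 - u1%:C :> R[i].
    have -> : u2 = 1 - u1 by move: t12; lra.
    by rewrite rmorphB rmorph1.
  by rewrite /k e; ring.
have scale (t : R) (z : R[i]) : 0 <= t -> t <= 1 -> cabs (t%:C * z) <= cabs z.
  by move=> t0 t1'; rewrite cabsM cabs_nneg // ler_piMl // cabs_ge0.
apply: (le_trans (cabsD _ _)); apply: (le_trans (lerD (cabsD _ _) (lexx _))).
have g1 := scale _ (k1 d.1 - muA d.1) t1 u1'.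
have g2 := scale _ (k2 d.2 - nu (p2 d.2)) t2 u2'.
have g3 := scale _ (nu (p2 d.2) - nu (p1 d.1) + (nu (p1 d.1) - muA d.1)) t2 u2'.
have g4 := cabsD (nu (p2 d.2) - nu (p1 d.1)) (nu (p1 d.1) - muA d.1).
have g5 := hK1 _ x1 y1; have g6 := hK2 _ x2 y2; have g7 := hK3 _ x1 y1.
have g8 : cabs (nu (p2 d.2) - nu (p1 d.1)) <= eps.
  rewrite cdistC -(functionalB lnu); apply: (le_trans (bnu _)).
  by rewrite mul1r; rewrite mulr1 in y3.
rewrite /= in g5 g6 g7; lra.
Qed.

End Glue.

(** * Approximate units of direct sums *)

Section ApproximateUnits.
Variable R : realType.

Definition prod_le I J (le1 : I -> I -> Prop) (le2 : J -> J -> Prop) (x y : I * J) :=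
  le1 x.1 y.1 /\ le2 x.2 y.2.

(** Properness asks for a net and its image over one index set, so the net on [A] is reindexed by
    pairs. *)
Lemma approximate_unit_fst (A B : cstarType R) I J le1 le2 (v : I -> A) (w : J -> B) :
  approximate_unit le1 v -> approximate_unit le2 w ->
  approximate_unit (prod_le le1 le2) (v \o fst).
Proof.
move=> [[[i0] r1 t1 d1] p1 m1 l1] [[[j0] r2 t2 d2] p2 m2 l2]; split.
- split; first by constructor; exact: (i0, j0).
  + by move=> i; split.
  + by move=> i j k [h1 h2] [h3 h4]; split; [exact: t1 h1 h3|exact: t2 h2 h4].
  + move=> i j; have [a a1 a2] := d1 i.1 j.1; have [b b1 b2] := d2 i.2 j.2.
    by exists (a, b).
- by move=> i; exact: p1.
- by move=> i j [h _]; exact: m1.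
- move=> a r r0; have [i iP] := l1 a r r0.
  by exists (i, j0) => j [h _]; exact: iP.
Qed.

Lemma approximate_unit_snd (A B : cstarType R) I J le1 le2 (v : I -> A) (w : J -> B) :
  approximate_unit le1 v -> approximate_unit le2 w ->
  approximate_unit (prod_le le1 le2) (w \o snd).
Proof.
move=> [[[i0] r1 t1 d1] p1 m1 l1] [[[j0] r2 t2 d2] p2 m2 l2]; split.
- split; first by constructor; exact: (i0, j0).
  + by move=> i; split.
  + by move=> i j k [h1 h2] [h3 h4]; split; [exact: t1 h1 h3|exact: t2 h2 h4].
  + move=> i j; have [a a1 a2] := d1 i.1 j.1; have [b b1 b2] := d2 i.2 j.2.
    by exists (a, b).
- by move=> i; exact: p2.
- by move=> i j [_ h]; exact: m2.
- move=> a r r0; have [i iP] := l2 a r r0.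
  by exists (i0, i) => j [_ h]; exact: iP.
Qed.

Lemma approximate_unit_pair (A B : cstarType R) I J le1 le2 (v : I -> A) (w : J -> B) :
  approximate_unit le1 v -> approximate_unit le2 w ->
  approximate_unit (prod_le le1 le2) (fun i => (v i.1, w i.2) : A * B).
Proof.
move=> h1 h2; have [dir _ _ _] := approximate_unit_fst h1 h2.
move: h1 h2 => [_ p1 m1 l1] [_ p2 m2 l2]; split=> //.
- move=> i; have [[a va] n1] := p1 i.1; have [[b wb] n2] := p2 i.2.
  split; last by rewrite rnorm_prod ge_max n1.
  by exists (a, b); rewrite va wb.
- move=> i j [/m1[a va] /m2[b wb]]; exists (a, b).
  by congr pair.
- move=> a r r0; have [i iP] := l1 a.1 r r0; have [j jP] := l2 a.2 r r0.
  exists (i, j) => k [/iP[h1 h2] /jP[h3 h4]].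
  by rewrite !rnorm_prod !gt_max; split; apply/andP; split.
Qed.

Lemma star_morphism_comp (A B C : cstarType R) (f : A -> B) (g : B -> C) :
  star_morphism f -> star_morphism g -> star_morphism (g \o f).
Proof.
move=> sf sg; split=> [c a b|a b|a] /=.
- by rewrite (star_morphismD sf) (star_morphismZ sf) (star_morphismD sg) (star_morphismZ sg).
- by rewrite (star_morphismM sf) (star_morphismM sg).
- by rewrite (star_morphism_star sf) (star_morphism_star sg).
Qed.

End ApproximateUnits.

(** * Isometries out of the glued space *)

Section Isometries.
Variables (R : realType) (M : R).
Hypothesis M0 : 0 < M.

Lemma quotient_normP (D A : cstarType R) (LD : lipdata D) (LA : lipdata A)
    (pi : D -> A) a :
  (lip_norm LA M a)%:E = ereal_inf
    [set (lip_norm LD M d)%:E | d in [set d | ldom_sa LD d /\ pi d = a]] <->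
  (forall d, ldom_sa LD d -> pi d = a -> lip_norm LA M a <= lip_norm LD M d) /\
  (forall e, 0 < e -> exists d, [/\ ldom_sa LD d, pi d = a &
     lip_norm LD M d <= lip_norm LA M a + e]).
Proof.
split=> [h|[h1 h2]].
  split=> [d dd pd|e e0].
    by rewrite -lee_fin h; apply: ereal_inf_lbound; exists d.
  have : (ereal_inf [set (lip_norm LD M d)%:E |
      d in [set d | ldom_sa LD d /\ pi d = a]] < (lip_norm LA M a + e)%:E)%E.
    by rewrite -h lte_fin ltrDl.
  move=> /ereal_inf_lt[_ [d [dd pd] <-]]; rewrite lte_fin => lt.
  by exists d; split=> //; exact: ltW.
apply/eqP; rewrite eq_le; apply/andP; split.
  by apply: le_ereal_inf_tmp => _ [d [dd pd] <-]; rewrite lee_fin h1.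
apply/lee_addgt0Pr => e e0; have [d [dd pd le]] := h2 e e0.
apply: le_trans (_ : (lip_norm LD M d)%:E <= _)%E.
  by apply: ereal_inf_lbound; exists d.
by rewrite -EFinD lee_fin.
Qed.

Lemma isometry_lip_norm (T A : topographic_sqlcms R) (p : T -> A) d :
  topographic_quantum_isometry M p -> ldom_sa (tq_L T) d ->
  ldom_sa (tq_L A) (p d) /\ lip_norm (tq_L A) M (p d) <= lip_norm (tq_L T) M d.
Proof.
move=> /tqi_isometry iso dd; have st := qi_morphism iso; have [d1 d2] := dd.
split.
  split; last exact: star_morphism_sa.
  have : [set p x | x in ldom (tq_L T)] (p d) by exists d.
  by rewrite (qi_dom iso).
have /(lip_norm_leP _ _ _ M0)[n l] := lexx (lip_norm (tq_L T) M d).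
apply/(lip_norm_leP _ _ _ M0); split.
  by apply: le_trans n; exact: star_morphism_contractive.
by apply: le_trans l; exact: (qi_contractive iso dd).
Qed.

Section CrossLift.
Variables (T1 T2 : topographic_sqlcms R).
Variables (BB : topographic_sqlcms R) (p1 : T1 -> BB) (p2 : T2 -> BB).
Hypotheses (iso1 : topographic_quantum_isometry M p1)
           (iso2 : topographic_quantum_isometry M p2).

Lemma cross_lift x e : ldom_sa (tq_L T1) x -> 0 < e -> exists y,
  [/\ ldom_sa (tq_L T2) y, p2 y = p1 x &
      lip_norm (tq_L T2) M y <= lip_norm (tq_L T1) M x + e].
Proof.
move=> dx e0; have [dpx lpx] := isometry_lip_norm iso1 dx.
have [_ h] := (quotient_normP _ _ _ _).1 (qi_quotient (tqi_isometry iso2) dpx).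
have [y [dy py ly]] := h e e0; exists y; split=> //.
by apply: (le_trans ly); rewrite lerD2r.
Qed.

Lemma cross_lift_topographic x e : ldom_sa (tq_L T1) x -> tq_M T1 x -> 0 < e ->
  exists y, [/\ tq_M T2 y, ldom_sa (tq_L T2) y, p2 y = p1 x,
    rnorm y <= expR e * rnorm x & tq_L T2 y <= expR e * tq_L T1 x].
Proof.
move=> dx Mx e0; have [dpx _] := isometry_lip_norm iso1 dx.
have Mpx : tq_M BB (p1 x) by apply: (tqi_sub iso1); exists x.
have [y [My dy py ny ly]] := tqi_lift iso2 dpx Mpx e0.
exists y; split=> //.
  apply: (le_trans ny); rewrite ler_wpM2l ?expR_ge0 //.
  exact: star_morphism_contractive (qi_morphism (tqi_isometry iso1)) _.
apply: (le_trans ly); rewrite ler_wpM2l ?expR_ge0 //.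
exact: qi_contractive (tqi_isometry iso1) _ dx.
Qed.

End CrossLift.

Section GlueIsometries.
Variables (T1 T2 : topographic_sqlcms R).
Variables (BB : pointed_proper_qms R) (p1 : T1 -> BB) (p2 : T2 -> BB).
Hypotheses (iso1 : topographic_quantum_isometry M p1)
           (iso2 : topographic_quantum_isometry M p2).
Variables (eps : R) (eps0 : 0 < eps).

Let leg1 := leg_isometry iso1.
Let leg2 := leg_isometry iso2.
Let G := glued leg1 leg2 eps0.

(** An element [a] lifts to [(x, y)] with [x] above [a] and [y] sharing the image of [x] in [BB], so
    that the bridge term vanishes; the tolerance is split between the two lifts. *)
Lemma glue_isometry_fst (AA : topographic_sqlcms R) (q : T1 -> AA) :
  topographic_quantum_isometry M q ->
  topographic_quantum_isometry M (q \o fst : G -> AA).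
Proof.
move=> iso; have iso' := tqi_isometry iso; have st := qi_morphism iso'.
split.
- split.
  + exact: (star_morphism_comp (fst_morphism T1 T2) st).
  + by move=> a; have [d <-] := qi_surjective iso' a; exists (d, 0).
  + have [I [le1 [v [hv hqv]]]] := qi_proper iso'.
    have [J [le2 [w [hw _]]]] := qi_proper (tqi_isometry iso2).
    exists (I * J)%type, (prod_le le1 le2), (fun i => (v i.1, w i.2)).
    split; first exact: approximate_unit_pair.
    exact: (approximate_unit_fst hqv hw).
  + rewrite -(qi_dom iso'); apply/seteqP; split=> _ [d dd <-].
      by exists d.1 => //; case: dd.
    exists (d, 0) => //; split=> //.
    exact: dom0 (sqlcms_seminorm (tq_sqlcms T2)).
  + move=> a da; apply/quotient_normP; split.
      move=> d /glue_dom_saP[d1 _] <-.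
      apply: le_trans (isometry_lip_norm iso d1).2 _.
      by have /(glue_lip_norm_leP _ _ eps0 _ _ M0)[] := lexx (lip_norm (tq_L G) M d).
    move=> e e0; have e20 : 0 < e / 2 by rewrite divr_gt0.
    have [_ h] := (quotient_normP _ _ _ _).1 (qi_quotient iso' da).
    have [x [dx px lx]] := h _ e20.
    have [y [dy py ly]] := cross_lift iso1 iso2 dx e20.
    exists (x, y); split=> //; first exact/glue_dom_saP.
    apply/(glue_lip_norm_leP _ _ eps0 _ _ M0) => /=.
    rewrite py subrr rnorm0; split; [lra|lra|].
    rewrite mulr_ge0 ?(ltW eps0) // addr_ge0 ?(ltW e0) //.
    exact: lip_norm_ge0.
  + move=> d /glue_dom_saP[d1 _] /=.
    apply: le_trans (qi_contractive iso' d1) _.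
    by rewrite !le_max lexx.
- by move=> _ [d [d1 _] <-]; apply: (tqi_sub iso); exists d.1.
move=> a e da Ma e0; have e20 : 0 < e / 2 by rewrite divr_gt0.
have [x [Mx dx px nx lx]] := tqi_lift iso da Ma e20.
have [y [My dy py ny ly]] := cross_lift_topographic iso1 iso2 dx Mx e20.
have ee : expR e = expR (e / 2) * expR (e / 2) by rewrite -expRD -splitr.
have e1 : 1 <= expR (e / 2) by apply: le_trans (expR_ge1Dx _); rewrite lerDl ltW.
have na0 := rnorm_ge0 a.
have La0 := lip_ge0 (sqlcms_seminorm (tq_sqlcms AA)) da.1.
have grow (u b : R) : 0 <= b -> u <= expR (e / 2) * b -> u <= expR e * b.
  move=> b0 h; apply: (le_trans h); rewrite ee ler_wpM2r //.
  by rewrite ler_peMl // expR_ge0.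
have grow2 (u w b : R) : w <= expR (e / 2) * u -> u <= expR (e / 2) * b ->
    w <= expR e * b.
  by move=> h1 h2; apply: (le_trans h1); rewrite ee -mulrA ler_wpM2l ?expR_ge0.
exists (x, y); split=> //; first exact/glue_dom_saP.
  rewrite rnorm_prod ge_max; apply/andP; split; [exact: grow|exact: grow2 ny nx].
apply/glueL_leP => //=; rewrite py subrr rnorm0; split.
- exact: grow.
- exact: grow2 ly lx.
- by rewrite mulr_ge0 ?(ltW eps0) // mulr_ge0 ?expR_ge0.
Qed.

Lemma glue_isometry_snd (AA : topographic_sqlcms R) (q : T2 -> AA) :
  topographic_quantum_isometry M q ->
  topographic_quantum_isometry M (q \o snd : G -> AA).
Proof.
move=> iso; have iso' := tqi_isometry iso; have st := qi_morphism iso'.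
split.
- split.
  + exact: (star_morphism_comp (snd_morphism T1 T2) st).
  + by move=> a; have [d <-] := qi_surjective iso' a; exists (0, d).
  + have [J [le2 [w [hw hqw]]]] := qi_proper iso'.
    have [I [le1 [v [hv _]]]] := qi_proper (tqi_isometry iso1).
    exists (I * J)%type, (prod_le le1 le2), (fun i => (v i.1, w i.2)).
    split; first exact: approximate_unit_pair.
    exact: (approximate_unit_snd hv hqw).
  + rewrite -(qi_dom iso'); apply/seteqP; split=> _ [d dd <-].
      by exists d.2 => //; case: dd.
    exists (0, d) => //; split=> //.
    exact: dom0 (sqlcms_seminorm (tq_sqlcms T1)).
  + move=> a da; apply/quotient_normP; split.
      move=> d /glue_dom_saP[_ d2] <-.
      apply: le_trans (isometry_lip_norm iso d2).2 _.
      by have /(glue_lip_norm_leP _ _ eps0 _ _ M0)[] := lexx (lip_norm (tq_L G) M d).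
    move=> e e0; have e20 : 0 < e / 2 by rewrite divr_gt0.
    have [_ h] := (quotient_normP _ _ _ _).1 (qi_quotient iso' da).
    have [y [dy py ly]] := h _ e20.
    have [x [dx px lx]] := cross_lift iso2 iso1 dy e20.
    exists (x, y); split=> //; first exact/glue_dom_saP.
    apply/(glue_lip_norm_leP _ _ eps0 _ _ M0) => /=.
    rewrite px subrr rnorm0; split; [lra|lra|].
    rewrite mulr_ge0 ?(ltW eps0) // addr_ge0 ?(ltW e0) //.
    exact: lip_norm_ge0.
  + move=> d /glue_dom_saP[_ d2] /=.
    apply: le_trans (qi_contractive iso' d2) _.
    by rewrite !le_max lexx orbT.
- by move=> _ [d [_ d2] <-]; apply: (tqi_sub iso); exists d.2.
move=> a e da Ma e0; have e20 : 0 < e / 2 by rewrite divr_gt0.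
have [y [My dy py ny ly]] := tqi_lift iso da Ma e20.
have [x [Mx dx px nx lx]] := cross_lift_topographic iso2 iso1 dy My e20.
have ee : expR e = expR (e / 2) * expR (e / 2) by rewrite -expRD -splitr.
have e1 : 1 <= expR (e / 2) by apply: le_trans (expR_ge1Dx _); rewrite lerDl ltW.
have na0 := rnorm_ge0 a.
have La0 := lip_ge0 (sqlcms_seminorm (tq_sqlcms AA)) da.1.
have grow (u b : R) : 0 <= b -> u <= expR (e / 2) * b -> u <= expR e * b.
  move=> b0 h; apply: (le_trans h); rewrite ee ler_wpM2r //.
  by rewrite ler_peMl // expR_ge0.
have grow2 (u w b : R) : w <= expR (e / 2) * u -> u <= expR (e / 2) * b ->
    w <= expR e * b.
  by move=> h1 h2; apply: (le_trans h1); rewrite ee -mulrA ler_wpM2l ?expR_ge0.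
exists (x, y); split=> //; first exact/glue_dom_saP.
  rewrite rnorm_prod ge_max; apply/andP; split; [exact: grow2 nx ny|exact: grow].
apply/glueL_leP => //=; rewrite px subrr rnorm0; split.
- exact: grow2 lx ly.
- exact: grow.
- by rewrite mulr_ge0 ?(ltW eps0) // mulr_ge0 ?expR_ge0.
Qed.

End GlueIsometries.

End Isometries.

(** * Pivots and extents *)

Section Reach.
Variables (R : realType) (M : R).
Hypothesis M1 : 1 <= M.
Let M0 : 0 < M. Proof. exact: lt_le_trans ltr01 M1. Qed.

(* e Q(T) e lies in the chi-neighborhood of q^*(Q(A)). *)
Definition reach (T A : topographic_sqlcms R) (q : T -> A) (e : T) (chi : R) :=
  forall phi, quasi_state_space T phi -> exists2 psi, quasi_state_space A psi &
    forall a, ldom_sa (tq_L T) a -> lip_norm (tq_L T) M a <= 1 ->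
      cabs (phi (e ** a ** e) - psi (q a)) <= chi.

Lemma included_reach (T A : topographic_sqlcms R) (q : T -> A) e r chi : r < chi ->
  included_up_to (bl (tq_L T) M) r (compressed_quasi_states e)
    (pullback q (quasi_state_space A)) -> reach q e chi.
Proof.
move=> rc inc phi qphi.
have := inc _ (ex_intro2 _ _ phi qphi erefl).
move=> /le_lt_trans /(_ (_ : r%:E < chi%:E)%E); rewrite lte_fin => /(_ rc).
move=> /ereal_inf_lt[_ [_ [psi qpsi <-] <-] /ltW/bl_leP h].
by exists psi.
Qed.

Lemma reach_included (T A : topographic_sqlcms R) (q : T -> A) e chi :
  reach q e chi -> included_up_to (bl (tq_L T) M) chi (compressed_quasi_states e)
    (pullback q (quasi_state_space A)).
Proof.
move=> rc _ [phi qphi <-]; have [psi qpsi h] := rc phi qphi.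
apply: le_trans (_ : bl (tq_L T) M (fun d => phi (e ** d ** e)) (psi \o q) <= _)%E.
  by apply: ereal_inf_lbound; exists (psi \o q) => //; exists psi.
by apply/bl_leP.
Qed.

Lemma reach_ge0 (T A : topographic_sqlcms R) (q : T -> A) e chi :
  reach q e chi -> 0 <= chi.
Proof.
move=> rc; have q0 : quasi_state_space T (fun=> 0).
  apply/quasi_stateP; split; first exact: positive0.
  by move=> a; rewrite cabs0 mul1r rnorm_ge0.
have [psi _ h] := rc _ q0.
have semi := sqlcms_seminorm (tq_sqlcms T).
apply: le_trans (h 0 (dom_sa0 semi) _); first exact: cabs_ge0.
by apply/(lip_norm_leP _ _ _ M0); rewrite rnorm0 lip0 // mulr1 ltW.
Qed.

(** For the parts of a quasi-state the error has to shrink in proportion to their norms; the bound 0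
    cannot be normalized and is treated apart. *)
Lemma reach_positive (T A : topographic_sqlcms R) (q : T -> A) e chi phi n :
  reach q e chi -> positive_functional phi -> fbound phi n -> 0 <= n ->
  exists psi, [/\ positive_functional psi, fbound psi n &
    forall a, ldom_sa (tq_L T) a -> lip_norm (tq_L T) M a <= 1 ->
      cabs (phi (e ** a ** e) - psi (q a)) <= n * chi].
Proof.
move=> rc pos bd; rewrite le_eqVlt => /predU1P[n0|n0].
  exists (fun=> 0); split; first exact: positive0.
    by move=> a; rewrite cabs0 -n0 mul0r.
  rewrite -n0 in bd *; move=> a _ _.
  by rewrite (fbound0 bd) subr0 cabs0 mul0r.
have in0 : 0 <= n^-1 by rewrite invr_ge0 ltW.
have qphi : quasi_state_space T (fun a => n^-1%:C * phi a).
  apply/quasi_stateP; split; first exact: positive_scale.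
  have n1 : n != 0 by rewrite gt_eqF.
  by have := fbound_scale in0 bd; rewrite mulVf.
have [psi /quasi_stateP[ppsi bpsi] h] := rc _ qphi.
exists (fun a => n%:C * psi a); split.
- exact: positive_scale (ltW n0) ppsi.
- by have := fbound_scale (ltW n0) bpsi; rewrite mulr1.
move=> a da la.
have -> : phi (e ** a ** e) - n%:C * psi (q a) =
    n%:C * (n^-1%:C * phi (e ** a ** e) - psi (q a)).
  by rewrite mulrBr mulrA -rmorphM mulfV ?gt_eqF // mul1r.
by rewrite cabsM cabs_nneg ?(ltW n0) // ler_wpM2l ?(ltW n0) // h.
Qed.

(** Dividing a functional of norm at most 1 by its norm can only increase its value at
    [star x ** x]. *)
Lemma state_scale_quasi (T : cstarType R) (phi : T -> R[i]) (x : T) :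
  positive_functional phi -> fbound phi 1 -> x != 0 ->
  phi (star x ** x) = (rnorm x ^+ 2)%:C ->
  exists2 psi, state_space T psi & rnorm x ^+ 2 <= complex.Re (psi (star x ** x)).
Proof.
move=> pos bd x0 e; have [lin _] := pos.
have nx : 0 < rnorm x ^+ 2.
  rewrite exprn_gt0 // lt0r rnorm_ge0 andbT.
  by apply: contra_neq x0 => /rnorm_eq0.
have t0 := fnorm_ge0 lin ler01 bd.
have t1 := fnorm_le lin ler01 bd.
have tp : 0 < fnorm phi.
  rewrite lt0r t0 andbT; apply/eqP => t; have := fnorm_bound lin ler01 bd.
  rewrite t => /fbound0 /(_ (star x ** x)); rewrite e => /complexI h.
  by rewrite h ltxx in nx.
exists (fun a => (fnorm phi)^-1%:C * phi a); first exact: state_normalize.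
rewrite e -rmorphM /= ler_peMl ?(ltW nx) // -[1]invr1 lef_pV2 ?posrE //.
Qed.

(* A norming state of e^2 is moved to one at finite distance from the pin,
   and the reach is tested on an almost unit with small Lipschitz constant. *)
Lemma pivot_norm (T : topographic_sqlcms R) (AA : pointed_proper_qms R) (q : T -> AA)
    (e : T) chi :
  topographic_quantum_isometry M q -> is_pin (tq_L T) (pq_mu AA \o q) ->
  ldom_sa (tq_L T) e -> tq_M T e -> reach q e chi ->
  M * rnorm e ^+ 2 <= M + chi.
Proof.
move=> iso [_ /weak_star_denseP pin] de Me rc.
have chi0 := reach_ge0 rc.
have [e0|e_neq0] := eqVneq e 0.
  by rewrite e0 rnorm0 expr0n mulr0 addr_ge0 // ltW.
have lg := leg_isometry iso; have au := leg_unital lg.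
have [[_ _ Mcomm] _] := tq_topography T.
have [_ se] := de.
have semi := sqlcms_seminorm (tq_sqlcms T).
set E := rnorm e ^+ 2; have E0 : 0 <= E by exact: sqr_ge0.
apply/ler_addgt0Pr => d d0.
have [phi0 [pos0 bd0 phi0e]] := norming_functional e.
have bd0' : fbound phi0 1 by move=> a; rewrite mul1r.
have [phi1 s1 h1] := state_scale_quasi pos0 bd0' e_neq0 phi0e.
have d3 : 0 < d / (3 * M) by rewrite divr_gt0 // mulr_gt0.
have [phi [sphi /mk_ltyP[K hK]] close] := pin _ s1 [:: star e ** e] _ d3.
have /stateP[pos bd _] := sphi; have [lin _] := pos.
(* The error [d] is spent in thirds: on the approximation of the norming state, on [theta] and on
   [eta]. *)
pose theta := d / (3 * M * (E + 1)).
have E1 : 0 < E + 1 by rewrite ltr_wpDl.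
have theta0 : 0 < theta by rewrite divr_gt0 // !mulr_gt0.
have K5 : 0 < 5 + 2 * `|K| by rewrite ltr_wpDr // mulr_ge0.
have Mchi : 0 < 3 * (M + chi) by rewrite mulr_gt0 // ltr_wpDr.
(* The bounds keep [M * eta] at most 1, the variance of [x] under [phi] at most [theta^2], and
   [eta * (M + chi)] within the last third of the error. *)
pose eta := Num.min M^-1 (Num.min (theta ^+ 2 / (5 + 2 * `|K|)) (d / (3 * (M + chi)))).
have eta0 : 0 < eta.
  by rewrite !lt_min invr_gt0 M0 !divr_gt0 // exprn_gt0.
have etaM : M * eta <= 1 by rewrite -ler_pdivlMl // mulr1 ge_min lexx.
have eta1 : eta <= 1 by apply: le_trans etaM; rewrite ler_peMl // ltW.
have etaK : eta * (5 + 2 * `|K|) <= theta ^+ 2.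
  by rewrite -ler_pdivlMr // !ge_min lexx !orbT.
have etad : eta * (M + chi) <= d / 3.
  have : eta * (3 * (M + chi)) <= d by rewrite -ler_pdivlMr // !ge_min lexx !orbT.
  lra.
clearbody eta.
have [x [Mx dx nx Lx mx]] := pinned_lift iso eta0.
have [_ sx] := dx.
have phix : cabs (phi x - pq_mu AA (q x)) <= `|K| * eta.
  have ie0 : 0 <= eta^-1 by rewrite invr_ge0 ltW.
  have := hK (eta^-1%:C *: x) (dom_saZr semi _ dx).
  rewrite (lipZr semi _ dx.1) (ger0_norm ie0).
  rewrite ler_pdivrMl // mulr1 => /(_ Lx).
  have [[lmu _] _ _] := (stateP _).1 (leg_state lg).
  rewrite /= (star_morphismZ (leg_morphism lg)) !functionalZ // -mulrBr.
  rewrite cabsM cabs_nneg ?invr_ge0 ?(ltW eta0) // ler_pdivrMl // mulrC => h.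
  by apply: (le_trans h); rewrite ler_wpM2r ?(ltW eta0) // ler_norm.
have Re_x : 1 - eta - `|K| * eta <= complex.Re (phi x).
  have h2 : `|complex.Re (phi x - 1)| <= `|K| * eta + eta.
    apply: le_trans (cabs_Re _) _.
    have -> : phi x - 1 = (phi x - pq_mu AA (q x)) + (pq_mu AA (q x) - 1).
      by rewrite addrA subrK.
    by apply: le_trans (cabsD _ _) _; rewrite lerD.
  by move: h2; rewrite raddfB /= ler_norml => /andP[h2 _]; lra.
(* Since [phi x] is close to 1 and [x] is almost a contraction, its variance around 1 is small, and
   [phi (e ** e ** x)] is close to [phi (e ** e)]. *)
have var := functional_variance au pos bd (e ** e) 1 sx.
rewrite mulr1 expr1n mul1r in var.
have Re_xx : complex.Re (phi (x ** x)) <= (1 + eta) ^+ 2.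
  apply: le_trans (ler_norm _) _; apply: le_trans (cabs_Re _) _.
  apply: le_trans (bd _) _; rewrite mul1r; apply: le_trans (rnormM _ _) _.
  by rewrite expr2 ler_pM ?rnorm_ge0.
have nee : rnorm (e ** e) <= E by rewrite /E expr2 rnormM.
have close2 : cabs (phi (e ** e ** x) - phi (e ** e)) <= E * theta.
  have Et0 := mulr_ge0 E0 (ltW theta0).
  rewrite -ler_sqr ?nnegrE ?cabs_ge0 ?Et0 //.
  apply: le_trans var _; rewrite exprMn.
  have n2 : rnorm (e ** e) ^+ 2 <= E ^+ 2 by rewrite ler_sqr ?nnegrE ?rnorm_ge0.
  apply: le_trans (_ : rnorm (e ** e) ^+ 2 * theta ^+ 2 <= _).
    rewrite ler_wpM2l ?sqr_ge0 //; apply: le_trans etaK.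
    have := normr_ge0 K; nra.
  by rewrite ler_wpM2r ?sqr_ge0.
have eta1' : 0 < 1 + eta by rewrite addr_gt0.
(* This multiple of [x] has norm at most [M], the norm allowed in the unit ball of [lip_norm]. *)
pose k := M / (1 + eta).
have k0 : 0 <= k by rewrite divr_ge0 ?ltW.
have kM : k * (1 + eta) = M by rewrite divfK // gt_eqF.
have dkx := dom_saZr semi k dx.
have lkx : lip_norm (tq_L T) M (k%:C *: x) <= 1.
  apply/(lip_norm_leP _ _ _ M0); rewrite mulr1; split.
    by rewrite rnormZr ger0_norm // -[leRHS]kM ler_wpM2l.
  rewrite (lipZr semi) ?ger0_norm //; last by case: dx.
  apply: le_trans (_ : M * eta <= _) => //; apply: ler_pM => //.
    by case: dx => h _; exact: lip_ge0 semi _ h.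
  by rewrite ler_pdivrMr // ler_peMr ?(ltW M0) // lerDl ltW.
have [psi /quasi_stateP[[lpsi _] bpsi] hpsi] := rc _ (state_quasi sphi).
have := hpsi _ dkx lkx.
have eE : e ** (k%:C *: x) ** e = k%:C *: (e ** e ** x).
  by rewrite -cscalerAr -cscalerAl -cmulA (Mcomm _ _ Mx Me) cmulA.
rewrite eE functionalZ // (star_morphismZ (leg_morphism lg)) (functionalZ lpsi) => h2.
have h3 : cabs (k%:C * psi (q x)) <= M.
  rewrite cabsM cabs_nneg // -[leRHS]kM ler_wpM2l //.
  apply: le_trans (bpsi _) _; rewrite mul1r; apply: le_trans nx.
  exact: star_morphism_contractive (leg_morphism lg) x.
have h4 : k * cabs (phi (e ** e ** x)) <= M + chi.
  have := cabsD (k%:C * phi (e ** e ** x) - k%:C * psi (q x)) (k%:C * psi (q x)).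
  by rewrite subrK {1}cabsM cabs_nneg //; lra.
have h5 : M * cabs (phi (e ** e ** x)) <= (1 + eta) * (M + chi).
  have := ler_wpM2l (ltW eta1') h4.
  by rewrite mulrA (mulrC _ k) kM.
have h6 : E - d / (3 * M) <= cabs (phi (e ** e)).
  have := close _ (mem_head _ _); rewrite se => /ltW h7.
  have := le_trans (cabs_Re _) h7; rewrite raddfB /= ler_norml => /andP[h8 _].
  rewrite se in h1; apply: le_trans (cabs_Re _).
  by apply: le_trans (ler_norm _); rewrite /E; lra.
have h7 : cabs (phi (e ** e)) <= cabs (phi (e ** e ** x)) + E * theta.
  rewrite -[X in cabs X <= _](subKr (phi (e ** e ** x))).
  by apply: le_trans (cabsB _ _) _; rewrite lerD2l.
have h8 : M * (E * theta) <= d / 3.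
  have th : theta * (3 * M * (E + 1)) = d by rewrite divfK // gt_eqF // !mulr_gt0.
  have := mulr_ge0 (ltW M0) (ltW theta0); nra.
have h9 : M * (d / (3 * M)) = d / 3 by field; rewrite gt_eqF.
have h10 := ler_wpM2l (ltW M0) h6.
have h11 := ler_wpM2l (ltW M0) h7.
lra.
Qed.

End Reach.

(** * Transport of the components of a quasi-state *)

Section ComponentReach.
Variables (R : realType) (M : R).
Hypothesis M1 : 1 <= M.
Let M0 : 0 < M. Proof. exact: lt_le_trans ltr01 M1. Qed.
Variables (T1 T2 AA : topographic_sqlcms R) (BB : pointed_proper_qms R).
Variables (p1 : T1 -> BB) (p2 : T2 -> BB) (q : T1 -> AA).
Hypotheses (iso1 : topographic_quantum_isometry M p1)
           (iso2 : topographic_quantum_isometry M p2)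
           (isoq : topographic_quantum_isometry M q).
Variables (e1 f1 : T1) (e2 f2 : T2) (chi1 chi2 eps s K Lam N W : R).
Hypotheses (df1 : ldom_sa (tq_L T1) f1)
           (de2 : ldom_sa (tq_L T2) e2) (df2 : ldom_sa (tq_L T2) f2).
Hypotheses (comm1 : e1 ** f1 = f1 ** e1) (comm2 : e2 ** f2 = f2 ** e2).
Hypothesis p2f2 : p2 f2 = p1 e1.
Hypotheses (reach1 : reach M q e1 chi1) (reach2 : reach M (p2 : T2 -> BB) e2 chi2).
Hypotheses (f1s : rnorm f1 ^+ 2 <= s) (s1 : 1 <= s) (f2K : rnorm f2 <= K)
  (f2Lam : 2 * M * tq_L T2 f2 <= Lam) (e1N : rnorm e1 ^+ 2 <= N) (eps0 : 0 <= eps).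
Hypotheses (W1 : s * chi1 + (s - 1) * M <= W)
           (W2 : chi2 * (K ^+ 2 + K * Lam) + N * eps + chi1 <= W).

Let st1 := qi_morphism (tqi_isometry iso1).
Let st2 := qi_morphism (tqi_isometry iso2).
Let semi1 := sqlcms_seminorm (tq_sqlcms T1).
Let semi2 := sqlcms_seminorm (tq_sqlcms T2).

Let chi20 : 0 <= chi2. Proof. exact: reach_ge0 reach2. Qed.

Let norm_leM (T : topographic_sqlcms R) (d : T) :
  lip_norm (tq_L T) M d <= 1 -> rnorm d <= M.
Proof. by move=> /(lip_norm_leP _ _ _ M0)[]; rewrite mulr1. Qed.

(** Compression by [f1] may raise the bound to [n * s], so the functional found by [reach1] is
    divided by [s]; on elements of norm at most [M] this costs [n * (s - 1) * M]. *)
Let reach_direct (phi : T1 -> R[i]) n : positive_functional phi -> fbound phi n -> 0 <= n ->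
  exists psi, [/\ positive_functional psi, fbound psi n &
    forall d, ldom_sa (tq_L T1) d -> lip_norm (tq_L T1) M d <= 1 ->
      cabs (phi ((e1 ** f1) ** d ** (e1 ** f1)) - psi (q d)) <=
        n * (s * chi1 + (s - 1) * M)].
Proof.
move=> pos bd n0; have s0 : 0 < s by exact: lt_le_trans ltr01 s1.
have ns0 : 0 <= n * s by rewrite mulr_ge0 // ltW.
have bd' : fbound (fun a => phi (f1 ** a ** f1)) (n * s).
  by apply: fbound_weaken (fbound_compress f1 n0 bd); exact: ler_wpM2l.
have [psi [ppsi bpsi hpsi]] := reach_positive reach1 (positive_compress df1.2 pos) bd' ns0.
have is0 : 0 <= s^-1 by rewrite invr_ge0 ltW.
exists (fun a => s^-1%:C * psi a); split; first exact: positive_scale.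
  by have := fbound_scale is0 bpsi; rewrite mulrCA mulVf ?mulr1 // gt_eqF.
move=> d dd ld.
have -> : (e1 ** f1) ** d ** (e1 ** f1) = f1 ** (e1 ** d ** e1) ** f1.
  by rewrite {1}comm1 !cmulA.
have h1 := hpsi d dd ld.
have h2 : cabs (psi (q d) - s^-1%:C * psi (q d)) <= n * ((s - 1) * M).
  have -> : psi (q d) - s^-1%:C * psi (q d) = (1 - s^-1)%:C * psi (q d).
    by rewrite rmorphB mulrBl mul1r.
  have is1 : 0 <= 1 - s^-1 by rewrite subr_ge0 invf_le1.
  rewrite cabsM cabs_nneg //.
  have h3 : cabs (psi (q d)) <= n * s * M.
    apply: le_trans (bpsi _) _; rewrite ler_wpM2l //.
    apply: le_trans (norm_leM ld).
    exact: star_morphism_contractive (qi_morphism (tqi_isometry isoq)) _.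
  apply: le_trans (ler_wpM2l is1 h3) _.
  have -> : (1 - s^-1) * (n * s * M) = n * ((s - 1) * M) by field; rewrite gt_eqF.
  exact: lexx.
have -> : phi (f1 ** (e1 ** d ** e1) ** f1) - s^-1%:C * psi (q d) =
   (phi (f1 ** (e1 ** d ** e1) ** f1) - psi (q d)) + (psi (q d) - s^-1%:C * psi (q d)).
  by rewrite addrA subrK.
apply: le_trans (cabsD _ _) _; rewrite mulrDr; apply: lerD => //.
by rewrite mulrA.
Qed.

(** Two uses of the Leibniz rule on an element of norm at most [M] produce [2 M L(f2)]; this
    explains the factor [2 M] in the extent. *)
Let lip_norm_sandwich d : ldom_sa (tq_L T2) d -> lip_norm (tq_L T2) M d <= 1 ->
  ldom_sa (tq_L T2) (f2 ** d ** f2) /\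
  lip_norm (tq_L T2) M (f2 ** d ** f2) <= K ^+ 2 + K * Lam.
Proof.
move=> dd ld; have [Dm Leib] := sqlcms_leibniz (tq_sqlcms T2).
have [df sf] := df2; have [dd1 sd] := dd.
have dfd := Dm _ _ df dd1; have dfdf := Dm _ _ dfd df.
split; first by split=> //; rewrite /sa /= !starM sf sd cmulA.
have nd := norm_leM ld; have /(lip_norm_leP _ _ _ M0)[_ Ld] := ld.
have Lf0 := lip_ge0 semi2 df; have Ld0 := lip_ge0 semi2 dd1.
have nf0 := rnorm_ge0 f2; have nd0 := rnorm_ge0 d.
have K0 : 0 <= K by exact: le_trans f2K.
have Lam0 : 0 <= Lam by apply: le_trans f2Lam; rewrite !mulr_ge0 // ltW.
have n1 : rnorm (f2 ** d) <= K * M.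
  by apply: le_trans (rnormM _ _) _; exact: ler_pM.
have l1 : tq_L T2 (f2 ** d) <= K + tq_L T2 f2 * M.
  apply: le_trans (Leib _ _ df dd1) _; apply: lerD; last exact: ler_wpM2l.
  by rewrite -[leRHS]mulr1; exact: ler_pM.
apply/(lip_norm_leP _ _ _ M0); split.
  apply: le_trans (rnormM _ _) _; apply: le_trans (_ : K * M * K <= _).
    by apply: ler_pM => //; exact: rnorm_ge0.
  rewrite mulrDr; have := mulr_ge0 (ltW M0) (mulr_ge0 K0 Lam0); rewrite expr2; lra.
apply: le_trans (Leib _ _ dfd df) _.
have h1 : rnorm (f2 ** d) * tq_L T2 f2 <= K * M * tq_L T2 f2 by exact: ler_wpM2r.
have h2 : tq_L T2 (f2 ** d) * rnorm f2 <= (K + tq_L T2 f2 * M) * K.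
  by apply: ler_pM => //; exact: lip_ge0 semi2 _ dfd.
have h3 := ler_wpM2l K0 f2Lam.
rewrite expr2; lra.
Qed.

(** The route passes through [BB]: [reach2] replaces the compression by [e2] with a functional on
    [BB], where [f2] has the image of [e1]; the bridge exchanges [d2] for [d1], and [reach1] removes
    the compression by [e1]. *)
Let reach_across (phi : T2 -> R[i]) n : positive_functional phi -> fbound phi n -> 0 <= n ->
  exists psi, [/\ positive_functional psi, fbound psi n &
    forall d1 d2, ldom_sa (tq_L T1) d1 -> lip_norm (tq_L T1) M d1 <= 1 ->
      ldom_sa (tq_L T2) d2 -> lip_norm (tq_L T2) M d2 <= 1 ->
      rnorm (p1 d1 - p2 d2) <= eps ->
      cabs (phi ((e2 ** f2) ** d2 ** (e2 ** f2)) - psi (q d1)) <=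
        n * (chi2 * (K ^+ 2 + K * Lam) + N * eps + chi1)].
Proof.
move=> pos bd n0.
have [psiB [pB bB hB]] := reach_positive reach2 pos bd n0.
have [lB _] := pB.
have [psi [ppsi bpsi hpsi]] := reach_positive reach1 (positive_pullback st1 pB)
  (fbound_pullback st1 n0 bB) n0.
exists psi; split=> // d1 d2 dd1 ld1 dd2 ld2 d12.
have -> : (e2 ** f2) ** d2 ** (e2 ** f2) = e2 ** (f2 ** d2 ** f2) ** e2.
  by rewrite {2}comm2 !cmulA.
have [db lb] := lip_norm_sandwich dd2 ld2.
have [lphi _] := positive_compress de2.2 pos.
have h1 : cabs (phi (e2 ** (f2 ** d2 ** f2) ** e2) - psiB (p2 (f2 ** d2 ** f2))) <=
    n * chi2 * (K ^+ 2 + K * Lam).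
  apply: le_trans (bl_homo semi2 M0 (mulr_ge0 n0 chi20) lphi
    (scalar_pullback st2 lB) hB db) _.
  by rewrite ler_wpM2l // mulr_ge0.
have h2 : cabs (psiB (p2 (f2 ** d2 ** f2)) - psiB (p1 (e1 ** d1 ** e1))) <=
    n * (N * eps).
  rewrite -functionalB // !(star_morphismM st1) !(star_morphismM st2) p2f2.
  rewrite -cmulBl -cmulBr; apply: le_trans (bB _) _; rewrite ler_wpM2l //.
  apply: le_trans (rnormM _ _) _.
  have c1 := star_morphism_contractive st1 e1.
  have c2 : rnorm (p1 e1 ** (p2 d2 - p1 d1)) <= rnorm e1 * eps.
    by apply: le_trans (rnormM _ _) _; rewrite ler_pM ?rnorm_ge0 // rdistC.
  apply: le_trans (_ : rnorm e1 * eps * rnorm e1 <= _).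
    by rewrite ler_pM ?rnorm_ge0.
  by rewrite mulrAC -expr2 ler_wpM2r.
have h3 := hpsi d1 dd1 ld1; rewrite /= in h3.
have -> : phi (e2 ** (f2 ** d2 ** f2) ** e2) - psi (q d1) =
  (phi (e2 ** (f2 ** d2 ** f2) ** e2) - psiB (p2 (f2 ** d2 ** f2))) +
  (psiB (p2 (f2 ** d2 ** f2)) - psiB (p1 (e1 ** d1 ** e1))) +
  (psiB (p1 (e1 ** d1 ** e1)) - psi (q d1)) by ring.
apply: le_trans (cabsD _ _) _.
apply: le_trans (lerD (cabsD _ _) h3) _.
rewrite 2!mulrDr; lra.
Qed.

(** The cost of each transport is proportional to the bound of the part, and these sum to at most 1,
    so a common bound [W] of the two rates bounds the total. *)
Lemma component_reach (phi1 : T1 -> R[i]) (phi2 : T2 -> R[i]) n1 n2 :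
  positive_functional phi1 -> positive_functional phi2 ->
  fbound phi1 n1 -> fbound phi2 n2 -> 0 <= n1 -> 0 <= n2 -> n1 + n2 <= 1 ->
  exists2 psi, quasi_state_space AA psi &
    forall d1 d2, ldom_sa (tq_L T1) d1 -> lip_norm (tq_L T1) M d1 <= 1 ->
      ldom_sa (tq_L T2) d2 -> lip_norm (tq_L T2) M d2 <= 1 ->
      rnorm (p1 d1 - p2 d2) <= eps ->
      cabs (phi1 ((e1 ** f1) ** d1 ** (e1 ** f1)) +
            phi2 ((e2 ** f2) ** d2 ** (e2 ** f2)) - psi (q d1)) <= W.
Proof.
move=> pos1 pos2 b1 b2 n10 n20 n12.
have [psi1 [q1 c1 h1]] := reach_direct pos1 b1 n10.
have [psi2 [q2 c2 h2]] := reach_across pos2 b2 n20.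
exists (fun a => psi1 a + psi2 a).
  apply/quasi_stateP; split; first exact: positive_add.
  exact: fbound_weaken n12 (fbound_add c1 c2).
move=> d1 d2 dd1 ld1 dd2 ld2 d12.
have W0 : 0 <= W.
  have s0 : 0 <= s by exact: le_trans ler01 s1.
  have chi10 : 0 <= chi1 by exact: reach_ge0 reach1.
  by apply: le_trans W1; rewrite addr_ge0 ?mulr_ge0 ?subr_ge0 // ltW.
rewrite opprD addrACA; apply: le_trans (cabsD _ _) _.
have g1 := le_trans (h1 _ dd1 ld1) (ler_wpM2l n10 W1).
have g2 := le_trans (h2 _ _ dd1 ld1 dd2 ld2 d12) (ler_wpM2l n20 W2).
apply: le_trans (lerD g1 g2) _; rewrite -mulrDl ler_piMl //.
Qed.

End ComponentReach.

(** * Extents in terms of real inequalities *)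

Section TunnelBound.
Variables (R : realType) (M : R).
Hypothesis M1 : 1 <= M.
Variables (AA BB : pointed_proper_qms R) (tau : tunnel M AA BB).

Local Notation piA := (@tn_piA _ _ _ _ tau).
Local Notation piB := (@tn_piB _ _ _ _ tau).

(** An infimum need not be attained, so this follows from [extent tau < chi] and, for [chi > 0],
    gives only [extent tau <= chi]. *)
Definition tunnel_bound (chi : R) :=
  [/\ reach M (piA) (tn_e tau) chi, reach M (piB) (tn_e tau) chi,
      forall a, ldom_sa (tq_L (tn_D tau)) a -> tq_L (tn_D tau) a <= 1 ->
        cabs (pq_mu AA (piA a) - pq_mu BB (piB a)) <= chi,
      2 * M * tq_L (tn_D tau) (tn_e tau) <= chi &
      cabs (1 - pq_mu AA (piA (tn_e tau))) <= chi /\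
      cabs (1 - pq_mu BB (piB (tn_e tau))) <= chi].

Lemma extent_lt_bound chi : (extent tau < chi%:E)%E -> tunnel_bound chi.
Proof.
rewrite /extent !gt_max => /and3P[h1 h2 h3].
move: h1 => /ereal_inf_lt[_ [r [r0 iA iB] <-]]; rewrite lte_fin => rchi.
move: h3; rewrite lte_fin !gt_max => /and3P[h3 h4 h5].
split; [exact: included_reach iA|exact: included_reach iB| |exact: ltW|].
  by move: h2 => /ltW/mk_leP.
by split; exact: ltW.
Qed.

Lemma extent_le_bound chi : 0 < chi -> tunnel_bound chi -> (extent tau <= chi%:E)%E.
Proof.
move=> chi0 [rA rB mk_le e_le [muA_le muB_le]].
rewrite /extent !ge_max; apply/and3P; split.
- apply: ereal_inf_lbound; exists chi => //; split=> //.
    exact: reach_included.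
  exact: reach_included.
- exact/mk_leP.
- rewrite lee_fin /extent_pivot !ge_max e_le /=; apply/andP.
  by split; [exact: muA_le|exact: muB_le].
Qed.

Lemma extent_ge0 : (0 <= extent tau)%E.
Proof.
rewrite /extent !le_max; apply/orP; right; apply/orP; right.
by rewrite lee_fin /extent_pivot !le_max !rnorm_ge0 !orbT.
Qed.

End TunnelBound.

(* The bound for the glued tunnel, before letting [t] tend to 0. *)
Definition triangle_bound (R : realType) (M x1 x2 t : R) : R :=
  (1 + t) ^+ 2 * (x1 * (1 + x2) ^+ 2 + x2 * (1 + x1) ^+ 2) +
  ((1 + t) ^+ 2 - 1) * M + (1 + x1 + x2) * t.

Section TriangleBound.
Variables (R : realType) (M : R).
Implicit Types x t : R.

Lemma triangle_boundC x1 x2 t : triangle_bound M x1 x2 t = triangle_bound M x2 x1 t.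
Proof. by rewrite /triangle_bound; ring. Qed.

Variables (x1 x2 t : R).
Hypotheses (M1 : 1 <= M) (x10 : 0 < x1) (x20 : 0 < x2) (t0 : 0 < t).

Local Notation W := (triangle_bound M x1 x2 t).
Local Notation k := (1 + t).

Let k1 : 1 <= k ^+ 2. Proof. by rewrite expr_ge1 ?addr_ge0 ?(ltW t0) // lerDl ltW. Qed.
Let tail0 : 0 <= (k ^+ 2 - 1) * M.
Proof. by rewrite mulr_ge0 ?subr_ge0 // (le_trans ler01). Qed.
Let x12 : 0 < x1 * x2. Proof. exact: mulr_gt0. Qed.

Lemma triangle_bound_main p :
  p <= x1 * (1 + x2) ^+ 2 + x2 * (1 + x1) ^+ 2 -> 0 <= p ->
  k ^+ 2 * p + (k ^+ 2 - 1) * M + (1 + x1 + x2) * t <= W.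
Proof.
move=> pG p0; rewrite /triangle_bound !lerD2r ler_wpM2l // sqr_ge0 //.
Qed.

Lemma triangle_bound_weak p : p <= x1 * (1 + x2) ^+ 2 + x2 * (1 + x1) ^+ 2 -> 0 <= p ->
  k * p <= W.
Proof.
move=> pG p0; apply: le_trans (triangle_bound_main pG p0).
have kk : k * p <= k ^+ 2 * p.
  by rewrite ler_wpM2r // expr2 ler_peMr ?addr_ge0 ?(ltW t0) // lerDl ltW.
have : 0 <= (1 + x1 + x2) * t by rewrite mulr_ge0 ?addr_ge0 ?ltW.
have := tail0; move: x10 x20 t0 x12; lra.
Qed.

(** With [s = k^2 (1 + x2 / M)] the excess [(s - 1) M] contains [x2] and not [x2 M]; the weaker
    bound [1 + x2] for the squared norm of a pivot would not do here. *)
Lemma triangle_bound_direct :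
  k ^+ 2 * (1 + x2 / M) * x1 + (k ^+ 2 * (1 + x2 / M) - 1) * M <= W.
Proof.
have M0 : 0 < M by exact: lt_le_trans ltr01 M1.
have dM : x2 / M <= x2 by rewrite ler_pdivrMr // ler_peMr // ltW.
have dM0 : 0 <= x2 / M by rewrite divr_ge0 // ltW.
have -> : k ^+ 2 * (1 + x2 / M) * x1 + (k ^+ 2 * (1 + x2 / M) - 1) * M =
   k ^+ 2 * (x1 + x2 / M * x1 + x2) + (k ^+ 2 - 1) * M by field; rewrite gt_eqF.
apply: le_trans (triangle_bound_main (p := x1 + x2 / M * x1 + x2) _ _).
- by rewrite lerDl mulr_ge0 ?addr_ge0 ?ltW.
- have : x2 / M * x1 <= x2 * x1 by rewrite ler_wpM2r // ltW.
  have := x12; have := mulr_gt0 x10 (mulr_gt0 x20 x20); have := mulr_gt0 x20 (mulr_gt0 x10 x10).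
  rewrite !expr2; move: x10 x20 t0 x12; lra.
- by apply: addr_ge0; [apply: addr_ge0; [exact: ltW|exact: mulr_ge0 dM0 (ltW x10)]|exact: ltW].
Qed.

(** For [k = 1] the factor of [x2] is [1 + 2 x1 + 3/4 x1^2], below [(1 + x1)^2]; the summand
    [(1 + x1) * t] is the cost of the bridge. *)
Lemma triangle_bound_across :
  x2 * ((k * (1 + x1 / 2)) ^+ 2 + k * (1 + x1 / 2) * (k * x1)) + (1 + x1) * t + x1 <= W.
Proof.
pose p := x2 * ((1 + x1 / 2) ^+ 2 + (1 + x1 / 2) * x1) + x1.
have -> : x2 * ((k * (1 + x1 / 2)) ^+ 2 + k * (1 + x1 / 2) * (k * x1)) = k ^+ 2 * (p - x1).
  by rewrite /p; ring.
have p0 : 0 <= p - x1.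
  by rewrite /p addrK mulr_ge0 ?addr_ge0 ?sqr_ge0 ?mulr_ge0 ?addr_ge0 ?divr_ge0 ?ltW.
apply: le_trans (triangle_bound_main (p := p) _ _); last by move: x10 x20 t0 x12; lra.
- have h1 : (1 + x1) * t <= (1 + x1 + x2) * t.
    by rewrite ler_wpM2r ?(ltW t0) // lerDl ltW.
  have h2 : x1 <= k ^+ 2 * x1 by rewrite ler_peMl // ltW.
  have := tail0; rewrite mulrBr; move: x10 x20 t0 x12; lra.
- have := x12; have := mulr_gt0 x10 (mulr_gt0 x20 x20); have := mulr_gt0 x20 (mulr_gt0 x10 x10).
  rewrite /p !expr2; move: x10 x20 t0 x12; lra.
Qed.

Lemma triangle_bound_sum : x1 + x2 + t <= W.
Proof.
apply: le_trans (triangle_bound_main (p := x1 + x2) _ _); last by move: x10 x20 t0 x12; lra.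
- have h1 : x1 + x2 <= k ^+ 2 * (x1 + x2) by rewrite ler_peMl // addr_ge0 ?ltW.
  have h2 : t <= (1 + x1 + x2) * t.
    by rewrite ler_peMl ?(ltW t0) // -addrA lerDl addr_ge0 ?ltW.
  have := tail0; move: x10 x20 t0 x12; lra.
- have := x12; have := mulr_gt0 x10 (mulr_gt0 x20 x20); have := mulr_gt0 x20 (mulr_gt0 x10 x10).
  rewrite !expr2; move: x10 x20 t0 x12; lra.
Qed.

(** The left side is the Leibniz bound for [2 M] times the seminorm of the product of a pivot and a
    lift of the other pivot. *)
Lemma triangle_bound_pivot : (1 + x1 / 2) * (k * x2) + x1 * (k * (1 + x2 / 2)) <= W.
Proof.
have -> : (1 + x1 / 2) * (k * x2) + x1 * (k * (1 + x2 / 2)) = k * (x1 + x2 + x1 * x2).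
  by field.
apply: triangle_bound_weak; last by move: x10 x20 t0 x12; lra.
have := x12; have := mulr_gt0 x10 (mulr_gt0 x20 x20); have := mulr_gt0 x20 (mulr_gt0 x10 x10).
rewrite !expr2; move: x10 x20 t0 x12; lra.
Qed.

(** Here [m1] and [m2] are the values of the base point at a pivot and at the lift of the other
    pivot; the latter is compared with the value in the middle space at the rate [x1]. *)
Lemma triangle_bound_pin (m1 m2 : R[i]) : cabs (1 - m1) <= x1 ->
  cabs (1 - m2) <= x2 + x1 * (k * x2 / 2) -> cabs (1 - m1 * m2) <= W.
Proof.
move=> h1 h2.
have -> : 1 - m1 * m2 = (1 - m1) + m1 * (1 - m2) by ring.
have nm1 : cabs m1 <= 1 + x1.
  by have := cabsB 1 (1 - m1); rewrite subKr cabs1; move: x10 x20 t0 x12; lra.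
apply: le_trans (cabsD _ _) _; rewrite cabsM.
have h3 : cabs m1 * cabs (1 - m2) <= (1 + x1) * (x2 + x1 * (k * x2 / 2)).
  by apply: ler_pM; rewrite ?cabs_ge0.
have k0 : 1 <= k by rewrite lerDl ltW.
apply: le_trans (_ : k * (x1 + x2 * (1 + x1) * (1 + x1 / 2)) <= _).
  have h4 : x1 <= k * x1 by rewrite ler_peMl // ltW.
  have h5 : (1 + x1) * x2 <= k * ((1 + x1) * x2).
    by rewrite ler_peMl // mulr_ge0 ?addr_ge0 ?ltW.
  move: x10 x20 t0 x12; lra.
apply: triangle_bound_weak.
  have := x12; have := mulr_gt0 x10 (mulr_gt0 x20 x20); have := mulr_gt0 x20 (mulr_gt0 x10 x10).
  rewrite !expr2; move: x10 x20 t0 x12; lra.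
by rewrite addr_ge0 ?mulr_ge0 ?addr_ge0 ?divr_ge0 ?ltW.
Qed.

End TriangleBound.

(** * Composition of tunnels *)

Section Compose.
Variables (R : realType) (M : R).
Hypothesis M1 : 1 <= M.
Let M0 : 0 < M. Proof. exact: lt_le_trans ltr01 M1. Qed.

(** The sharp form serves the direct transport, the form [1 + x / 2] bounds the lifts in the
    sandwiches, and the last one enters the cost of the bridge. *)
Lemma pivot_norm_le (A : cstarType R) (e : A) (x : R) : 0 <= x ->
  M * rnorm e ^+ 2 <= M + x ->
  [/\ rnorm e ^+ 2 <= 1 + x / M, rnorm e <= 1 + x / 2 & rnorm e ^+ 2 <= 1 + x].
Proof.
move=> x0 h.
have h1 : rnorm e ^+ 2 <= 1 + x / M.
  have -> : 1 + x / M = (M + x) / M by field; rewrite gt_eqF.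
  by rewrite ler_pdivlMr // mulrC.
have xM : x / M <= x by rewrite ler_pdivrMr // ler_peMr.
have h2 : rnorm e ^+ 2 <= 1 + x by apply: le_trans h1 _; rewrite lerD2l.
split=> //; rewrite -ler_sqr ?nnegrE ?rnorm_ge0 ?addr_ge0 ?divr_ge0 //.
by apply: le_trans h2 _; have := sqr_ge0 x; rewrite !expr2; lra.
Qed.

Lemma sqr_scale_le (u v w k : R) : 0 <= u -> 0 <= k -> u <= k * v -> v ^+ 2 <= w ->
  u ^+ 2 <= k ^+ 2 * w.
Proof.
move=> u0 k0 uv vw; apply: le_trans (_ : (k * v) ^+ 2 <= _).
  by rewrite ler_sqr ?nnegrE // (le_trans u0).
by rewrite exprMn ler_wpM2l ?sqr_ge0.
Qed.

Lemma mk_scale (A : cstarType R) (L : lipdata A) (f g : A -> R[i]) a (c l : R) :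
  seminorm_on_dom L -> scalar f -> scalar g -> 0 < l ->
  (forall b, ldom_sa L b -> L b <= 1 -> cabs (f b - g b) <= c) ->
  ldom_sa L a -> L a <= l -> cabs (f a - g a) <= c * l.
Proof.
move=> semi lf lg l0 h da la.
have il0 : 0 <= l^-1 by rewrite invr_ge0 ltW.
have := h (l^-1%:C *: a) (dom_saZr semi _ da).
rewrite (lipZr semi _ da.1) (ger0_norm il0) ler_pdivrMl // mulr1 => /(_ la).
by rewrite !functionalZ // -mulrBr cabsM cabs_nneg // ler_pdivrMl // mulrC.
Qed.

Variables (AA BB DD : pointed_proper_qms R).
Variables (tau1 : tunnel M AA BB) (tau2 : tunnel M BB DD).
Variables (x1 x2 t : R).
Hypotheses (x10 : 0 < x1) (x20 : 0 < x2) (t0 : 0 < t).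
Hypotheses (b1 : tunnel_bound tau1 x1) (b2 : tunnel_bound tau2 x2).

Local Notation T1 := (tn_D tau1).
Local Notation T2 := (tn_D tau2).
Local Notation q := (@tn_piA _ _ _ _ tau1).
Local Notation p1 := (@tn_piB _ _ _ _ tau1).
Local Notation p2 := (@tn_piA _ _ _ _ tau2).
Local Notation r := (@tn_piB _ _ _ _ tau2).
Local Notation e1 := (tn_e tau1).
Local Notation e2 := (tn_e tau2).
Local Notation W := (triangle_bound M x1 x2 t).
Local Notation k := (1 + t).

Let iq := tn_isoA tau1.
Let i1 := tn_isoB tau1.
Let i2 := tn_isoA tau2.
Let ir := tn_isoB tau2.
Let leg1 := leg_isometry i1.
Let leg2 := leg_isometry i2.
Let G := glued leg1 leg2 t0.

Lemma tunnel_composition : exists tau : tunnel M AA DD, tunnel_bound tau W.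
Proof.
have k0 : 0 < k by rewrite addr_gt0.
(* Lifting with tolerance [ln k] costs the factor [k = 1 + t] in norm and in seminorm. *)
have lk : expR (ln k) = k by rewrite lnK // posrE.
have lk0 : 0 < ln k by rewrite ln_gt0 // ltrDl.
have [f1 [Mf1 df1 pf1 nf1 Lf1]] :=
  cross_lift_topographic M0 i2 i1 (tn_e_dom tau2) (tn_e_M tau2) lk0.
have [f2 [Mf2 df2 pf2 nf2 Lf2]] :=
  cross_lift_topographic M0 i1 i2 (tn_e_dom tau1) (tn_e_M tau1) lk0.
rewrite lk in nf1 Lf1 nf2 Lf2.
have de1 := tn_e_dom tau1; have de2 := tn_e_dom tau2.
have Me1 := tn_e_M tau1; have Me2 := tn_e_M tau2.
have [[[_ mul1 _] _ c1] _] := tq_topography T1.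
have [[[_ mul2 _] _ c2] _] := tq_topography T2.
have comm1 := c1 _ _ Me1 Mf1; have comm2 := c2 _ _ Me2 Mf2.
have [Dm1 Leib1] := sqlcms_leibniz (tq_sqlcms T1).
have [Dm2 Leib2] := sqlcms_leibniz (tq_sqlcms T2).
have dg1 : ldom_sa (tq_L T1) (e1 ** f1).
  split; first exact: Dm1 de1.1 df1.1.
  by rewrite /sa /= starM de1.2 df1.2 comm1.
have dg2 : ldom_sa (tq_L T2) (e2 ** f2).
  split; first exact: Dm2 de2.1 df2.1.
  by rewrite /sa /= starM de2.2 df2.2 comm2.
pose g : G := (e1 ** f1, e2 ** f2).
have dg : ldom_sa (tq_L G) g by apply/glue_dom_saP.
have Mg : tq_M G g by split; [exact: mul1|exact: mul2].
have pin : is_pin (tq_L G) (pq_mu AA \o (q \o fst : G -> AA)).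
  exact: glue_pin (tn_pin tau1) (leg_character (leg_isometry iq)) (tn_pin tau2).
have isoA := glue_isometry_fst M0 i1 i2 t0 iq.
have isoB := glue_isometry_snd M0 i1 i2 t0 ir.
exists (@Tunnel R M AA DD G (q \o fst) (r \o snd) g dg Mg isoA isoB pin).
have [rq rp1 mk1 Le1 [mq1 mp1]] := b1; have [rp2 rr mk2 Le2 [mp2 mr2]] := b2.
have [ne1 ne1' ne1''] := pivot_norm_le (ltW x10)
  (pivot_norm M1 iq (tn_pin tau1) de1 Me1 rq).
have [ne2 ne2' ne2''] := pivot_norm_le (ltW x20)
  (pivot_norm M1 i2 (tn_pin tau2) de2 Me2 rp2).
have M20 : 0 < 2 * M by rewrite mulr_gt0.
have Lf1' : 2 * M * tq_L T1 f1 <= k * x2.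
  apply: le_trans (ler_wpM2l (ltW M20) Lf1) _.
  by rewrite mulrCA ler_wpM2l // ltW.
have Lf2' : 2 * M * tq_L T2 f2 <= k * x1.
  apply: le_trans (ler_wpM2l (ltW M20) Lf2) _.
  by rewrite mulrCA ler_wpM2l // ltW.
have nf1' : rnorm f1 <= k * (1 + x2 / 2).
  by apply: le_trans nf1 _; rewrite ler_wpM2l // ltW.
have nf2' : rnorm f2 <= k * (1 + x1 / 2).
  by apply: le_trans nf2 _; rewrite ler_wpM2l // ltW.
have sq1 := sqr_scale_le (rnorm_ge0 f1) (ltW k0) nf1 ne2.
have sq2 := sqr_scale_le (rnorm_ge0 f2) (ltW k0) nf2 ne1.
have s_ge1 x : 0 <= x -> 1 <= k ^+ 2 * (1 + x / M).
  move=> x0; have k1 : 1 <= k ^+ 2 by rewrite expr_ge1 ?(ltW k0) // lerDl ltW.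
  have : 1 <= 1 + x / M by rewrite lerDl divr_ge0 // ltW.
  by move=> h; apply: le_trans h _; rewrite ler_peMl // addr_ge0 ?divr_ge0 ?(ltW M0).
have parts (phi : G -> R[i]) : quasi_state_space G phi -> exists n1 n2,
    [/\ positive_functional (part1 phi), positive_functional (part2 phi),
        fbound (part1 phi) n1, fbound (part2 phi) n2 &
        [/\ 0 <= n1, 0 <= n2 & n1 + n2 <= 1]].
  move=> /quasi_stateP[pos bd]; have [lin _] := pos.
  have P1 := part1_positive pos; have P2 := part2_positive pos.
  have h1 := part1_bound ler01 bd; have h2 := part2_bound ler01 bd.
  have [l1 _] := P1; have [l2 _] := P2.
  exists (fnorm (part1 phi)), (fnorm (part2 phi)); split=> //.
  - exact: fnorm_bound l1 ler01 h1.
  - exact: fnorm_bound l2 ler01 h2.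
  - split; [exact: fnorm_ge0 l1 ler01 h1|exact: fnorm_ge0 l2 ler01 h2|].
    by apply: le_trans (fnorm_part_le lin bd) (fnorm_le lin ler01 bd).
have g_pe (phi : G -> R[i]) d : scalar phi -> phi (g ** d ** g) =
    part1 phi ((e1 ** f1) ** d.1 ** (e1 ** f1)) +
    part2 phi ((e2 ** f2) ** d.2 ** (e2 ** f2)).
  by move=> lin; rewrite (partE _ lin).
split.
- move=> phi qphi; have [n1 [n2 [P1 P2 h1 h2 [n10 n20 n12]]]] := parts _ qphi.
  have /quasi_stateP[[lin _] _] := qphi.
  have [psi qpsi hpsi] := component_reach M1 i1 i2 iq df1 de2 df2 comm1 comm2
    pf2 rq rp2 sq1 (s_ge1 _ (ltW x20)) nf2' Lf2' ne1'' (ltW t0)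
    (triangle_bound_direct M1 x10 x20 t0) (triangle_bound_across M1 x10 x20 t0)
    P1 P2 h1 h2 n10 n20 n12.
  exists psi => // d /glue_dom_saP[d1 d2] /(glue_lip_norm_leP _ _ t0 _ _ M0)[l1 l2 l3].
  by rewrite mulr1 in l3; rewrite /= g_pe //; exact: hpsi.
(* The second inclusion is the first with the two tunnels exchanged; [triangle_boundC] makes the
   bounds agree. *)
- move=> phi qphi; have [n1 [n2 [P1 P2 h1 h2 [n10 n20 n12]]]] := parts _ qphi.
  have /quasi_stateP[[lin _] _] := qphi; rewrite addrC in n12.
  have [psi qpsi hpsi] := component_reach M1 i2 i1 ir df2 de1 df1 comm2 comm1
    pf1 rr rp1 sq2 (s_ge1 _ (ltW x10)) nf1' Lf1' ne2'' (ltW t0)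
    (triangle_bound_direct M1 x20 x10 t0) (triangle_bound_across M1 x20 x10 t0)
    P2 P1 h2 h1 n20 n10 n12.
  exists psi => // d /glue_dom_saP[d1 d2] /(glue_lip_norm_leP _ _ t0 _ _ M0)[l1 l2 l3].
  rewrite mulr1 in l3; rewrite /= g_pe // (addrC (part1 phi _)) triangle_boundC.
  by apply: hpsi => //; rewrite rdistC.
- move=> d /glue_dom_saP[d1 d2] /(glueL_leP _ _ t0)[l1 l2 l3] /=.
  have /stateP[[lnu _] bnu _] := leg_state leg1.
  rewrite mulr1 in l3; have h3 : cabs (pq_mu BB (p1 d.1) - pq_mu BB (p2 d.2)) <= t.
    by rewrite -functionalB //; apply: le_trans (bnu _) _; rewrite mul1r.
  have h1 := mk1 _ d1 l1; have h2 := mk2 _ d2 l2.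
  apply: le_trans (triangle_bound_sum M1 x10 x20 t0).
  have -> : pq_mu AA (q d.1) - pq_mu DD (r d.2) =
    (pq_mu AA (q d.1) - pq_mu BB (p1 d.1)) + (pq_mu BB (p1 d.1) - pq_mu BB (p2 d.2)) +
    (pq_mu BB (p2 d.2) - pq_mu DD (r d.2)) by ring.
  apply: le_trans (cabsD _ _) _.
  by have := cabsD (pq_mu AA (q d.1) - pq_mu BB (p1 d.1)) (pq_mu BB (p1 d.1) - pq_mu BB (p2 d.2)); lra.
- rewrite mulrC -ler_pdivlMr //; apply/(glueL_leP _ _ t0) => /=.
  rewrite !ler_pdivlMr //.
  have cross (T : topographic_sqlcms R) (e f : T) (y1 y2 : R) : 0 < y1 ->
      ldom_sa (tq_L T) e -> ldom_sa (tq_L T) f ->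
      rnorm e <= 1 + y1 / 2 -> rnorm f <= k * (1 + y2 / 2) ->
      2 * M * tq_L T e <= y1 -> 2 * M * tq_L T f <= k * y2 ->
      tq_L T (e ** f) * (2 * M) <= (1 + y1 / 2) * (k * y2) + y1 * (k * (1 + y2 / 2)).
    move=> y10 [de _] [df _] he hf le lf.
    have [_ Leib] := sqlcms_leibniz (tq_sqlcms T).
    have semi := sqlcms_seminorm (tq_sqlcms T).
    apply: le_trans (ler_wpM2r (ltW M20) (Leib _ _ de df)) _.
    rewrite mulrDl; apply: lerD.
      rewrite -mulrA (mulrC (tq_L T f)); apply: ler_pM; rewrite ?rnorm_ge0 //.
      by rewrite mulr_ge0 ?(ltW M20) // (lip_ge0 semi).
    rewrite mulrAC (mulrC (tq_L T e)); apply: ler_pM; rewrite ?rnorm_ge0 //.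
    by rewrite mulr_ge0 ?(ltW M20) // (lip_ge0 semi).
  split.
  + apply: le_trans (triangle_bound_pivot M1 x10 x20 t0); exact: cross.
  + rewrite triangle_boundC.
    apply: le_trans (triangle_bound_pivot M1 x20 x10 t0); exact: cross.
  + rewrite (star_morphismM (qi_morphism (tqi_isometry i1))).
    rewrite (star_morphismM (qi_morphism (tqi_isometry i2))) pf1 pf2.
    (* The components of the pivot have the same two factors in [BB], in opposite orders; these
       commute in the topography, so the bridge term vanishes. *)
    have [[[_ _ _] _ cB] _] := tq_topography BB.
    have MB1 : tq_M BB (p1 e1) by apply: (tqi_sub i1); exists e1.
    have MB2 : tq_M BB (p2 e2) by apply: (tqi_sub i2); exists e2.
    rewrite (cB _ _ MB1 MB2) subrr rnorm0 mulr_ge0 ?(ltW t0) // divr_ge0 ?(ltW M20) //.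
    apply: le_trans (triangle_bound_sum M1 x10 x20 t0).
    by rewrite !addr_ge0 // ltW.
- have semi1 := sqlcms_seminorm (tq_sqlcms T1); have semi2 := sqlcms_seminorm (tq_sqlcms T2).
  have lin_pull (T : topographic_sqlcms R) (CC : pointed_proper_qms R) (p : T -> CC) :
      topographic_quantum_isometry M p -> scalar (pq_mu CC \o p).
    move=> i; have /stateP[[l _] _ _] := (leg_character (leg_isometry i)).1.
    exact: l.
  have mult (T : topographic_sqlcms R) (CC : pointed_proper_qms R) (p : T -> CC) :
      topographic_quantum_isometry M p -> forall a b, tq_M T a -> tq_M T b ->
      pq_mu CC (p (a ** b)) = pq_mu CC (p a) * pq_mu CC (p b).
    by move=> i a b Ma Mb; exact: (leg_character (leg_isometry i)).2.1.
  have half (y u : R) : 0 < y -> 2 * M * u <= k * y -> u <= k * y / 2.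
    move=> y0 h; have ky0 : 0 <= k * y / 2 by rewrite divr_ge0 ?mulr_ge0 ?ltW.
    rewrite -(ler_pM2l M20); apply: (le_trans h).
    have -> : 2 * M * (k * y / 2) = M * (k * y) by field.
    by rewrite ler_peMl // mulr_ge0 ?ltW.
  have half0 (y : R) : 0 < y -> 0 < k * y / 2 by move=> y0; rewrite divr_gt0 ?mulr_gt0.
  split; rewrite /=.
  + rewrite (mult _ _ _ iq) //; apply: (triangle_bound_pin M1 x10 x20 t0) => //.
    (* [f1] has the image of [e2] in [BB], where the second tunnel controls the value; [mk1] carries
       this over to the base point of [AA]. *)
    have h := mk_scale semi1 (lin_pull _ _ _ iq) (lin_pull _ _ _ i1) (half0 _ x20) mk1 df1
      (half _ _ x20 Lf1').
    rewrite /= pf1 in h.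
    have -> : 1 - pq_mu AA (q f1) =
      (1 - pq_mu BB (p2 e2)) - (pq_mu AA (q f1) - pq_mu BB (p2 e2)) by ring.
    by apply: le_trans (cabsB _ _) _; apply: lerD.
  + rewrite (mult _ _ _ ir) // triangle_boundC.
    apply: (triangle_bound_pin M1 x20 x10 t0) => //.
    have h := mk_scale semi2 (lin_pull _ _ _ i2) (lin_pull _ _ _ ir) (half0 _ x10) mk2 df2
      (half _ _ x10 Lf2').
    rewrite /= pf2 in h.
    have -> : 1 - pq_mu DD (r f2) =
      (1 - pq_mu BB (p1 e1)) + (pq_mu BB (p1 e1) - pq_mu DD (r f2)) by ring.
    by apply: le_trans (cabsD _ _) _; apply: lerD.
Qed.

End Compose.

(** * The metametric *)

Section Metametric.
Variables (R : realType) (M : R).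
Hypothesis M1 : 1 <= M.
Let M0 : 0 < M. Proof. exact: lt_le_trans ltr01 M1. Qed.
Implicit Types AA BB DD : pointed_proper_qms R.

Lemma metametric_ge0 AA BB : (0 <= metametric M AA BB)%E.
Proof. by apply: le_ereal_inf_tmp => _ [tau ->]; exact: extent_ge0. Qed.

Lemma metametric_le AA BB (tau : tunnel M AA BB) (x : R) : 0 < x ->
  tunnel_bound tau x -> (metametric M AA BB <= x%:E)%E.
Proof.
move=> x0 b; apply: le_trans (_ : extent tau <= _)%E; last exact: extent_le_bound.
by apply: ereal_inf_lbound; exists tau.
Qed.

Lemma metametric_lt AA BB (x : R) : (metametric M AA BB < x%:E)%E ->
  exists tau : tunnel M AA BB, tunnel_bound tau x.
Proof.
by move=> /ereal_inf_lt[_ [tau ->] /extent_lt_bound b]; exists tau; exact: b.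
Qed.

(* The two base points are at finite distance, so mu_B o pi_B is a pin too. *)
Lemma tunnel_swap AA BB (tau : tunnel M AA BB) :
  exists tau' : tunnel M BB AA, forall x, tunnel_bound tau x -> tunnel_bound tau' x.
Proof.
pose piA := @tn_piA _ _ _ _ tau; pose piB := @tn_piB _ _ _ _ tau.
have legA : leg piA (pq_mu AA) := leg_isometry (tn_isoA tau).
have legB : leg piB (pq_mu BB) := leg_isometry (tn_isoB tau).
have pin : is_pin (tq_L (tn_D tau)) (pq_mu BB \o piB).
  split; first by case: (leg_character legB).
  have [_ /weak_star_denseP dens] := tn_pin tau.
  apply/weak_star_denseP => phi sphi s r r0.
  have [psi [spsi mkpsi] close] := dens phi sphi s r r0.
  exists psi => //; split=> //; apply: mk_tri mkpsi _.
  exact: mk_character_states (leg_unital legA) (leg_character legA) (leg_character legB).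
exists (@Tunnel R M BB AA (tn_D tau) piB piA (tn_e tau) (tn_e_dom tau) (tn_e_M tau)
  (tn_isoB tau) (tn_isoA tau) pin).
move=> x [rA rB mk e [mA mB]]; split=> // a da la.
by rewrite cdistC; exact: mk.
Qed.

Lemma metametric_sym_le AA BB : (metametric M BB AA <= metametric M AA BB)%E.
Proof.
apply/lee_addgt0Pr => e e0.
have := metametric_ge0 AA BB; case E : (metametric M AA BB) => [x| |] x0 //.
  2: by rewrite addye ?leey.
have [tau b] : exists tau : tunnel M AA BB, tunnel_bound tau (x + e).
  by apply: metametric_lt; rewrite E lte_fin ltrDl.
have [tau' b'] := tunnel_swap tau.
rewrite lee_fin in x0; rewrite -EFinD.
by apply: metametric_le (b' _ b); rewrite ltr_wpDl.
Qed.

Lemma metametric_sym AA BB : metametric M BB AA = metametric M AA BB.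
Proof. by apply/eqP; rewrite eq_le !metametric_sym_le. Qed.

(** The given isometry supplies the approximate unit that properness of the identity asks for. *)
Lemma isometry_id (AA BB : topographic_sqlcms R) (pi : AA -> BB) :
  topographic_quantum_isometry M pi -> topographic_quantum_isometry M (id : AA -> AA).
Proof.
move=> iso; split.
- split=> //.
  + by move=> a; exists a.
  + have [I [le [v [hv _]]]] := qi_proper (tqi_isometry iso).
    by exists I, le, v.
  + by apply/seteqP; split=> [_ [a da <-]|a da] //; exists a.
  + move=> a da; apply/quotient_normP; split; first by move=> d _ ->.
    by move=> e e0; exists a; split=> //; rewrite lerDl ltW.
- by move=> _ [a Ma <-].
- move=> a e da Ma e0; exists a; split=> //.
    rewrite ler_peMl ?rnorm_ge0 //.
    by apply: le_trans (expR_ge1Dx _); rewrite lerDl ltW.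
  rewrite ler_peMl //; first exact: lip_ge0 (sqlcms_seminorm (tq_sqlcms AA)) _ da.1.
  by apply: le_trans (expR_ge1Dx _); rewrite lerDl ltW.
Qed.

(** The space is its own tunnel, with the identity and [pi] as projections. The pivot is an almost
    unit of norm at most 1, so compressed quasi-states are again quasi-states and the inclusions are
    exact. *)
Lemma metametric_isometric AA BB (pi : AA -> BB) :
  full_topographic_quantum_isometry M pi -> pq_mu BB \o pi = pq_mu AA ->
  metametric M AA BB = 0%E.
Proof.
move=> [iso [rho [piK rhoK iso']]] mu_pi.
apply/eqP; rewrite eq_le metametric_ge0 andbT.
apply/lee_addgt0Pr => e e0; rewrite add0e.
have iid := isometry_id iso.
have pin := pp_pin (pq_pointed_proper AA).
(* This yields [2 M eta <= e] for the seminorm of the pivot and [2 eta <= e] for its value at the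
   base point. *)
pose eta := Num.min 1 (e / (2 + 2 * M)).
have eta0 : 0 < eta by rewrite lt_min ltr01 divr_gt0 // addr_gt0 // mulr_gt0.
have etae : eta * (2 + 2 * M) <= e.
  by rewrite -ler_pdivlMr ?addr_gt0 ?mulr_gt0 // ge_min lexx orbT.
clearbody eta.
have [d [Md dd nd Ld md]] := pinned_lift iid eta0.
have k0 : 0 < 1 + eta by rewrite addr_gt0.
pose h := (1 + eta)^-1%:C *: d.
have ik0 : 0 <= (1 + eta)^-1 by rewrite invr_ge0 ltW.
have ik1 : (1 + eta)^-1 <= 1 by rewrite invf_le1 // lerDl ltW.
have semi := sqlcms_seminorm (tq_sqlcms AA).
have dh : ldom_sa (tq_L AA) h := dom_saZr semi _ dd.
have [[[[M_0 linM] _ _] _ _] _] := tq_topography AA.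
have Mh : tq_M AA h by rewrite -[h]addr0; exact: linM.
have nh : rnorm h <= 1.
  by rewrite rnormZr ger0_norm // ler_pdivrMl // mulr1.
pose tau := @Tunnel R M AA BB AA id pi h dh Mh iid iso pin.
apply: (@metametric_le _ _ tau) => //.
have compress phi : quasi_state_space AA phi ->
    quasi_state_space AA (fun a => phi (h ** a ** h)).
  move=> /quasi_stateP[pos bd]; apply/quasi_stateP; split.
    exact: positive_compress dh.2 pos.
  apply: fbound_weaken (fbound_compress h ler01 bd).
  by rewrite mul1r expr_le1 ?rnorm_ge0.
have [[lmu _] bmu _] := (stateP _).1 pin.1.
have pivot : cabs (1 - pq_mu AA h) <= e.
  rewrite /h functionalZ //.
  have -> : 1 - (1 + eta)^-1%:C * pq_mu AA d =
     (1 + eta)^-1%:C * (eta%:C + (1 - pq_mu AA d)).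
    rewrite fmorphV rmorphD rmorph1; field.
    by rewrite -(rmorph1 (real_complex R)) -rmorphD fmorph_eq0 gt_eqF.
  rewrite cabsM cabs_nneg //.
  apply: le_trans (_ : cabs (eta%:C + (1 - pq_mu AA d)) <= _).
    by rewrite ler_piMl // cabs_ge0.
  apply: le_trans (cabsD _ _) _; rewrite (cabs_nneg (ltW eta0)) cdistC.
  apply: le_trans (lerD (lexx _) md) _.
  by have := mulr_gt0 eta0 M0; lra.
split.
- move=> phi qphi; exists (fun a => phi (h ** a ** h)); first exact: compress.
  by move=> a _ _; rewrite subrr cabs0 ltW.
- move=> phi qphi; exists ((fun a => phi (h ** a ** h)) \o rho).
    exact: quasi_state_pullback (qi_morphism (tqi_isometry iso')) _ (compress _ qphi).
  by move=> a _ _; rewrite /= piK subrr cabs0 ltW.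
- move=> a _ _; rewrite /= -mu_pi /= subrr cabs0 ltW //.
- rewrite /= /h (lipZr semi _ dd.1) ger0_norm //.
  apply: le_trans (_ : 2 * M * eta <= _); last by lra.
  rewrite ler_wpM2l ?mulr_ge0 ?(ltW M0) //; apply: le_trans Ld.
  by rewrite ler_piMl // (lip_ge0 semi dd.1).
- split=> //=; move: pivot; rewrite -mu_pi /=.
  by [].
Qed.

Lemma metametric_triangle_bound AA BB DD (x1 x2 t : R) : 0 < x1 -> 0 < x2 -> 0 < t ->
  (metametric M AA BB < x1%:E)%E -> (metametric M BB DD < x2%:E)%E ->
  (metametric M AA DD <= (triangle_bound M x1 x2 t)%:E)%E.
Proof.
move=> x10 x20 t0 /metametric_lt[tau1 b1] /metametric_lt[tau2 b2].
have [tau b] := tunnel_composition M1 x10 x20 t0 b1 b2.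
apply: metametric_le b; apply: lt_le_trans (triangle_bound_sum M1 x10 x20 t0).
by rewrite !addr_gt0.
Qed.

(** The bound is a polynomial in [t], hence continuous at 0. The shifts of [x1] and [x2] are there
    because the infima need not be attained and may be 0. *)
Lemma triangle_bound_limit (x1 x2 m : R) :
  (forall t, 0 < t -> m <= triangle_bound M (x1 + t) (x2 + t) t) ->
  m <= x1 * (1 + x2) ^+ 2 + x2 * (1 + x1) ^+ 2.
Proof.
move=> h.
pose y1 : {poly R} := x1%:P + 'X; pose y2 : {poly R} := x2%:P + 'X.
pose p : {poly R} := (1 + 'X) ^+ 2 * (y1 * (1 + y2) ^+ 2 + y2 * (1 + y1) ^+ 2) +
  ((1 + 'X) ^+ 2 - 1) * M%:P + (1 + y1 + y2) * 'X.
have pE t : p.[t] = triangle_bound M (x1 + t) (x2 + t) t.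
  by rewrite /p /y1 /y2 /triangle_bound !hornerE.
have -> : x1 * (1 + x2) ^+ 2 + x2 * (1 + x1) ^+ 2 = p.[0].
  by rewrite pE /triangle_bound; ring.
have pc : p.[t] @[t --> 0^'+] --> p.[0].
  by apply: cvg_at_right_filter; exact: continuous_horner.
apply: (cvgr_to_ge pc); near=> t; rewrite pE; apply: h.
by near: t; exact: nbhs_right_gt.
Unshelve. all: by end_near.
Qed.

Lemma metametric_triangle AA BB DD :
  (metametric M AA DD <=
     metametric M AA BB * (1 + metametric M BB DD) ^+ 2 +
     metametric M BB DD * (1 + metametric M AA BB) ^+ 2)%E.
Proof.
have := @metametric_triangle_bound AA BB DD.
have := metametric_ge0 AA DD; move: (metametric M AA DD) => z z0.
have := metametric_ge0 AA BB; have := metametric_ge0 BB DD.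
move: (metametric M AA BB) (metametric M BB DD) => u v v0 u0 h.
have sq (w : \bar R) : (0 <= w)%E -> (1 <= (1 + w) ^+ 2)%E.
  by move=> w0; rewrite expe2 -[leLHS]mule1 lee_pmul // leeDl.
(* An infinite distance makes one summand infinite, its cofactor being at least 1; the other summand
   is nonnegative, whatever 0 times infinity is. *)
have infty (w w' : \bar R) : (0 <= w)%E -> (0 <= w')%E ->
    (+oo * (1 + w) ^+ 2 + w * w' = +oo)%E.
  move=> w0 w1; rewrite gt0_mulye ?(lt_le_trans _ (sq _ w0)) // addye //.
  by rewrite gt_eqF // (lt_le_trans ltNy0) // mule_ge0.
have sq0 (w : \bar R) : (0 <= w)%E -> (0 <= (1 + w) ^+ 2)%E.
  by move=> /sq; apply: le_trans; rewrite lee01.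
case: u u0 h => [x1| |] // u0 h; last by rewrite infty ?leey ?sq0.
case: v v0 h => [x2| |] // v0 h; last by rewrite addeC infty ?leey ?sq0.
rewrite !lee_fin in u0 v0.
have tri t : 0 < t -> (z <= (triangle_bound M (x1 + t) (x2 + t) t)%:E)%E.
  by move=> t0; apply: h; rewrite ?lte_fin ?ltrDl ?ltr_wpDl.
case: z z0 tri {h} => [m| |] // _ tri; last by have := tri 1 ltr01.
rewrite -!EFinD lee_fin -!expr2.
by apply: triangle_bound_limit => t /tri; rewrite lee_fin.
Qed.

End Metametric.

Theorem theorem2p24 (R : realType) (M : R) (hM : 1 <= M) :
  [/\ forall AA BB : pointed_proper_qms R,
        (exists2 pi : AA -> BB, full_topographic_quantum_isometry M pi
           & pq_mu BB \o pi = pq_mu AA) ->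
        metametric M AA BB = 0%E,
      forall AA BB : pointed_proper_qms R,
        metametric M BB AA = metametric M AA BB &
      forall AA BB DD : pointed_proper_qms R,
        (metametric M AA DD <=
           metametric M AA BB * (1 + metametric M BB DD) ^+ 2 +
           metametric M BB DD * (1 + metametric M AA BB) ^+ 2)%E].
Proof.
split=> [AA BB [pi iso mu_pi]|AA BB|AA BB DD].
- exact: metametric_isometric iso mu_pi.
- exact: metametric_sym.
- exact: metametric_triangle.
Qed.
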